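(* The von Neumann algebras $Q_P^{(m,N)}=\{Q^{(m,N)},P_U^{(m,N)}\}''$, $\left(M_m(X^N)\rtimes S_N\right)\otimes\mathrm{End}(A_N)$ and $\{Q^{(m,N)},\{U(b)\}_{b\in B_N}\}''$ are isomorphic.
   Context: Let $X$ be a smooth connected Riemannian manifold and $G$ an infinite discrete ICC group (every non-trivial conjugacy class is infinite) acting freely on $X$ by isometries so that $X\to K=X/G$ is a Galois cover of a compact Riemannian manifold $K$. Fix $N\ge2$ and $0\le m\le N\dim X$. The braid group $B_N$ is generated by $b_1,\dots,b_{N-1}$ with relations $b_ib_j=b_jb_i$ for $|i-j|\ge2$ and $b_ib_jb_i=b_jb_ib_j$ for $|i-j|=1$; $\phi:B_N\to S_N$ is the canonical homomorphism onto the symmetric group, sending $b_i$ to the transposition of $i,i+1$; $B_N^{pure}=\ker\phi$. $A_N$ is a finite-dimensional commutative algebra that is also a finite-dimensional Hilbert space, $\mathrm{End}(A_N)$ is the algebra of linear operators on it, and $\pi:B_N\to\mathrm{End}(A_N)$ is a unitary representation such that $A_N^\pi=\{a\in A_N:\pi(b)a=a\ \forall b\in B_N^{pure}\}$ is a subalgebra of $A_N$. $L^2\Omega^m(X^N)$ is the space of square-integrable $m$-forms on $X^N$; $\mathfrak S(\sigma)$, $\sigma\in S_N$, acts on it by pullback by $(x_1,\dots,x_N)\mapsto(x_{\sigma(1)},\dots,x_{\sigma(N)})$; $U(b)=\mathfrak S(\phi(b))\otimes\pi(b)$ acts on $L^2\Omega^m(X^N)\otimes A_N$; $P_U^{(m,N)}$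 is the orthogonal projection onto the subspace of $U(B_N)$-invariant elements. $M_m(X^N)$ is the commutant of the natural unitary action of $G^N$ on $L^2\Omega^m(X^N)$ (a $\mathrm{II}_\infty$-factor), and $Q^{(m,N)}=M_m(X^N)\otimes\mathrm{End}(A_N)$. The crossed product $M_m(X^N)\rtimes S_N$ is with respect to the action $\alpha_\sigma(x)=\mathfrak S(\sigma)x\mathfrak S(\sigma)^*$. For a set $Y$ of operators, $Y''$ denotes the von Neumann algebra it generates. *)

(* Defs.v *)
From HB Require Import structures.
From mathcomp Require Import all_boot all_order all_algebra all_fingroup all_field.
From mathcomp Require Import generic_quotient sesquilinear complex.
From mathcomp Require Import all_classical all_reals all_analysis.
Set Implicit Arguments.
Unset Strict Implicit.
Unset Printing Implicit Defensive.
Import Order.TTheory GRing.Theory Num.Theory numFieldNormedType.Exports.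
Local Open Scope classical_set_scope.
Local Open Scope ring_scope.
Local Open Scope quotient_scope.

Section Braid.
Variable N : nat.

(* (i, true) and (i, false) stand for b_{i+1} and its inverse. *)
Definition braid_word := seq ('I_N.-1 * bool).

Inductive braid_eq : braid_word -> braid_word -> Prop :=
| braid_refl w : braid_eq w w
| braid_sym v w : braid_eq v w -> braid_eq w v
| braid_trans u v w : braid_eq u v -> braid_eq v w -> braid_eq u w
| braid_cat u u' v v' :
    braid_eq u u' -> braid_eq v v' -> braid_eq (u ++ v) (u' ++ v')
| braid_cancel i e : braid_eq [:: (i, e); (i, ~~ e)] [::]
| braid_comm (i j : 'I_N.-1) : (i.+1 < j)%N ->
    braid_eq [:: (i, true); (j, true)] [:: (j, true); (i, true)]
| braid_braid (i j : 'I_N.-1) : j = i.+1 :> nat ->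
    braid_eq [:: (i, true); (j, true); (i, true)]
             [:: (j, true); (i, true); (j, true)].

Definition braid_eqb (v w : braid_word) : bool := `[< braid_eq v w >].

Lemma braid_eqb_equiv : equiv_class_of braid_eqb.
Proof.
split=> [w|v w|v u w]; first by apply/asboolP; exact: braid_refl.
  by apply/asboolP/asboolP; exact: braid_sym.
by move=> /asboolP uv /asboolP vw; apply/asboolP; exact: braid_trans uv vw.
Qed.

Canonical braid_equiv := EquivRelPack braid_eqb_equiv.

Definition braid := {eq_quot braid_equiv}.
HB.instance Definition _ := Choice.on braid.
HB.instance Definition _ := EqQuotient.on braid.

Definition braid_of_word (w : braid_word) : braid := \pi_braid w.

Lemma braid_eqP v w : braid_of_word v = braid_of_word w <-> braid_eq v w.
Proof.
split; first by move=> /eqmodP /asboolP.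
by move=> ?; apply/eqmodP/asboolP.
Qed.

Lemma braid_repr b : braid_of_word (repr b) = b.
Proof. exact: reprK. Qed.

Lemma repr_braid w : braid_eq (repr (braid_of_word w)) w.
Proof. by apply/braid_eqP; rewrite braid_repr. Qed.

Definition inv_word (w : braid_word) : braid_word :=
  rev [seq (l.1, ~~ l.2) | l <- w].

Lemma inv_wordK : involutive inv_word.
Proof.
move=> w; rewrite /inv_word map_rev revK -map_comp -[RHS]map_id.
by apply: eq_map => -[i e] /=; rewrite negbK.
Qed.

Lemma cat_inv_word w : braid_eq (w ++ inv_word w) [::].
Proof.
elim: w => [|[i e] w IHw]; first exact: braid_refl.
rewrite /inv_word /= rev_cons -cats1 -cat_cons catA -/(inv_word w).
rewrite -cat1s -(catA [:: (i, e)]).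
apply: braid_trans (braid_cancel i e).
rewrite -[in X in braid_eq _ X](cat1s (i, e)).
apply: (@braid_cat ([:: (i, e)] ++ _) [:: (i, e)]); last exact: braid_refl.
by rewrite -[X in braid_eq _ X]cats0; apply: braid_cat => //; exact: braid_refl.
Qed.

Lemma inv_word_cat w : braid_eq (inv_word w ++ w) [::].
Proof. by rewrite -{2}[w]inv_wordK; exact: cat_inv_word. Qed.

Definition braid_one : braid := braid_of_word [::].
Definition braid_mul (a b : braid) : braid := braid_of_word (repr a ++ repr b).
Definition braid_inv (a : braid) : braid := braid_of_word (inv_word (repr a)).

Lemma braid_mulA : associative braid_mul.
Proof.
move=> a b c; apply/braid_eqP.
apply: braid_trans (braid_cat (braid_refl _) (repr_braid _)) _.
rewrite catA; apply: braid_sym.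
exact: braid_cat (repr_braid _) (braid_refl _).
Qed.

Lemma braid_mul1 : left_id braid_one braid_mul.
Proof.
move=> a; rewrite -[RHS]braid_repr; apply/braid_eqP.
exact: (braid_cat (repr_braid [::]) (braid_refl _)).
Qed.

Lemma braid_1mul : right_id braid_one braid_mul.
Proof.
move=> a; rewrite -[RHS]braid_repr; apply/braid_eqP.
rewrite -[X in braid_eq _ X]cats0.
exact: (braid_cat (braid_refl _) (repr_braid [::])).
Qed.

Lemma braid_mulV : left_inverse braid_one braid_inv braid_mul.
Proof.
move=> a; apply/braid_eqP.
apply: braid_trans (inv_word_cat (repr a)).
exact: braid_cat (repr_braid _) (braid_refl _).
Qed.

Lemma braid_Vmul : right_inverse braid_one braid_inv braid_mul.
Proof.
move=> a; apply/braid_eqP.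
apply: braid_trans (cat_inv_word (repr a)).
exact: braid_cat (braid_refl _) (repr_braid _).
Qed.

HB.instance Definition _ := isGroup.Build braid
  braid_mulA braid_mul1 braid_1mul braid_mulV braid_Vmul.

Definition strand (i : 'I_N.-1) : 'I_N := widen_ord (leq_pred N) i.
Definition next_strand (i : 'I_N.-1) : 'I_N :=
  Ordinal (etrans (esym (ltn_predRL i N)) (ltn_ord i)).

(* The product of 'S_N is that of S_N with composition read from left to     *)
(* right: (s * t) x = t (s x).  Permutations are multiplied here as          *)
(* functions, hence the reversed order.                                      *)
Definition word_perm (w : braid_word) : 'S_N :=
  foldr (fun l s => (s * tperm (strand l.1) (next_strand l.1))%g) 1%g w.

Definition phi (b : braid) : 'S_N := word_perm (repr b).

Lemma word_perm_cat v w : word_perm (v ++ w) = (word_perm w * word_perm v)%g.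
Proof.
elim: v => [|l v IHv] /=; first by rewrite mulg1.
by rewrite IHv mulgA.
Qed.

Lemma word_perm_eq v w : braid_eq v w -> word_perm v = word_perm w.
Proof.
elim=> {v w} [//|//|u v w _ -> _ -> //|u u' v v' _ IHu _ IHv|i e|i j ij|i j ij].
- by rewrite !word_perm_cat IHu IHv.
- by rewrite /= mul1g tperm2.
- have [ij1 ij2] := (ltnW ij, ltnW (ltnW ij)).
  by rewrite /= !mul1g conjgC tpermJ !tpermD // -val_eqE /= neq_ltn ?ltnS;
    rewrite ?ij ?ij1 ?ij2 ?orbT.
- rewrite /= !mul1g.
  have ->: strand j = next_strand i by apply: val_inj; rewrite /= ij.
  set a := strand i; set b := next_strand i; set c := next_strand j.
  have ab : a != b by rewrite -val_eqE /= neq_ltn ltnSn.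
  have bc : b != c by rewrite -val_eqE /= ij neq_ltn ltnSn.
  have ac : a != c by rewrite -val_eqE /= ij neq_ltn ltnS leqnSn.
  have -> : (tperm a b * tperm b c * tperm a b)%g = (tperm b c ^ tperm a b)%g.
    by rewrite conjgE tpermV mulgA.
  have -> : (tperm b c * tperm a b * tperm b c)%g = (tperm a b ^ tperm b c)%g.
    by rewrite conjgE tpermV mulgA.
  by rewrite !tpermJ tpermR tpermL !tpermD // eq_sym.
Qed.

Lemma phiM (a b : braid) : phi (a * b)%g = (phi b * phi a)%g.
Proof. by rewrite /phi (word_perm_eq (repr_braid _)) word_perm_cat. Qed.

Lemma phi_gen i : phi (braid_of_word [:: (i, true)]) =
  tperm (strand i) (next_strand i).
Proof. by rewrite /phi (word_perm_eq (repr_braid _)) /= mul1g. Qed.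

End Braid.

(* Inner products are linear in the first argument.  Algebras of operators   *)
(* on V are sets of functions V -> V.                                        *)

Section Operators.
Variable R : realType.
Implicit Type V : lmodType R[i].

Definition hnorm V (ip : {dot V for Num.conj}) (v : V) : R :=
  Num.sqrt (complex.Re (ip v v)).

Definition hcomplete V (ip : {dot V for Num.conj}) : Prop :=
  forall u : nat -> V,
    (forall e : R, 0 < e -> exists n0, forall i j, (n0 <= i)%N -> (n0 <= j)%N ->
      hnorm ip (u i - u j) < e) ->
    exists l, forall e : R, 0 < e -> exists n0, forall i, (n0 <= i)%N ->
      hnorm ip (u i - l) < e.

Definition bounded_op V (ip : {dot V for Num.conj}) (a : V -> V) : Prop :=
  linear a /\ exists M : R, forall v, hnorm ip (a v) <= M * hnorm ip v.

Definition commutant V (ip : {dot V for Num.conj}) (S : set (V -> V)) :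
    set (V -> V) :=
  [set a | bounded_op ip a /\ forall b, S b -> a \o b = b \o a].

Definition is_adjoint V (ip : {dot V for Num.conj}) (a b : V -> V) : Prop :=
  forall u v, ip (a u) v = ip u (b v).

Definition adjoint V (ip : {dot V for Num.conj}) (a : V -> V) : V -> V :=
  xget (fun=> 0) [set b | is_adjoint ip a b].

(* Generated von Neumann algebra, by the bicommutant theorem. *)
Definition vn_gen V (ip : {dot V for Num.conj}) (S : set (V -> V)) :
    set (V -> V) :=
  commutant ip (commutant ip (S `|` [set adjoint ip a | a in S])).

Definition vn_isomorphic V1 (ip1 : {dot V1 for Num.conj}) (S1 : set (V1 -> V1))
    V2 (ip2 : {dot V2 for Num.conj}) (S2 : set (V2 -> V2)) : Prop :=
  exists f : (V1 -> V1) -> (V2 -> V2),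
    [/\ set_bij S1 S2 f,
        forall (c : R[i]) a b, S1 a -> S1 b ->
          f (fun v => c *: a v + b v) = (fun v => c *: f a v + f b v),
        forall a b, S1 a -> S1 b -> f (a \o b) = f a \o f b &
        forall a, S1 a -> f (adjoint ip1 a) = adjoint ip2 (f a)].

Definition orth_proj V (ip : {dot V for Num.conj}) (W : set V) (v : V) : V :=
  xget 0 [set u | W u /\ forall w, W w -> ip (v - u) w = 0].

(* A Hilbert tensor product of V1 and V2; it is unique up to a unitary map   *)
(* compatible with ht_pure.                                                  *)
Record htensor V1 (ip1 : {dot V1 for Num.conj})
    V2 (ip2 : {dot V2 for Num.conj}) := HTensor {
  ht_space :> lmodType R[i];
  ht_dot : {dot ht_space for Num.conj};
  ht_pure : {bilinear V1 -> V2 -> ht_space};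
  ht_complete : hcomplete ht_dot;
  ht_pureE : forall x x' y y',
    ht_dot (ht_pure x y) (ht_pure x' y') = ip1 x x' * ip2 y y';
  ht_dense : forall (z : ht_space) (e : R), 0 < e ->
    exists (k : nat) (x : 'I_k -> V1) (y : 'I_k -> V2),
      hnorm ht_dot (z - \sum_(i < k) ht_pure (x i) (y i)) < e }.

Section Tensor.
Variables (V1 V2 : lmodType R[i]).
Variables (ip1 : {dot V1 for Num.conj}) (ip2 : {dot V2 for Num.conj}).
Variable T : htensor ip1 ip2.

Definition tensor_op (a : V1 -> V1) (b : V2 -> V2) : T -> T :=
  xget (fun=> 0) [set z | bounded_op (ht_dot T) z /\
    forall x y, z (ht_pure T x y) = ht_pure T (a x) (b y)].

Definition vn_tensor (S1 : set (V1 -> V1)) (S2 : set (V2 -> V2)) :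
    set (T -> T) :=
  vn_gen (ht_dot T) [set z | exists2 a, S1 a & exists2 b, S2 b &
    z = tensor_op a b].

End Tensor.

Definition End_alg V : set (V -> V) := [set a | linear a].

(* The Hilbert sum of copies of V indexed by I, i.e. l^2(I, V). *)
Section FfunDot.
Variables (I : finType) (V : lmodType R[i]) (ip : {dot V for Num.conj}).

Definition ffun_dot (xi eta : {ffun I -> V}) : R[i] :=
  \sum_i ip (xi i) (eta i).

Lemma ffun_dot_linearl eta : linear_for *%R (ffun_dot^~ eta).
Proof.
move=> a x y; rewrite /ffun_dot mulr_sumr -big_split; apply: eq_bigr => i _ /=.
by rewrite !ffunE linearPl.
Qed.

Lemma ffun_dot_linearr xi :
  linear_for (Num.conj \; *%R) (ffun_dot xi).
Proof.
move=> a x y; rewrite /ffun_dot /= mulr_sumr -big_split.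
by apply: eq_bigr => i _ /=; rewrite !ffunE linearPr.
Qed.

HB.instance Definition _ := bilinear_isBilinear.Build R[i] _ _ _ _ _ ffun_dot
  (ffun_dot_linearl, ffun_dot_linearr).

Lemma ffun_dot_herm xi eta :
  ffun_dot xi eta = (-1) ^+ false * Num.conj (ffun_dot eta xi).
Proof.
rewrite expr0 mul1r /ffun_dot rmorph_sum; apply: eq_bigr => i _ /=.
by rewrite hermC expr0 mul1r.
Qed.

HB.instance Definition _ :=
  isHermitianSesquilinear.Build R[i] _ false Num.conj ffun_dot ffun_dot_herm.

Lemma ffun_dot_gt0 xi : xi != 0 -> 0 < ffun_dot xi xi.
Proof.
move=> xi0; have [i xii0] : exists i, xi i != 0.
  apply/existsP; apply: contraNT xi0; rewrite negb_exists => /forallP xi0.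
  by apply/eqP/ffunP => i; rewrite ffunE; apply/eqP; rewrite -[_ == _]negbK.
have ge0 j : 0 <= ip (xi j) (xi j).
  have [->|/neq0_dnorm_gt0/ltW//] := eqVneq (xi j) 0.
  by rewrite linear0l.
rewrite /ffun_dot (bigD1 i) //= ltr_pwDl ?neq0_dnorm_gt0 //.
by apply: sumr_ge0.
Qed.

HB.instance Definition _ := isDotProduct.Build R[i] _ ffun_dot ffun_dot_gt0.

End FfunDot.

(* Crossed product by an action of S_N, on l^2(S_N, V).  As functions,       *)
(* sigma^-1 o tau is (tau * sigma^-1)%g.                                     *)
Section Crossed.
Variables (N : nat) (V : lmodType R[i]) (ip : {dot V for Num.conj}).

Definition crossed_emb (alpha : 'S_N -> (V -> V) -> (V -> V)) (x : V -> V)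
    (xi : {ffun 'S_N -> V}) : {ffun 'S_N -> V} :=
  [ffun tau => alpha (tau^-1)%g x (xi tau)].

Definition crossed_transl (sigma : 'S_N) (xi : {ffun 'S_N -> V}) :
    {ffun 'S_N -> V} :=
  [ffun tau => xi (tau * sigma^-1)%g].

Definition crossed_product (M : set (V -> V))
    (alpha : 'S_N -> (V -> V) -> (V -> V)) :
    set ({ffun 'S_N -> V} -> {ffun 'S_N -> V}) :=
  vn_gen (@ffun_dot 'S_N V ip)
    ([set crossed_emb alpha x | x in M] `|` range crossed_transl).

End Crossed.

End Operators.

Notation borel X := (g_sigma_algebraType (@open X)).

Section Manifolds.
Variable R : realType.

(* Class C^k on the open set O. *)
Fixpoint Ck n (k : nat) (O : set 'rV[R]_n) (f : 'rV[R]_n -> R^o) : Prop :=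
  if k is k'.+1 then
    (forall x, O x -> differentiable f x) /\
    forall i : 'I_n, Ck k' O (fun x => 'D_(delta_mx 0 i) f x)
  else forall x, O x -> {for x, continuous f}.

Definition smooth_on n p (O : set 'rV[R]_n) (f : 'rV[R]_n -> 'rV[R]_p) : Prop :=
  forall k j, Ck k O (fun u => f u 0 j).

(* Only the values of [cmap] on [cdom] and of [cinv] on [cmap @` cdom]       *)
(* are relevant.                                                             *)
Record chart (X : Type) n := Chart {
  cdom : set X;
  cmap : X -> 'rV[R]_n;
  cinv : 'rV[R]_n -> X }.

Definition cran X n (c : chart X n) : set 'rV[R]_n := cmap c @` cdom c.

Definition is_chart (X : topologicalType) n (c : chart X n) : Prop :=
  [/\ open (cdom c), open (cran c),
      forall x, cdom c x -> cinv c (cmap c x) = x,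
      forall x, cdom c x -> {for x, continuous (cmap c)} &
      forall u, cran c u -> {for u, continuous (cinv c)}].

Definition smooth_transition X n (c c' : chart X n) : Prop :=
  smooth_on (cmap c @` (cdom c `&` cdom c')) (cmap c' \o cinv c).

(* [atlas] is a maximal atlas; [chart_at x] selects a chart around x, used   *)
(* to identify the tangent space at x with 'rV[R]_n.  The pointed carrier    *)
(* only records that manifolds are nonempty; measurable types require it.    *)
Record manifold n := Manifold {
  mpoint :> ptopologicalType;
  mhausdorff : hausdorff_space mpoint;
  msecond_countable : @second_countable mpoint;
  atlas : set (chart mpoint n);
  atlas_chart : forall c, atlas c -> is_chart c;
  atlas_smooth : forall c c', atlas c -> atlas c' -> smooth_transition c c';
  atlas_max : forall c, is_chart c ->
    (forall c', atlas c' -> smooth_transition c c' /\ smooth_transition c' c) ->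
    atlas c;
  chart_at : mpoint -> chart mpoint n;
  chart_at_atlas : forall x, atlas (chart_at x);
  chart_at_dom : forall x, cdom (chart_at x) x }.

Arguments atlas {n} _ _.

Definition smooth_map n p (X : manifold n) (Y : manifold p) (f : X -> Y) :
    Prop :=
  continuous f /\ forall c c', atlas X c -> atlas Y c' ->
    smooth_on (cmap c @` (cdom c `&` f @^-1` cdom c')) (cmap c' \o f \o cinv c).

(* The differential of f at x acts on row vectors by v |-> v *m tangent f x. *)
Definition tangent n p (X : manifold n) (Y : manifold p) (f : X -> Y) (x : X) :
    'M[R]_(n, p) :=
  jacobian (cmap (chart_at (f x)) \o f \o cinv (chart_at x))
           (cmap (chart_at x) x).

(* From coordinates in the chart c to the preferred coordinates at x. *)
Definition tangent_chart n (X : manifold n) (c : chart X n) (x : X) : 'M[R]_n :=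
  jacobian (cmap (chart_at x) \o cinv c) (cmap c x).

Definition gram n (X : manifold n) (g : X -> 'M[R]_n) (c : chart X n) (x : X) :
    'M[R]_n :=
  tangent_chart c x *m g x *m (tangent_chart c x)^T.

Record riemannian n := Riemannian {
  rmanifold :> manifold n;
  metric : rmanifold -> 'M[R]_n;
  metric_sym : forall x, (metric x)^T = metric x;
  metric_pos : forall x (v : 'rV[R]_n), v != 0 ->
    0 < (v *m metric x *m v^T) 0 0;
  metric_smooth : forall c, atlas rmanifold c -> forall k i j,
    Ck k (cran c) (fun u => gram metric c (cinv c u) i j) }.

Definition local_isometry n p (X : riemannian n) (Y : riemannian p)
    (f : X -> Y) : Prop :=
  smooth_map f /\ forall x,
    metric x = tangent f x *m metric (f x) *m (tangent f x)^T.

(* Lebesgue integral over R^n of a nonnegative Borel function, by iterated   *)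
(* integration.                                                              *)
Fixpoint rV_integral n : ('rV[R]_n -> \bar R) -> \bar R :=
  match n with
  | 0 => fun f => f 0
  | n'.+1 => fun f => (\int[lebesgue_measure]_(x in [set: R])
      rV_integral (fun v => f (@row_mx R 1 1 n' (const_mx x) v)))%E
  end.


Definition is_volume n (X : riemannian n)
    (vol : {measure set (borel X) -> \bar R}) : Prop :=
  forall (c : chart X n) (A : set (borel X)),
    atlas X c -> measurable A -> A `<=` cdom c ->
    vol A = rV_integral (fun u =>
      (\1_(cmap c @` A) u * Num.sqrt (\det (gram (@metric n X) c (cinv c u))))%:E).

Definition prod_chart n N (X Y : Type) (pr : 'I_N -> Y -> X)
    (tup : ('I_N -> X) -> Y) (c : 'I_N -> chart X n) : chart Y (N * n) :=
  {| cdom := [set y | forall i, cdom (c i) (pr i y)];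
     cmap := fun y => mxvec (\matrix_(i < N, j < n) cmap (c i) (pr i y) 0 j);
     cinv := fun u => tup (fun i => cinv (c i) (row i (vec_mx u))) |}.

(* The Riemannian product X^N: products of charts are charts, and the metric *)
(* is the sum of the pullbacks along the projections.                        *)
Record riem_power n (X : riemannian n) (N : nat) := RiemPower {
  rpower :> riemannian (N * n);
  pr : 'I_N -> rpower -> X;
  tup : ('I_N -> X) -> rpower;
  pr_tup : forall x i, pr i (tup x) = x i;
  tup_pr : forall y, tup (fun i => pr i y) = y;
  power_atlas : forall c : 'I_N -> chart X n,
    (forall i, atlas X (c i)) -> atlas rpower (prod_chart pr tup c);
  power_metric : forall y : rpower,
    metric y = \sum_(i < N)
      tangent (pr i) y *m metric (pr i y) *m (tangent (pr i) y)^T }.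

Section Forms.
Variables (n : nat) (Y : riemannian n) (m : nat).

(* The m tangent vectors at y are the rows of a matrix. *)
Definition mform := Y -> 'M[R]_(m, n) -> R[i].

Definition alternating (f : 'M[R]_(m, n) -> R[i]) : Prop :=
  (forall (i : 'I_m) (a : R) (A B C : 'M[R]_(m, n)),
     row i A = a *: row i B + row i C -> row' i B = row' i A ->
     row' i C = row' i A -> f A = a%:C%C * f B + f C) /\
  (forall (i j : 'I_m) A, i != j -> row i A = row j A -> f A = 0).

Definition frame (I : {ffun 'I_m -> 'I_n}) : 'M[R]_(m, n) :=
  \matrix_(k, j) (j == I k)%:R.

Definition measurable_form (w : mform) : Prop :=
  forall (c : chart Y n) (I : {ffun 'I_m -> 'I_n}), atlas Y c ->
    measurable_fun (cdom c : set (borel Y))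
      (fun y => complex.Re (w y (frame I *m tangent_chart c y)) : R) /\
    measurable_fun (cdom c : set (borel Y))
      (fun y => complex.Im (w y (frame I *m tangent_chart c y)) : R).

(* Pointwise squared norm, for which the wedge products of increasing        *)
(* m-tuples of an orthonormal coframe are orthonormal.                       *)
Definition form_norm2 (w : mform) (y : Y) : R :=
  (m`!)%:R^-1 * complex.Re
    (\sum_(I : {ffun 'I_m -> 'I_n}) \sum_(J : {ffun 'I_m -> 'I_n})
      (\prod_(k < m) invmx (metric y) (I k) (J k))%:C%C *
        (w y (frame I) * Num.conj (w y (frame J)))).

Variable vol : {measure set (borel Y) -> \bar R}.

Definition L2_norm2 (w : mform) : \bar R :=
  (\int[vol]_(y in [set: borel Y]) (form_norm2 w y)%:E)%E.

Definition square_integrable (w : mform) : Prop :=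
  [/\ forall y, alternating (w y), measurable_form w & (L2_norm2 w < +oo)%E].

(* The Hilbert space of square-integrable forms modulo forms of norm 0: by   *)
(* L2_classE, two such forms have the same class iff they are equal almost   *)
(* everywhere, and the space is unique up to a unitary map compatible with   *)
(* L2_class.  The squared norms determine the inner product by polarization. *)
Record L2_forms := L2Forms {
  L2_space :> lmodType R[i];
  L2_dot : {dot L2_space for Num.conj};
  L2_complete : hcomplete L2_dot;
  L2_class : mform -> L2_space;
  L2_class_linear : forall (a : R[i]) w w',
    square_integrable w -> square_integrable w' ->
    L2_class (fun y v => a * w y v + w' y v) = a *: L2_class w + L2_class w';
  L2_classE : forall w, square_integrable w ->
    (complex.Re (L2_dot (L2_class w) (L2_class w)))%:E = L2_norm2 w;
  L2_class_surj : forall h, exists2 w, square_integrable w & L2_class w = h }.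

Definition pullback (f : Y -> Y) (w : mform) : mform :=
  fun y v => w (f y) (v *m tangent f y).

Definition L2_repr (L : L2_forms) (h : L) : mform :=
  xget (fun _ _ => 0) [set w | square_integrable w /\ L2_class L w = h].

Definition pullback_op (L : L2_forms) (f : Y -> Y) (h : L) : L :=
  L2_class L (pullback f (L2_repr h)).

End Forms.

Definition ICC (G : groupType) : Prop :=
  forall g : G, g != 1%g -> infinite_set (range (fun h : G => (h^-1 * g * h)%g)).

Definition isometric_action (G : groupType) n (X : riemannian n)
    (act : G -> X -> X) : Prop :=
  [/\ forall x, act 1%g x = x,
      forall g h x, act (g * h)%g x = act g (act h x) &
      forall g, local_isometry (act g)].

Definition free_action (G : groupType) (X : Type) (act : G -> X -> X) : Prop :=
  forall g x, act g x = x -> g = 1%g.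

Definition covering_map (X K : topologicalType) (p : X -> K) : Prop :=
  [/\ continuous p, forall k, exists x, p x = k &
      forall k, exists V : set K, [/\ open V, V k &
        exists (I : Type) (U : I -> set X),
          [/\ forall i, open (U i), p @^-1` V = \bigcup_i U i,
              forall i j x, U i x -> U j x -> i = j &
              forall i, [/\ set_bij (U i) V p &
                forall W, open W -> W `<=` U i -> open (p @` W)]]]].

(* p exhibits K as X/G, with its quotient smooth structure and metric. *)
Definition galois_cover (G : groupType) n (X K : riemannian n)
    (act : G -> X -> X) (p : X -> K) : Prop :=
  [/\ covering_map p, local_isometry p &
      forall x y, p x = p y <-> exists g, y = act g x].

End Manifolds.

Section Algebras.
Variables (R : realType) (n : nat) (X : riemannian R n) (N m : nat).
Variable XN : riem_power X N.
Variable vol : {measure set (borel XN) -> \bar R}.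
Variable L : L2_forms m vol.

Definition diag_act (G : groupType) (act : G -> X -> X) (g : 'I_N -> G)
    (y : XN) : XN :=
  tup XN (fun i => act (g i) (pr i y)).

Definition group_op (G : groupType) (act : G -> X -> X) (g : 'I_N -> G) : L -> L :=
  pullback_op (diag_act act (fun i => (g i)^-1%g)).

Definition M_alg (G : groupType) (act : G -> X -> X) : set (L -> L) :=
  commutant (L2_dot L) (range (group_op act)).

Definition perm_op (s : 'S_N) : L -> L :=
  pullback_op (fun y : XN => tup XN (fun i => pr (s i) y)).

Definition alpha_action (s : 'S_N) (x : L -> L) : L -> L :=
  perm_op s \o x \o adjoint (L2_dot L) (perm_op s).

Variables (A : lmodType R[i]) (ipA : {dot A for Num.conj}).
Variable pi : braid N -> A -> A.
Variable T : htensor (L2_dot L) ipA.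

Definition U_op (b : braid N) : T -> T := tensor_op (perm_op (phi b)) (pi b).

Definition P_U : T -> T :=
  orth_proj (ht_dot T) [set v | forall b, U_op b v = v].

Definition Q_alg (G : groupType) (act : G -> X -> X) : set (T -> T) :=
  vn_tensor (M_alg act) (@End_alg R A).

End Algebras.

Definition unitary_rep (R : realType) (B : groupType) (A : lmodType R[i])
    (ip : {dot A for Num.conj}) (pi : B -> A -> A) : Prop :=
  [/\ forall b, linear (pi b), forall b u v, ip (pi b u) (pi b v) = ip u v,
      forall u, pi 1%g u = u & forall b c u, pi (b * c)%g u = pi b (pi c u)].

Definition pure_fixed (R : realType) N (A : lmodType R[i])
    (pi : braid N -> A -> A) : set A :=
  [set a | forall b, phi b = 1%g -> pi b a = a].

(* Subalgebras are unital. *)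
Definition subalgebra (R : realType) (A : falgType R[i]) (S : set A) : Prop :=
  [/\ S 1, forall (c : R[i]) a b, S a -> S b -> S (c *: a + b) &
      forall a b, S a -> S b -> S (a * b)].

(* Main.v *)
Require Import Defs.
From HB Require Import structures.
From mathcomp Require Import all_boot all_order all_algebra all_fingroup all_field.
From mathcomp Require Import generic_quotient sesquilinear complex.
From mathcomp Require Import all_classical all_reals all_analysis.
From mathcomp Require Import measurable_realfun ring lra.
Set Implicit Arguments.
Unset Strict Implicit.
Unset Printing Implicit Defensive.
Import Order.TTheory GRing.Theory Num.Theory numFieldNormedType.Exports.
Local Open Scope classical_set_scope.
Local Open Scope ring_scope.

(* Let Gamma = G^N act on L = L^2 Omega^m(X^N) by rho, and let S be the
   permutation representation.  Since G acts freely and properly, L is spanned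
   by wandering vectors v, those with <rho(g) v, v> = 0 for all g <> 1: forms
   supported in small product patches.  So the coefficients of rho are mixing,
   and, G being infinite, one can let h go to infinity in Gamma in such a way
   that (h o s)^-1 (h o t) leaves every finite set whenever s <> t.  Averaging
   along an ultrafilter then shows that the operators sum_s x_s S_s, with x_s in
   M = rho(Gamma)', form the commutant of { sum_s rho(g o s) : g in Gamma } and
   have unique coefficients.  They thus form a von Neumann algebra isomorphic to
   the crossed product, which is also identified as a commutant.  Tensoring with
   End(A) amounts to taking matrices over these algebras in an orthonormal basis
   of A.  Finally P_U (u (x) 1) is the average over s in S_N of
   S_s u (x) pi_s 1, because pure braids fix 1; an operator commuting with Q and
   P_U hence has the form w (x) 1 with w in M' commuting with every S_s.

   That rho and S are unitary needs no change of variables: a chart composed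
   with an isometry is again a chart, in which the volume has the same
   expression. *)

(** * Hilbert spaces and bounded operators *)

Section HilbertSpace.
Variables (R : realType) (V : lmodType R[i]) (ip : {dot V for Num.conj}).
Implicit Types (u v w : V) (a : V -> V) (c : R[i]).
Local Notation normc := ComplexField.Normc.normc.

Definition sqn v : R := complex.Re (ip v v).

Lemma ip_sqn v : ip v v = (sqn v)%:C%C.
Proof. by rewrite /sqn RRe_real // ger0_real // dnorm_ge0. Qed.

Lemma sqn_ge0 v : 0 <= sqn v.
Proof. by rewrite -ler0c -ip_sqn dnorm_ge0. Qed.

Lemma sqn_eq0 v : (sqn v == 0) = (v == 0).
Proof. by rewrite -(inj_eq (@complexI R)) -ip_sqn dnorm_eq0. Qed.

Lemma sqn0 : sqn 0 = 0.
Proof. by apply/eqP; rewrite sqn_eq0. Qed.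

Lemma hnormE v : hnorm ip v = Num.sqrt (sqn v). Proof. by []. Qed.

Lemma hnorm_ge0 v : 0 <= hnorm ip v. Proof. exact: sqrtr_ge0. Qed.

Lemma sqr_hnorm v : hnorm ip v ^+ 2 = sqn v.
Proof. by rewrite sqr_sqrtr // sqn_ge0. Qed.

Lemma hnorm_eq0 v : (hnorm ip v == 0) = (v == 0).
Proof. by rewrite -sqn_eq0 -sqr_hnorm sqrf_eq0. Qed.

Lemma ipC u v : ip u v = (ip v u)^*%C.
Proof. by rewrite hermC expr0 mul1r. Qed.

Lemma ipDl u v w : ip (u + v) w = ip u w + ip v w. Proof. exact: linearDl. Qed.
Lemma ipDr u v w : ip w (u + v) = ip w u + ip w v. Proof. exact: linearDr. Qed.
Lemma ipBl u v w : ip (u - v) w = ip u w - ip v w. Proof. exact: linearBl. Qed.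
Lemma ipBr u v w : ip w (u - v) = ip w u - ip w v. Proof. exact: linearBr. Qed.
Lemma ipNl u w : ip (- u) w = - ip u w. Proof. exact: linearNl. Qed.
Lemma ipNr u w : ip w (- u) = - ip w u. Proof. exact: linearNr. Qed.
Lemma ip0l w : ip 0 w = 0. Proof. exact: linear0l. Qed.
Lemma ip0r w : ip w 0 = 0. Proof. exact: linear0r. Qed.
Lemma ipZl c u w : ip (c *: u) w = c * ip u w. Proof. exact: linearZl_LR. Qed.
Lemma ipZr c u w : ip w (c *: u) = (c^*)%C * ip w u. Proof. exact: linearZr_LR. Qed.
Lemma ip_suml I r (P : pred I) (F : I -> V) w :
  ip (\sum_(i <- r | P i) F i) w = \sum_(i <- r | P i) ip (F i) w.
Proof. exact: linear_sumlz. Qed.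
Lemma ip_sumr I r (P : pred I) (F : I -> V) w :
  ip w (\sum_(i <- r | P i) F i) = \sum_(i <- r | P i) ip w (F i).
Proof. exact: linear_sumr. Qed.

Lemma normcN' c : normc (- c) = normc c.
Proof. by case: c => x y /=; rewrite !sqrrN. Qed.

Lemma normc_ge0 c : 0 <= normc c.
Proof. by case: c => x y; exact: sqrtr_ge0. Qed.

Lemma sqr_normcE c : (normc c ^+ 2)%:C%C = c * (c^*)%C.
Proof. by rewrite -sqr_normc rmorphXn. Qed.

Lemma normcJ' c : normc (c^*)%C = normc c.
Proof. by apply: (@complexI R); exact: normcJ. Qed.

Lemma normc_real (x : R) : 0 <= x -> normc (x%:C)%C = x.
Proof. by move=> x0; rewrite /= expr0n addr0 sqrtr_sqr ger0_norm. Qed.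

Lemma normc_triangle c c' : normc (c + c') <= normc c + normc c'.
Proof. by rewrite -lecR; have := ler_normD c c'; rewrite rmorphD. Qed.

Lemma normc_nat n : normc (n%:R : R[i]) = n%:R.
Proof. by rewrite -(rmorph_nat (real_complex R)) normc_real. Qed.

Lemma sqnZ c v : sqn (c *: v) = normc c ^+ 2 * sqn v.
Proof.
apply: (@complexI R); rewrite rmorphM /= -!ip_sqn dnormZ; congr (_ * _).
by rewrite rmorphXn.
Qed.

Lemma hnormZ c v : hnorm ip (c *: v) = normc c * hnorm ip v.
Proof. by rewrite !hnormE sqnZ sqrtrM ?sqr_ge0 // sqrtr_sqr ger0_norm ?normc_ge0. Qed.

Lemma hnormN v : hnorm ip (- v) = hnorm ip v.
Proof. by rewrite -scaleN1r hnormZ normcN' normc_real ?ler01 // mul1r. Qed.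

Lemma hnorm0 : hnorm ip 0 = 0.
Proof. by apply/eqP; rewrite hnorm_eq0. Qed.

Lemma hnormBC u v : hnorm ip (u - v) = hnorm ip (v - u).
Proof. by rewrite -hnormN opprB. Qed.

Lemma sqnD u v : sqn (u + v) = sqn u + sqn v + 2 * complex.Re (ip u v).
Proof.
by rewrite /sqn ipDl !ipDr (ipC v u); case: (ip u v) => x y /=; rewrite !raddfD /=; ring.
Qed.

Lemma sqnB u v : sqn (u - v) = sqn u + sqn v - 2 * complex.Re (ip u v).
Proof. by rewrite sqnD ipNr {2}/sqn ipNl ipNr opprK raddfN mulrN. Qed.

Lemma parallelogram u v : sqn (u + v) + sqn (u - v) = 2 * sqn u + 2 * sqn v.
Proof. by rewrite sqnD sqnB; ring. Qed.

Lemma sqn_proj u v : v != 0 ->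
  sqn (u - (ip u v / ip v v) *: v) = sqn u - normc (ip u v) ^+ 2 / sqn v.
Proof.
move=> v0; have vv : ip v v != 0 by rewrite dnorm_eq0.
have E : (normc (ip u v) ^+ 2 / sqn v)%:C%C = ip u v * (ip u v)^*%C / ip v v.
  by rewrite [in RHS]ip_sqn -sqr_normcE -[RHS]fmorph_div.
have F : ((ip u v / ip v v)^*)%C = (ip u v)^*%C / ip v v.
  by rewrite fmorph_div /= -(ipC v v).
apply: (@complexI R); rewrite -ip_sqn ipBl !ipBr !ipZl !ipZr rmorphB /= E -ip_sqn F.
by rewrite (ipC v u); field.
Qed.

Lemma cauchy_schwarz u v : normc (ip u v) <= hnorm ip u * hnorm ip v.
Proof.
have [->|v0] := eqVneq v 0.
  by rewrite ip0r hnorm0 mulr0 normc_real.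
have sv : 0 < sqn v by rewrite lt_neqAle eq_sym sqn_eq0 v0 sqn_ge0.
rewrite -(@ler_pXn2r _ 2) ?nnegrE ?mulr_ge0 ?hnorm_ge0 ?normc_ge0 //.
rewrite exprMn !sqr_hnorm -ler_pdivrMr //.
by have := sqn_ge0 (u - (ip u v / ip v v) *: v); rewrite sqn_proj // subr_ge0.
Qed.

Lemma hnormD u v : hnorm ip (u + v) <= hnorm ip u + hnorm ip v.
Proof.
rewrite -(@ler_pXn2r _ 2) ?nnegrE ?addr_ge0 ?hnorm_ge0 // sqr_hnorm sqnD.
rewrite sqrrD !sqr_hnorm -addrA (addrC (sqn v)) addrA lerD2r lerD2l mulr_natl.
rewrite lerMn2r /= (le_trans _ (cauchy_schwarz u v)) //.
by rewrite -lecR (le_trans _ (normc_ge_Re _)) // lecR ler_norm.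
Qed.

Lemma hnormB_trans w u v : hnorm ip (u - v) <= hnorm ip (u - w) + hnorm ip (w - v).
Proof. by rewrite -[u - v](subrKA w) hnormD. Qed.

Lemma small0 (x : R) : 0 <= x -> (forall e, 0 < e -> x <= e) -> x = 0.
Proof. by move=> x0 H; apply/eqP; rewrite eq_le x0 andbT; apply/ler_addgt0Pl => e /H; rewrite addr0. Qed.

Lemma hnorm_small v : (forall e, 0 < e -> hnorm ip v <= e) -> v = 0.
Proof. by move=> H; apply/eqP; rewrite -hnorm_eq0; apply/eqP/small0 => //; exact: hnorm_ge0. Qed.

Lemma normc_small c : (forall e, 0 < e -> normc c <= e) -> c = 0.
Proof.
move=> H; apply/ComplexField.Normc.eq0_normc/small0 => //; exact: normc_ge0.
Qed.

Lemma ip_inj u v : (forall w, ip u w = ip v w) -> u = v.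
Proof.
move=> H; apply/eqP; rewrite -subr_eq0 -(dnorm_eq0 ip) ipBl.
by rewrite H subrr.
Qed.

Lemma ip_injr u v : (forall w, ip w u = ip w v) -> u = v.
Proof. by move=> H; apply: ip_inj => w; rewrite ipC H -ipC. Qed.

Definition hclosure (W : set V) : set V :=
  [set v | forall e : R, 0 < e -> exists2 w, W w & hnorm ip (v - w) < e].

Definition hclosed (W : set V) := hclosure W `<=` W.

Definition subspace (W : set V) :=
  W 0 /\ forall c u v, W u -> W v -> W (c *: u + v).

Lemma subspaceD W u v : subspace W -> W u -> W v -> W (u + v).
Proof. by move=> [_ H] /H Wu /Wu; rewrite -{2}[u]scale1r; apply. Qed.

Lemma subspaceZ W c u : subspace W -> W u -> W (c *: u).
Proof. by move=> [W0 H] /H Wu; rewrite -[_ *: _]addr0; apply: Wu. Qed.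

Lemma subspaceB W u v : subspace W -> W u -> W v -> W (u - v).
Proof. by move=> [_ H] Wu /H; rewrite addrC -scaleN1r; apply. Qed.

Lemma ip_closed u : hclosed [set v | ip u v = 0].
Proof.
move=> v H; apply: normc_small => e e0 /=.
have k0 : 0 < hnorm ip u + 1 by rewrite ltr_wpDl ?hnorm_ge0.
have [w /= uw vw] := H (e / (hnorm ip u + 1)) ltac:(by rewrite divr_gt0).
rewrite -[v](subrK w) ipDr uw addr0 (le_trans (cauchy_schwarz _ _)) //.
rewrite ltr_pdivlMr // in vw; apply: le_trans (ltW vw).
by rewrite mulrC ler_wpM2l ?hnorm_ge0 // lerDl ler01.
Qed.

Lemma ip_eq_dense (D : set V) u v : (forall w, hclosure D w) ->
  (forall w, D w -> ip u w = ip v w) -> u = v.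
Proof.
move=> dD H; apply: ip_inj => w; apply/eqP; rewrite -subr_eq0 -ipBl; apply/eqP.
apply: (@ip_closed (u - v)) => e /(dD w)[z Dz wz]; exists z => //=.
by rewrite ipBl H // subrr.
Qed.

Hypothesis Vcomplete : hcomplete ip.

Theorem projection (W : set V) v : subspace W -> hclosed W ->
  exists2 u, W u & forall w, W w -> ip (v - u) w = 0.
Proof.
move=> sW cW; pose E := [set sqn (v - w) | w in W].
have Elb : lbound E 0 by move=> _ [w _ <-]; exact: sqn_ge0.
have infE : has_inf E.
  by split; [exists (sqn (v - 0)), 0 => //; case: sW | exists 0].
pose d := inf E.
have dle w : W w -> d <= sqn (v - w).
  by move=> Ww; apply: ge_inf => //; [exists 0 | exists w].
have /choice[f fP] (n : nat) : exists w, W w /\ sqn (v - w) < d + n.+1%:R^-1.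
  have n0 : (0 : R) < n.+1%:R^-1 by rewrite invr_gt0.
  by have [_ [w Ww <-] lt] := inf_adherent n0 infE; exists w.
have fW n : W (f n) by have [] := fP n.
have fd n : sqn (v - f n) < d + n.+1%:R^-1 by have [] := fP n.
have small (e : R) : 0 < e -> exists n0, forall n, (n0 <= n)%N -> n.+1%:R^-1 < e.
  move=> e0; exists (Num.truncn e^-1) => n le.
  rewrite invf_plt ?posrE //; apply: lt_le_trans (truncnS_gt _) _.
  by rewrite ler_nat ltnS.
have fC i j : sqn (f i - f j) <= 2 * i.+1%:R^-1 + 2 * j.+1%:R^-1.
  have := parallelogram (v - f j) (v - f i).
  have -> : v - f j - (v - f i) = f i - f j.
    by rewrite opprB addrC addrA subrK.
  have -> : v - f j + (v - f i) = 2 *: (v - 2^-1 *: (1 *: f i + f j)).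
    rewrite scalerBr scalerA divff ?pnatr_eq0 // scale1r scale1r scaler_nat mulr2n.
    by rewrite opprD addrACA (addrC (- f i)).
  rewrite sqnZ normc_nat => eqP.
  have := dle (2^-1 *: (1 *: f i + f j)) ltac:(apply: subspaceZ => //; by apply sW.2).
  have := ltW (fd i); have := ltW (fd j); move: eqP.
  set x := sqn _; set y := sqn _; set z := sqn _; set t := sqn _.
  set p := i.+1%:R^-1; set q := j.+1%:R^-1; lra.
have [u fu] : exists l, forall e : R, 0 < e -> exists n0, forall i, (n0 <= i)%N ->
      hnorm ip (f i - l) < e.
  apply: Vcomplete => e e0.
  have [n0 n0P] := small (e ^+ 2 / 4) ltac:(by rewrite divr_gt0 ?exprn_gt0).
  exists n0 => i j /n0P i0 /n0P j0.
  rewrite -(@ltr_pXn2r _ 2) ?nnegrE ?hnorm_ge0 ?(ltW e0) // sqr_hnorm.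
  by apply: le_lt_trans (fC i j) _; move: i0 j0; set x := i.+1%:R^-1; set y := j.+1%:R^-1; set z := e ^+ 2; lra.
have Wu : W u.
  apply: cW => e /fu[n0 H]; exists (f n0) => //.
  by rewrite hnormBC H.
exists u => // w Ww.
have du : sqn (v - u) <= d.
  rewrite -sqr_hnorm; apply/ler_addgt0Pr => e e0.
  have sd e1 : 0 < e1 -> hnorm ip (v - u) <= Num.sqrt (d + e1) + e1.
    move=> e1p; have [n0 n0P] := fu _ e1p; have [n1 n1P] := small _ e1p.
    pose n := maxn n0 n1.
    apply: le_trans (hnormB_trans (f n) _ _) _; apply: lerD.
      rewrite hnormE ler_sqrt; last first.
        by rewrite addr_ge0 ?(ltW e1p) // lb_le_inf //; case: infE.
      apply: le_trans (ltW (fd n)) _; rewrite lerD2l; apply/ltW/n1P.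
      exact: leq_maxr.
    exact/ltW/n0P/leq_maxl.
  have d0 : 0 <= d by rewrite lb_le_inf //; case: infE.
  pose b := Num.sqrt (d + 1).
  have b0 : 0 <= b by exact: sqrtr_ge0.
  pose e1 := Num.min 1 (e / (2 + 2 * b)).
  have bb : 0 < 2 + 2 * b by lra.
  have e1p : 0 < e1 by rewrite lt_min ltr01 divr_gt0.
  have e1le : e1 * (2 + 2 * b) <= e by rewrite -ler_pdivlMr // ge_min lexx orbT.
  have e11 : e1 <= 1 by rewrite ge_min lexx.
  have := sd _ e1p; set x := hnorm _ _; set y := Num.sqrt _ => xy.
  have x0 : 0 <= x by exact: hnorm_ge0.
  have y0 : 0 <= y by exact: sqrtr_ge0.
  have yb : y <= b by rewrite ler_sqrt ?addr_ge0 // lerD2l.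
  have y2 : y ^+ 2 = d + e1 by rewrite sqr_sqrtr ?addr_ge0 // ltW.
  have : x ^+ 2 <= (y + e1) ^+ 2 by rewrite ler_pXn2r // nnegrE addr_ge0 // ltW.
  rewrite sqrrD y2; have : y * e1 <= b * e1 by rewrite ler_wpM2r // ltW.
  have : e1 ^+ 2 <= e1 by rewrite expr2 -[leRHS]mulr1 ler_wpM2l // ltW.
  by nra.
have [->|w0] := eqVneq w 0; first by rewrite ip0r.
have ww : ip w w != 0 by rewrite dnorm_eq0.
pose c := ip (v - u) w / ip w w.
have := dle (c *: w + u) ltac:(by apply sW.2).
have -> : v - (c *: w + u) = (v - u) - c *: w by rewrite opprD addrCA addrC.
rewrite sqn_proj //.
move=> le; have {le du} : normc (ip (v - u) w) ^+ 2 / sqn w <= 0 by lra.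
rewrite ler_pdivrMr ?mul0r => [|]; last by rewrite lt_neqAle eq_sym sqn_eq0 w0 sqn_ge0.
move=> le; have /eqP : normc (ip (v - u) w) ^+ 2 = 0 by apply/eqP; rewrite eq_le le sqr_ge0.
by rewrite sqrf_eq0 => /eqP/ComplexField.Normc.eq0_normc.
Qed.

Lemma closed_orth_full (D Z : set V) : subspace Z -> hclosed Z -> D `<=` Z ->
  (forall v, (forall w, D w -> ip v w = 0) -> Z v) -> forall v, Z v.
Proof.
move=> sZ cZ DZ oZ v; have [u Zu vu] := projection v sZ cZ.
by rewrite -[v](subrK u); apply: subspaceD => //; apply: oZ => w /DZ/vu.
Qed.

Lemma riesz (f : V -> R[i]) (M : R) : (forall c u v, f (c *: u + v) = c * f u + f v) ->
  (forall v, normc (f v) <= M * hnorm ip v) -> exists w, forall v, f v = ip v w.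
Proof.
move=> fl fM.
have f0 : f 0 = 0 by have := fl 1 0 0; rewrite scaler0 addr0 mul1r => /eqP; rewrite -subr_eq0 opprD addNKr oppr_eq0 => /eqP.
have fD u v : f (u + v) = f u + f v by have := fl 1 u v; rewrite scale1r mul1r.
have fZ c u : f (c *: u) = c * f u by have := fl c u 0; rewrite !addr0 f0 addr0.
have fB u v : f (u - v) = f u - f v by rewrite fD -scaleN1r fZ mulN1r.
have [H|/existsNP[v0 /eqP fv0]] := pselect (forall v, f v = 0).
  by exists 0 => v; rewrite ip0r.
pose K := [set v | f v = 0].
have sK : subspace K by split=> // c u v /= fu fv; rewrite /K /= fl fu fv mulr0 addr0.
have cK : hclosed K.
  move=> v H; apply: normc_small => e e0.
  have k0 : 0 < `|M| + 1 by rewrite ltr_wpDl.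
  have [w /= fw vw] := H (e / (`|M| + 1)) ltac:(by rewrite divr_gt0).
  rewrite -[v](subrK w) fD fw addr0 (le_trans (fM _)) //.
  rewrite ltr_pdivlMr // in vw; apply: le_trans (ltW vw).
  rewrite mulrC ler_wpM2l ?hnorm_ge0 // (le_trans (ler_norm _)) // lerDl ler01 //.
have [u0 Ku0 o] := projection v0 sK cK; pose u := v0 - u0.
have fu : f u != 0 by rewrite fB (Ku0 : f u0 = 0) subr0.
have uu : ip u u != 0.
  by rewrite dnorm_eq0; apply: contra fu => /eqP->; rewrite f0.
exists (((f u) ^*)%C / ip u u *: u) => v.
have /o : K (v - (f v / f u) *: u) by rewrite /K /= fB fZ divfK // subrr.
rewrite -/u ipBr ipZr => /eqP; rewrite subr_eq0 => /eqP uv.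
rewrite ipZr (ipC v u) uv.
have -> : ((f v / f u)^* * ip u u)^*%C = f v / f u * ip u u.
  by rewrite rmorphM /= conjcK -ipC.
have -> : ((f u)^* / ip u u)^*%C = f u / ip u u.
  by rewrite fmorph_div /= conjcK -ipC.
by field; rewrite uu fu.
Qed.

Lemma sesqui_op (B : V -> V -> R[i]) (M : R) :
  (forall c u v w, B (c *: u + v) w = c * B u w + B v w) ->
  (forall c u v w, B w (c *: u + v) = (c^*)%C * B w u + B w v) ->
  (forall u v, normc (B u v) <= M * hnorm ip u * hnorm ip v) ->
  exists2 a, bounded_op ip a & forall u v, ip (a u) v = B u v.
Proof.
move=> Bl Br BM.
have /choice[a aP] u : exists w, forall v, ip w v = B u v.
  have [c x y|v|w H] := @riesz (fun v => (B u v)^*)%C (M * hnorm ip u).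
  - by rewrite Br rmorphD rmorphM /= conjcK.
  - by rewrite normcJ'.
  - by exists w => v; rewrite ipC -H conjcK.
exists a => //; split.
  by move=> c u v; apply: ip_inj => w; rewrite ipDl ipZl !aP Bl.
exists M => u; have [->|] := eqVneq (hnorm ip (a u)) 0.
  have [->|u0] := eqVneq u 0; first by rewrite hnorm0 mulr0.
  have := BM u u; rewrite -mulrA => /(le_trans (normc_ge0 _)) h.
  have hu : 0 < hnorm ip u by rewrite lt_neqAle eq_sym hnorm_eq0 u0 hnorm_ge0.
  by move: h; rewrite mulrA pmulr_lge0.
move=> n0; have au : 0 < hnorm ip (a u) by rewrite lt_neqAle eq_sym n0 hnorm_ge0.
have := BM u (a u); rewrite -aP ip_sqn normc_real ?sqn_ge0 // -sqr_hnorm expr2.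
by rewrite ler_pM2r.
Qed.

Lemma bounded_adjoint a : bounded_op ip a -> exists2 b, bounded_op ip b & is_adjoint ip a b.
Proof.
move=> [al [M aM]].
have [| | |b bb bP] := @sesqui_op (fun u v => ip u (a v)) M.
- by move=> c u v w; rewrite ipDl ipZl.
- by move=> c u v w; rewrite al ipDr ipZr.
- move=> u v; rewrite (le_trans (cauchy_schwarz _ _)) // mulrAC mulrC.
  by rewrite ler_wpM2r ?hnorm_ge0.
- by exists b => // u v; rewrite ipC -bP -ipC.
Qed.

End HilbertSpace.

Section BoundedOperators.
Variables (R : realType) (V : lmodType R[i]) (ip : {dot V for Num.conj}).
Implicit Types (u v w : V) (a b d : V -> V) (c : R[i]) (S D : set (V -> V)).
Local Notation normc := ComplexField.Normc.normc.
Local Notation bop := (bounded_op ip).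

Lemma linear_fun0 a : linear a -> a 0 = 0.
Proof.
by move=> la; have := la (-1) 0 0; rewrite scaler0 addr0 scaleN1r addNr.
Qed.

Lemma linear_funD a : linear a -> {morph a : u v / u + v}.
Proof. by move=> la u v; have := la 1 u v; rewrite !scale1r. Qed.

Lemma linear_funZ a c u : linear a -> a (c *: u) = c *: a u.
Proof. by move=> la; have := la c u 0; rewrite !addr0 (linear_fun0 la) addr0. Qed.

Lemma linear_funB a : linear a -> {morph a : u v / u - v}.
Proof. by move=> la u v; rewrite linear_funD // -scaleN1r linear_funZ // scaleN1r. Qed.

Lemma linear_fun_sum a I r (P : pred I) (F : I -> V) : linear a ->
  a (\sum_(i <- r | P i) F i) = \sum_(i <- r | P i) a (F i).
Proof. by move=> la; exact: (big_morph a (linear_funD la) (linear_fun0 la)). Qed.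

Lemma bopP a : bop a ->
  exists2 M : R, 0 < M & forall v, hnorm ip (a v) <= M * hnorm ip v.
Proof.
move=> [_ [M aM]]; exists (`|M| + 1); first by rewrite ltr_wpDl.
move=> v; apply: le_trans (aM v) _; rewrite ler_wpM2r ?hnorm_ge0 //.
by rewrite (le_trans (ler_norm _)) // lerDl.
Qed.

Lemma bop_linear a : bop a -> linear a. Proof. by case. Qed.

Lemma bop0 : bop (fun=> 0).
Proof.
split; first by move=> c u v; rewrite scaler0 addr0.
by exists 0 => v; rewrite hnorm0 mul0r.
Qed.

Lemma bop_id : bop id.
Proof. by split => //; exists 1 => v; rewrite mul1r. Qed.

Lemma bop_comp a b : bop a -> bop b -> bop (a \o b).
Proof.
move=> ba bb; split; first by move=> c u v /=; rewrite bb.1 ba.1.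
have [M M0 aM] := bopP ba; have [K K0 bK] := bopP bb.
exists (M * K) => v; apply: le_trans (aM _) _.
by rewrite -mulrA ler_wpM2l // ltW.
Qed.

Lemma bop_lin c a b : bop a -> bop b -> bop (fun v => c *: a v + b v).
Proof.
move=> ba bb; split.
  move=> k u v; rewrite ba.1 // bb.1 // !scalerDr !scalerA addrACA.
  by rewrite (mulrC c).
have [M M0 aM] := bopP ba; have [K K0 bK] := bopP bb.
exists (normc c * M + K) => v; apply: le_trans (hnormD _ _ _) _.
by rewrite mulrDl lerD // hnormZ -mulrA ler_wpM2l ?normc_ge0.
Qed.

Lemma bop_add a b : bop a -> bop b -> bop (fun v => a v + b v).
Proof.
move=> ba bb; have := bop_lin 1 ba bb.
by congr (bop _); apply/funext => v; rewrite scale1r.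
Qed.

Lemma bop_sum I r (P : pred I) (F : I -> V -> V) : (forall i, P i -> bop (F i)) ->
  bop (fun v => \sum_(i <- r | P i) F i v).
Proof.
move=> bF; elim: r => [|i r IHr].
  by have := bop0; congr (bop _); apply/funext => v; rewrite big_nil.
have [Pi|nPi] := boolP (P i).
  have := bop_add (bF i Pi) IHr.
  by congr (bop _); apply/funext => v; rewrite big_cons Pi.
by move: IHr; congr (bop _); apply/funext => v; rewrite big_cons (negbTE nPi).
Qed.

Lemma isometry_bop a : linear a -> (forall u, sqn ip (a u) = sqn ip u) -> bop a.
Proof. by move=> la ia; split => //; exists 1 => v; rewrite !hnormE ia mul1r. Qed.

Lemma hclosed_eq a b : bop a -> bop b -> hclosed ip [set v | a v = b v].
Proof.
move=> ba bb v H; apply/eqP; rewrite -subr_eq0; apply/eqP.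
apply: hnorm_small => e e0.
have [M M0 aM] := bopP ba; have [K K0 bK] := bopP bb.
have [w /= E vw] := H (e / (M + K)) ltac:(by rewrite divr_gt0 // addr_gt0).
have -> : a v - b v = a (v - w) - b (v - w).
  by rewrite (linear_funB ba.1) (linear_funB bb.1) E opprB addrA subrK.
apply: le_trans (hnormD _ _ _) _; rewrite hnormN.
move: vw; rewrite ltr_pdivlMr ?addr_gt0 // => /ltW; apply: le_trans.
by rewrite mulrC mulrDl lerD.
Qed.

Lemma is_adjointC a b : is_adjoint ip a b -> is_adjoint ip b a.
Proof. by move=> H u v; rewrite ipC -H -ipC. Qed.

Lemma adjointE a b : is_adjoint ip a b -> adjoint ip a = b.
Proof.
move=> ab; rewrite /adjoint; case: xgetP => [b' _ H|/(_ b)//].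
by apply/funext => v; apply: (ip_injr (ip := ip)) => u; rewrite -H ab.
Qed.

Lemma is_adjoint_comp a a' b b' : is_adjoint ip a a' -> is_adjoint ip b b' ->
  is_adjoint ip (a \o b) (b' \o a').
Proof. by move=> A B u v /=; rewrite A B. Qed.

Lemma is_adjoint_sum I r (P : pred I) (F G : I -> V -> V) :
  (forall i, P i -> is_adjoint ip (F i) (G i)) ->
  is_adjoint ip (fun v => \sum_(i <- r | P i) F i v) (fun v => \sum_(i <- r | P i) G i v).
Proof. by move=> H u v; rewrite ip_suml ip_sumr; apply: eq_bigr => i /H. Qed.

Lemma isometry_dot a : linear a -> (forall u, sqn ip (a u) = sqn ip u) ->
  forall u v, ip (a u) (a v) = ip u v.
Proof.
move=> la ia.
have re u v : complex.Re (ip (a u) (a v)) = complex.Re (ip u v).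
  have := ia (u + v); rewrite (linear_funD la) !sqnD !ia => /addrI.
  by apply: mulfI; rewrite pnatr_eq0.
move=> u v; apply/eqP; rewrite eq_complex re eqxx /=.
have := re u ('i%C *: v); rewrite linear_funZ // !ipZr.
by case: (ip _ _) => x y; case: (ip _ _) => x' y' /=; rewrite !mul0r !mulN1r !sub0r !opprK => ->.
Qed.

Lemma unitary_adjoint a b : linear a -> (forall u, sqn ip (a u) = sqn ip u) ->
  cancel b a -> is_adjoint ip a b.
Proof. by move=> la ia ba u v; rewrite -{1}[v]ba isometry_dot. Qed.

Definition star_closed D := forall d, D d -> exists2 d', D d' & is_adjoint ip d d'.

Lemma commutantP S a : commutant ip S a <->
  bop a /\ forall b, S b -> forall v, a (b v) = b (a v).
Proof.
split=> -[ba H]; split=> // b Sb; last by apply/funext => v; exact: H.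
by move=> v; have := congr1 (fun f => f v) (H _ Sb).
Qed.

Lemma commutant_bop S a : commutant ip S a -> bop a. Proof. by case. Qed.

Lemma commutant_comp S a b : commutant ip S a -> commutant ip S b -> commutant ip S (a \o b).
Proof.
move=> /commutantP[ba Ha] /commutantP[bb Hb]; apply/commutantP; split.
  exact: bop_comp.
by move=> d Sd v /=; rewrite Hb // Ha.
Qed.

Lemma commutant0 S : S `<=` bop -> commutant ip S (fun=> 0).
Proof.
by move=> bS; apply/commutantP; split=> [|d /bS[ld _] v]; [exact: bop0 | rewrite (linear_fun0 ld)].
Qed.

Lemma commutant_lin S c a b : S `<=` bop -> commutant ip S a -> commutant ip S b ->
  commutant ip S (fun v => c *: a v + b v).
Proof.
move=> bS /commutantP[ba Ha] /commutantP[bb Hb]; apply/commutantP; split.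
  exact: bop_lin.
by move=> d Sd v /=; rewrite Hb // Ha // (bS _ Sd).1.
Qed.

Lemma commutant_sum S I r (P : pred I) (F : I -> V -> V) : S `<=` bop ->
  (forall i, P i -> commutant ip S (F i)) ->
  commutant ip S (fun v => \sum_(i <- r | P i) F i v).
Proof.
move=> bS CF; apply/commutantP; split.
  by apply: bop_sum => i /CF/commutant_bop.
move=> d Sd v; rewrite (linear_fun_sum _ _ _ (bS _ Sd).1); apply: eq_bigr => i /CF.
by move=> /commutantP[_]; apply.
Qed.

Lemma commutantS S S' : S `<=` S' -> commutant ip S' `<=` commutant ip S.
Proof. by move=> SS a [ba H]; split => // b /SS; exact: H. Qed.

Lemma sub_bicommutant S : S `<=` bop -> S `<=` commutant ip (commutant ip S).
Proof. by move=> bS a Sa; split; [exact: bS|move=> b [_ H]; rewrite H]. Qed.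

Lemma commutant_bops S : commutant ip S `<=` bop. Proof. by move=> a []. Qed.

Lemma commutant_adj S a b : star_closed S -> S `<=` bop -> bop b -> is_adjoint ip a b ->
  commutant ip S a -> commutant ip S b.
Proof.
move=> sS bS bb ab /commutantP[ba H]; apply/commutantP; split => // d Sd v.
have [d' Sd' dd'] := sS _ Sd.
by apply: (ip_injr (ip := ip)) => u; rewrite -ab -(is_adjointC dd') -H // ab (is_adjointC dd').
Qed.

Hypothesis Vcomplete : hcomplete ip.

Lemma adjointP a : bop a -> is_adjoint ip a (adjoint ip a).
Proof. by move=> /(bounded_adjoint Vcomplete)[b _ ab]; rewrite (adjointE ab). Qed.

Lemma bop_adjoint a : bop a -> bop (adjoint ip a).
Proof. by move=> /(bounded_adjoint Vcomplete)[b bb ab]; rewrite (adjointE ab). Qed.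

Lemma adj_set_bop S : S `<=` bop -> S `|` [set adjoint ip a | a in S] `<=` bop.
Proof. by move=> bS a [/bS//|[b /bS bb <-]]; exact: bop_adjoint. Qed.

Lemma adj_set_star S : S `<=` bop -> star_closed (S `|` [set adjoint ip a | a in S]).
Proof.
move=> bS d [Sd|[b Sb <-]].
  by exists (adjoint ip d); [right; exists d|exact/adjointP/bS].
by exists b; [left|exact/is_adjointC/adjointP/bS].
Qed.

Lemma commutant_star S : star_closed S -> S `<=` bop -> star_closed (commutant ip S).
Proof.
move=> sS bS d Cd; exists (adjoint ip d); last exact/adjointP/(commutant_bop Cd).
apply: (commutant_adj sS bS _ _ Cd); first exact/bop_adjoint/(commutant_bop Cd).
exact/adjointP/(commutant_bop Cd).
Qed.

Lemma sub_vn_gen S : S `<=` bop -> S `<=` vn_gen ip S.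
Proof.
move=> bS a Sa; apply: (sub_bicommutant (adj_set_bop bS)); by left.
Qed.

Lemma vn_gen_star S : S `<=` bop -> star_closed (vn_gen ip S).
Proof.
move=> bS; apply: commutant_star; last exact: commutant_bops.
by apply: commutant_star; [exact: adj_set_star|exact: adj_set_bop].
Qed.

Lemma adj_set_commutant S D : star_closed D -> D `<=` bop -> S `<=` commutant ip D ->
  D `<=` commutant ip (S `|` [set adjoint ip a | a in S]).
Proof.
move=> sD bD SD d Dd; apply/commutantP; split; first exact: bD.
have sub a : commutant ip D a -> forall v, d (a v) = a (d v).
  by move=> /commutantP[_ H] v; rewrite H.
move=> a [/SD/sub//|[b /SD Cb <-]]; apply: sub.
apply: (commutant_adj sD bD _ _ Cb); first exact/bop_adjoint/(commutant_bop Cb).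
exact/adjointP/(commutant_bop Cb).
Qed.

Lemma vn_gen_min S D : star_closed D -> D `<=` bop -> S `<=` commutant ip D ->
  vn_gen ip S `<=` commutant ip D.
Proof. by move=> sD bD SD; apply: commutantS; exact: adj_set_commutant. Qed.

Lemma vn_gen_comp S a b : vn_gen ip S a -> vn_gen ip S b -> vn_gen ip S (a \o b).
Proof. exact: commutant_comp. Qed.

Lemma vn_gen_lin S c a b : vn_gen ip S a -> vn_gen ip S b ->
  vn_gen ip S (fun v => c *: a v + b v).
Proof. by apply: commutant_lin; exact: commutant_bops. Qed.

Lemma vn_gen_sum S I r (P : pred I) (F : I -> V -> V) :
  (forall i, P i -> vn_gen ip S (F i)) ->
  vn_gen ip S (fun v => \sum_(i <- r | P i) F i v).
Proof. by apply: commutant_sum; exact: commutant_bops. Qed.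

End BoundedOperators.

Section FfunHilbert.
Variables (R : realType) (I : finType) (V : lmodType R[i]) (ip : {dot V for Num.conj}).
Implicit Types (f g : {ffun I -> V}).
Local Notation fdot := (@ffun_dot R I V ip : {dot {ffun I -> V} for Num.conj}).

Lemma fdotE f g : fdot f g = \sum_i ip (f i) (g i). Proof. by []. Qed.

Lemma sqn_ffun f : sqn fdot f = \sum_i sqn ip (f i).
Proof.
apply: (@complexI R); rewrite -ip_sqn fdotE rmorph_sum; apply: eq_bigr => i _.
exact: ip_sqn.
Qed.

Lemma hnorm_ffun_ge f i : hnorm ip (f i) <= hnorm fdot f.
Proof.
rewrite !hnormE ler_sqrt ?sqn_ge0 // sqn_ffun (bigD1 i) //= lerDl sumr_ge0 // => j _.
exact: sqn_ge0.
Qed.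

Lemma hnorm_ffun_le f : hnorm fdot f <= \sum_i hnorm ip (f i).
Proof.
have S0 : 0 <= \sum_i hnorm ip (f i) by rewrite sumr_ge0 // => i _; exact: hnorm_ge0.
rewrite -(@ler_pXn2r _ 2) ?nnegrE ?hnorm_ge0 // sqr_hnorm sqn_ffun expr2 mulr_suml ler_sum // => i _.
rewrite -sqr_hnorm expr2 ler_wpM2l ?hnorm_ge0 // (bigD1 i) //= lerDl.
by rewrite sumr_ge0 // => j _; exact: hnorm_ge0.
Qed.

Lemma ffun_complete : hcomplete ip -> hcomplete fdot.
Proof.
move=> cV u uC.
have /choice[l lP] i : exists l, forall e : R, 0 < e -> exists n0, forall n, (n0 <= n)%N ->
      hnorm ip (u n i - l) < e.
  apply: (cV (fun n => u n i)) => e /uC[n0 H]; exists n0 => n m n0n n0m.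
  by apply: le_lt_trans (H n m n0n n0m); have := hnorm_ffun_ge (u n - u m) i; rewrite !ffunE.
exists [ffun i => l i] => e e0.
have k0 : (0 : R) < #|I|.+1%:R by rewrite ltr0n.
have /choice[n nP] i := lP i (e / #|I|.+1%:R) ltac:(by rewrite divr_gt0).
exists (\max_i n i)%N => m Hm; apply: le_lt_trans (hnorm_ffun_le _) _.
apply: (@le_lt_trans _ _ (\sum_(i : I) e / #|I|.+1%:R)).
  apply: ler_sum => i _; rewrite !ffunE; apply/ltW/nP/(leq_trans _ Hm).
  exact: (leq_bigmax i).
rewrite sumr_const -[_ *+ #|_|]mulr_natr -mulrA gtr_pMr // mulrC ltr_pdivrMr // mul1r.
by rewrite ltr_nat.
Qed.

End FfunHilbert.

(** * Going to infinity in a power of an infinite group *)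

Section DisplacementFilter.
Variables (G : groupType) (N : nat).
Local Notation Gam := ('I_N -> G).

Definition fmul (g h : Gam) : Gam := fun i => (g i * h i)%g.
Definition finv (g : Gam) : Gam := fun i => (g i)^-1%g.
Definition fone : Gam := fun=> 1%g.
Definition fperm (g : Gam) (s : 'S_N) : Gam := fun i => g (s i).

(* A basis of the filter along which the displacement of one coordinate of [h]
   from another leaves every finite set. *)
Definition displaced (F : seq G) : set Gam :=
  [set h | forall i j q f, i != j -> q \in F -> f \in F -> ((h j)^-1 * q * h i)%g != f].

Definition displacement : set_system Gam := filter_from setT displaced.

Hypothesis G_infinite : infinite_set [set: G].

Lemma fresh_element (l : seq G) : exists x, x \notin l.
Proof.
apply/not_existsP => H; apply: G_infinite; apply/finite_seqP; exists l.
by apply/seteqP; split => x // _ /=; have /negP := H x; rewrite negbK.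
Qed.

Lemma displaced_sequence (F : seq G) (n : nat) : exists a : nat -> G,
  forall i j q f, (i < n)%N -> (j < n)%N -> i != j -> q \in F -> f \in F ->
    ((a j)^-1 * q * a i)%g != f.
Proof.
elim: n => [|n [a aP]]; first by exists (fun=> 1%g).
pose l := [seq ((x.1)^-1 * y * x.2)%g | x <- [seq (q, f) | q <- F, f <- F], y <- [seq a i | i <- iota 0 n]]
  ++ [seq (x.1 * y * (x.2)^-1)%g | x <- [seq (q, f) | q <- F, f <- F], y <- [seq a i | i <- iota 0 n]].
have [x] := fresh_element l; rewrite mem_cat negb_or => /andP[x1 x2].
exists (fun i => if i == n then x else a i) => i j q f; rewrite !ltnS => le_i le_j ij qF fF.
have mem k : (k < n)%N -> a k \in [seq a i | i <- iota 0 n].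
  by move=> kn; apply: map_f; rewrite mem_iota.
have [ei|ni] := eqVneq i n; have [ej|nj] := eqVneq j n.
- by rewrite ei ej eqxx in ij.
- apply: contra x1 => /eqP E; apply/allpairsP; exists ((q, f), a j); split => /=.
  + by apply/allpairsP; exists (q, f).
  + by apply: mem; rewrite ltn_neqAle nj.
  + by rewrite -E !mulgA mulgK mulVg mul1g.
- apply: contra x2 => /eqP E; apply/allpairsP; exists ((q, f), a i); split => /=.
  + by apply/allpairsP; exists (q, f).
  + by apply: mem; rewrite ltn_neqAle ni.
  + by rewrite -E !invMg !mulgA invgK mulgK mulgV mul1g.
- by apply: aP => //; rewrite ltn_neqAle ?ni ?nj.
Qed.

Lemma displacement_proper : ProperFilter displacement.
Proof.
apply: filter_from_proper.
  apply: filter_fromT_filter; first by exists [::].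
  move=> F F'; exists (F ++ F') => h H; split=> i j q f ij qF fF; apply: H => //;
    by rewrite mem_cat ?qF ?fF ?orbT.
move=> F _; have [a aP] := displaced_sequence F N.
by exists (fun i => a i) => i j q f ij qF fF; apply: aP.
Qed.

Lemma displacement_avoid (E : set Gam) (b : Gam) (s t : 'S_N) : finite_set E -> s != t ->
  displacement [set h | ~ E (fmul (fmul (finv (fperm h s)) b) (fperm h t))].
Proof.
move=> fE st; have [i ist] : exists i, s i != t i.
  apply/existsP; rewrite -negb_forall; apply: contra st => /forallP st.
  by apply/eqP/permP => i; apply/eqP.
have /finite_seqP[l El] := finite_image (fun g : Gam => g i) fE.
exists (b i :: l) => // h H /= Eh.
have hl : ((h (s i))^-1 * b i * h (t i))%g \in b i :: l.
  have : [set g i | g in E] ((h (s i))^-1 * b i * h (t i))%g.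
    by eexists; [exact: Eh|].
  by rewrite El /= inE => ->; rewrite orbT.
have := H (t i) (s i) (b i) _ _ (mem_head _ _) hl.
by rewrite eq_sym ist eqxx => /(_ isT).
Qed.

End DisplacementFilter.

Section UltraLimit.
Variables (R : realType) (T : Type) (U : set_system T) (UU : UltraFilter U).
Local Notation normc := ComplexField.Normc.normc.

Definition cbounded (c : T -> R[i]) := exists M : R, forall h, normc (c h) <= M.

Definition ulim (c : T -> R[i]) : R[i] :=
  xget 0 [set z | forall e : R, 0 < e -> U [set h | normc (c h - z) < e]].

Lemma ultra_real_limit (c : T -> R) (M : R) : (forall h, `|c h| <= M) ->
  exists z : R, forall e : R, 0 < e -> U [set h | `|c h - z| < e].
Proof.
move=> cM; have := @segment_compact R (- M) M.
have cU : (c @ U) (`[(- M), M]%classic : set R).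
  rewrite /fmap /= /nbhs /=; apply: filterS filterT => h _ /=.
  by rewrite in_itv /= -ler_norml.
move=> /(_ (c @ U) _ cU)[z [_ clz]]; exists z => e e0.
have [//|Un] := in_ultra_setVsetC [set h | `|c h - z| < e] UU.
have [x [/= xn xz]] : (c @` [set h | ~ `|c h - z| < e]) `&` ball z e !=set0.
  apply: clz; last exact: nbhsx_ballx.
  by rewrite /fmap /nbhs /=; apply: filterS Un => h hn /=; exists h.
by case: xn => h hn E; case: hn; rewrite E distrC; exact: xz.
Qed.

Lemma Re_le_normc (z : R[i]) : `|complex.Re z| <= normc z.
Proof. by rewrite -lecR; exact: normc_ge_Re. Qed.

Lemma Im_le_normc (z : R[i]) : `|complex.Im z| <= normc z.
Proof.
case: z => x y /=; rewrite -[leLHS]ger0_norm // -sqrtr_sqr ler_wsqrtr //.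
by rewrite real_normK ?num_real // lerDr sqr_ge0.
Qed.

Lemma normc_le_ReIm (z : R[i]) : normc z <= `|complex.Re z| + `|complex.Im z|.
Proof.
case: z => x y /=; rewrite -[leRHS]ger0_norm ?addr_ge0 // -sqrtr_sqr ler_wsqrtr //.
by rewrite sqrrD !real_normK ?num_real // -addrA lerD2l addrC lerDl mulrn_wge0 // mulr_ge0.
Qed.

Lemma ulimP c : cbounded c -> forall e : R, 0 < e -> U [set h | normc (c h - ulim c) < e].
Proof.
move=> [M cM].
suff: exists z, forall e : R, 0 < e -> U [set h | normc (c h - z) < e].
  by rewrite /ulim => /cid[z Hz]; case: xgetP => [z' _ //|/(_ z)].
have [x xP] := ultra_real_limit (fun h => le_trans (Re_le_normc _) (cM h)).
have [y yP] := ultra_real_limit (fun h => le_trans (Im_le_normc _) (cM h)).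
exists (x +i* y)%C => e e0; have e2 : 0 < e / 2 by rewrite divr_gt0.
apply: filterS (filterI (xP _ e2) (yP _ e2)) => h [/= xh yh].
apply: le_lt_trans (normc_le_ReIm _) _; rewrite (splitr e) !raddfB /=.
exact: ltrD.
Qed.

Lemma ulim_unique c z : (forall e : R, 0 < e -> U [set h | normc (c h - z) < e]) ->
  ulim c = z.
Proof.
move=> cz.
have cl : forall e : R, 0 < e -> U [set h | normc (c h - ulim c) < e].
  by rewrite /ulim; case: xgetP => [z' _ //|/(_ z)].
apply/eqP; rewrite -subr_eq0; apply/eqP/normc_small => e e0.
have e2 : 0 < e / 2 by rewrite divr_gt0.
have [h [/= h1 h2]] := filter_ex (filterI (cz _ e2) (cl _ e2)).
have -> : ulim c - z = (c h - z) - (c h - ulim c) by ring.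
apply: le_trans (normc_triangle _ _) _.
by rewrite normcN' (splitr e) lerD // ltW.
Qed.

Lemma ulim_lin (k : R[i]) c d : cbounded c -> cbounded d ->
  ulim (fun h => k * c h + d h) = k * ulim c + ulim d.
Proof.
move=> bc bd; apply: ulim_unique => e e0.
have k0 : 0 < normc k + 1 by rewrite ltr_wpDl ?normc_ge0.
apply: filterS (filterI (ulimP bc (divr_gt0 e0 (mulr_gt0 (ltr0Sn R 1) k0)))
                        (ulimP bd (divr_gt0 e0 (ltr0Sn R 1)))) => h [/= hc hd].
have -> : k * c h + d h - (k * ulim c + ulim d) = k * (c h - ulim c) + (d h - ulim d) by ring.
apply: le_lt_trans (normc_triangle _ _) _.
rewrite (splitr e) ler_ltD // ComplexField.Normc.normcM.
move: hc; rewrite invfM mulrA ltr_pdivlMr // => /ltW; apply: le_trans.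
by rewrite mulrC ler_wpM2l ?normc_ge0 // lerDl.
Qed.

Lemma ulim_le c (M : R) : (forall h, normc (c h) <= M) -> normc (ulim c) <= M.
Proof.
move=> cM; apply/ler_addgt0Pr => e e0.
have [h /= hP] := filter_ex (ulimP (ex_intro _ M cM) e0).
have -> : ulim c = c h - (c h - ulim c) by ring.
apply: le_trans (normc_triangle _ _) _.
by rewrite normcN' lerD // ltW.
Qed.

Lemma cbounded_lin (k : R[i]) c d : cbounded c -> cbounded d -> cbounded (fun h => k * c h + d h).
Proof.
move=> [M cM] [K dK]; exists (normc k * M + K) => h.
apply: le_trans (normc_triangle _ _) _.
by rewrite lerD // ComplexField.Normc.normcM ler_wpM2l ?normc_ge0.
Qed.

Lemma ulim_sum (I : Type) (r : seq I) (P : pred I) (F : I -> T -> R[i]) :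
  (forall i, P i -> cbounded (F i)) ->
  ulim (fun h => \sum_(i <- r | P i) F i h) = \sum_(i <- r | P i) ulim (F i).
Proof.
move=> bF.
suff [] : cbounded (fun h => \sum_(i <- r | P i) F i h) /\
  ulim (fun h => \sum_(i <- r | P i) F i h) = \sum_(i <- r | P i) ulim (F i) by [].
elim: r => [|i r [bI IHr]].
  rewrite big_nil; split.
    by exists 0 => h; rewrite big_nil normc_real.
  apply: ulim_unique => e e0; apply: filterS filterT => h _ /=.
  by rewrite big_nil subr0 normc_real.
rewrite big_cons; have [Pi|nPi] := ifPn.
  have E : (fun h => \sum_(j <- i :: r | P j) F j h) =
           (fun h => 1 * F i h + \sum_(j <- r | P j) F j h).
    by apply/funext => h; rewrite big_cons Pi mul1r.
  by rewrite E ulim_lin ?IHr ?mul1r //; [split => //; apply: cbounded_lin => //|]; exact: bF.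
have -> : (fun h => \sum_(j <- i :: r | P j) F j h) = (fun h => \sum_(j <- r | P j) F j h).
  by apply/funext => h; rewrite big_cons (negbTE nPi).
by [].
Qed.

Lemma ulim_cst (z : R[i]) : ulim (fun=> z) = z.
Proof.
apply: ulim_unique => e e0; apply: filterS filterT => h _ /=.
by rewrite subrr normc_real.
Qed.

End UltraLimit.

(** * Wandering vectors *)

Lemma infinite_injection T (A : set T) : infinite_set A ->
  exists2 f : nat -> T, forall k, A (f k) & injective f.
Proof.
move=> /infiniteP/card_leP[f].
pose i k : [set: nat] := SigSub (mem_set (I : [set: nat] k)).
exists (fun k => \val (f (i k))) => [k|j k /val_inj/inj]; first exact: set_valP.
by rewrite !inE => /(_ I I) /(congr1 \val).
Qed.

Section Wandering.
Variables (R : realType) (V : lmodType R[i]) (ip : {dot V for Num.conj}).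
Variables (G : groupType) (N : nat).
Local Notation Gam := ('I_N -> G).
Local Notation normc := ComplexField.Normc.normc.
Variables (rho : Gam -> V -> V) (S : 'S_N -> V -> V).

Definition wandering (v : V) := forall g, g <> @fone G N -> ip (rho g v) v = 0.

(* All that the geometry of the cover contributes to the theorem. *)
Record wandering_system : Prop := WanderingSystem {
  ws_complete : hcomplete ip;
  ws_infinite : infinite_set [set: G];
  ws_rho_lin : forall g, linear (rho g);
  ws_rho_iso : forall g u, sqn ip (rho g u) = sqn ip u;
  ws_rho1 : forall u, rho (@fone G N) u = u;
  ws_rhoM : forall g h u, rho (fmul g h) u = rho g (rho h u);
  ws_S_lin : forall s, linear (S s);
  ws_S_iso : forall s u, sqn ip (S s u) = sqn ip u;
  ws_S1 : forall u, S 1%g u = u;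
  ws_SM : forall s t u, S (s * t)%g u = S t (S s u);
  ws_S_rho : forall s g u, S s (rho g u) = rho (fperm g s^-1%g) (S s u);
  ws_total : forall v, (forall w, wandering w -> ip v w = 0) -> v = 0 }.

Hypothesis ws : wandering_system.
Let Vcomplete := ws_complete ws.
Let G_infinite := ws_infinite ws.
Let rho_lin := ws_rho_lin ws.
Let rho_iso := ws_rho_iso ws.
Let rho1 := ws_rho1 ws.
Let rhoM := ws_rhoM ws.
Let S_lin := ws_S_lin ws.
Let S_iso := ws_S_iso ws.
Let S1 := ws_S1 ws.
Let SM := ws_SM ws.
Let S_rho := ws_S_rho ws.
Let wandering_total := ws_total ws.

Definition rhoC : set (V -> V) := commutant ip (range rho).

Lemma fmulA (g h k : Gam) : fmul g (fmul h k) = fmul (fmul g h) k.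
Proof. by apply/funext => i; rewrite /fmul mulgA. Qed.
Lemma fmulV (g : Gam) : fmul g (finv g) = @fone G N.
Proof. by apply/funext => i; rewrite /fmul /finv mulgV. Qed.
Lemma fmulVr (g : Gam) : fmul (finv g) g = @fone G N.
Proof. by apply/funext => i; rewrite /fmul /finv mulVg. Qed.
Lemma fmul1l (g : Gam) : fmul (@fone G N) g = g.
Proof. by apply/funext => i; rewrite /fmul mul1g. Qed.
Lemma fmul1r (g : Gam) : fmul g (@fone G N) = g.
Proof. by apply/funext => i; rewrite /fmul mulg1. Qed.

Lemma finvK (g : Gam) : finv (finv g) = g.
Proof. by apply/funext => i; rewrite /finv invgK. Qed.
Lemma fpermM (g h : Gam) s : fperm (fmul g h) s = fmul (fperm g s) (fperm h s).
Proof. by []. Qed.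
Lemma fpermV (g : Gam) s : fperm (finv g) s = finv (fperm g s).
Proof. by []. Qed.

Lemma rho_bop g : bounded_op ip (rho g). Proof. exact: isometry_bop. Qed.
Lemma S_bop s : bounded_op ip (S s). Proof. exact: isometry_bop. Qed.

Lemma rhoVK g : cancel (rho (finv g)) (rho g).
Proof. by move=> u; rewrite -rhoM fmulV rho1. Qed.
Lemma SK s : cancel (S s) (S s^-1%g).
Proof. by move=> u; rewrite -SM mulgV S1. Qed.
Lemma SVK s : cancel (S s^-1%g) (S s).
Proof. by move=> u; rewrite -SM mulVg S1. Qed.

Lemma rho_adj g : is_adjoint ip (rho g) (rho (finv g)).
Proof. by apply: unitary_adjoint => //; exact: rhoVK. Qed.
Lemma S_adj s : is_adjoint ip (S s) (S s^-1%g).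
Proof. by apply: unitary_adjoint => //; exact: SVK. Qed.

Lemma rho_star : star_closed ip (range rho).
Proof. by move=> _ [g _ <-]; exists (rho (finv g)); [exists (finv g)|exact: rho_adj]. Qed.

Lemma range_rho_bop : range rho `<=` bounded_op ip.
Proof. by move=> _ [g _ <-]; exact: rho_bop. Qed.

Lemma rhoCP x : rhoC x <-> bounded_op ip x /\ forall g u, x (rho g u) = rho g (x u).
Proof.
split=> [/commutantP[bx H]|[bx H]]; first by split => // g u; apply: H; exists g.
by apply/commutantP; split => // _ [g _ <-] u.
Qed.

Lemma rho_ipl g u v : ip (rho g u) v = ip u (rho (finv g) v).
Proof. exact: rho_adj. Qed.
Lemma rho_ipr g u v : ip u (rho g v) = ip (rho (finv g) u) v.
Proof. by rewrite rho_ipl finvK. Qed.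

Lemma wandering_orth g h v : wandering v -> g <> h -> ip (rho g v) (rho h v) = 0.
Proof.
move=> wv gh; rewrite rho_ipr -rhoM; apply: wv => E.
apply: gh; have := congr1 (fmul h) E.
by rewrite fmulA fmulV fmul1l fmul1r.
Qed.

Lemma wandering_rho h v : wandering v -> wandering (rho h v).
Proof.
move=> wv g g1; rewrite -rhoM; apply: wandering_orth => // E; apply: g1.
have := congr1 (fun x => fmul x (finv h)) E.
by rewrite -fmulA fmulV fmul1r.
Qed.

Lemma subspace_total (Z : set V) : subspace Z -> hclosed ip Z -> wandering `<=` Z ->
  forall v, Z v.
Proof.
move=> sZ cZ WZ; apply: (closed_orth_full Vcomplete sZ cZ WZ) => v /wandering_total->.
by case: sZ.
Qed.

Lemma bessel n (e : 'I_n -> V) (s : R) v : 0 < s -> (forall i, sqn ip (e i) = s) ->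
  (forall i j, i != j -> ip (e i) (e j) = 0) ->
  \sum_i normc (ip v (e i)) ^+ 2 <= s * sqn ip v.
Proof.
move=> s0 es eo; pose w := \sum_i (ip v (e i) / (s%:C)%C) *: e i.
have sC : (s%:C)%C != 0 :> R[i] by rewrite -(rmorph0 (real_complex R)) (inj_eq (@complexI R)) gt_eqF.
have we i : ip w (e i) = ip v (e i).
  rewrite ip_suml (bigD1 i) //= big1 => [|j ji]; last by rewrite ipZl eo // mulr0.
  by rewrite addr0 ipZl ip_sqn es divfK.
pose n2 : R := \sum_i normc (ip v (e i)) ^+ 2.
have E u : (forall i, ip u (e i) = ip v (e i)) -> ip u w = (n2 / s)%:C%C.
  move=> uE; rewrite ip_sumr rmorphM rmorph_sum mulr_suml; apply: eq_bigr => i _.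
  rewrite ipZr uE fmorphV /= sqr_normcE.
  have -> : ((ip v (e i) / s%:C)^*)%C = (ip v (e i))^*%C / s%:C%C.
    by rewrite fmorph_div /= oppr0.
  by rewrite mulrAC; congr (_ * _); rewrite mulrC.
have := sqn_ge0 ip (v - w); rewrite sqnB {2}/sqn !E //=.
by rewrite -/n2 (mulrC s) -ler_pdivrMr //; move: (n2 / s) (sqn ip v) => x y; lra.
Qed.

(* For a wandering [u] this is Bessel's inequality for the orthogonal family
   [rho g u], and the property passes to closed linear spans. *)
Lemma mixing u v (e : R) : 0 < e -> finite_set [set g | e <= normc (ip (rho g u) v)].
Proof.
pose Z := [set u | forall (e : R), 0 < e ->
  finite_set [set g | e <= normc (ip (rho g u) v)]].
suff: Z u by exact.
apply: subspace_total.
- split=> [e' e0|c x y Zx Zy e' e0].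
    apply: sub_finite_set (finite_set0 Gam) => g /=.
    by rewrite (linear_fun0 (rho_lin g)) ip0l normc_real // leNgt e0.
  have k0 : 0 < normc c + 1 by rewrite ltr_wpDl ?normc_ge0.
  have := conj (Zx (e' / 2 / (normc c + 1)) ltac:(by rewrite !divr_gt0))
    (Zy (e' / 2) ltac:(by rewrite divr_gt0)).
  rewrite -finite_setU; apply: sub_finite_set => g /=.
  rewrite rho_lin ipDl ipZl => le; apply/orP; rewrite -implyNb; apply/implyP.
  rewrite -ltNge => lt; rewrite leNgt; apply: contraTN le => lt'; rewrite -ltNge.
  apply: le_lt_trans (normc_triangle _ _) _; rewrite (splitr e').
  rewrite ltr_pdivlMr // in lt; apply: ltr_leD; last exact: ltW.
  rewrite ComplexField.Normc.normcM mulrC; apply: le_lt_trans lt.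
  by rewrite ler_wpM2l ?normc_ge0 // lerDl.
- move=> x clx e' e0.
  have k0 : 0 < hnorm ip v + 1 by rewrite ltr_wpDl ?hnorm_ge0.
  have [y Zy xy] := clx (e' / 2 / (hnorm ip v + 1)) ltac:(by rewrite !divr_gt0).
  apply: sub_finite_set (Zy (e' / 2) ltac:(by rewrite divr_gt0)) => g /= le.
  rewrite leNgt; apply: contraTN le => lt; rewrite -ltNge.
  rewrite -[x](subrK y) linear_funD // ipDl.
  apply: le_lt_trans (normc_triangle _ _) _; rewrite (splitr e') ler_ltD //.
  apply: le_trans (cauchy_schwarz _ _ _) _; rewrite (hnormE _ (rho _ _)) rho_iso -hnormE.
  rewrite ltr_pdivlMr // in xy; apply: le_trans (ltW xy).
  by rewrite ler_wpM2l ?hnorm_ge0 // lerDl.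
move=> x wx e' e0; apply: contrapT => /infinite_injection[f fP finj].
have [xz|x0] := eqVneq x 0.
  have := fP 0%N; rewrite xz /= (linear_fun0 (rho_lin _)) ip0l normc_real //.
  by rewrite leNgt e0.
pose n := Num.truncn (sqn ip x * sqn ip v / e' ^+ 2).
have sx : 0 < sqn ip x by rewrite lt_neqAle eq_sym sqn_eq0 x0 sqn_ge0.
have fo (i j : 'I_n.+1) : i != j -> ip (rho (f i) x) (rho (f j) x) = 0.
  move=> ij; apply: wandering_orth => // /finj E.
  by case/negP: ij; apply/eqP/val_inj.
have := bessel v sx (fun i : 'I_n.+1 => rho_iso (f i) x) fo.
apply/negP; rewrite -ltNge.
apply: (@lt_le_trans _ _ (\sum_(i < n.+1) e' ^+ 2)).
  rewrite sumr_const card_ord -[_ *+ n.+1]mulr_natl -ltr_pdivrMr ?exprn_gt0 //.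
  exact: truncnS_gt.
apply: ler_sum => i _; rewrite ler_pXn2r ?nnegrE ?normc_ge0 ?(ltW e0) //.
have := fP i; rewrite /= => /le_trans; apply.
by rewrite ipC normcJ'.
Qed.

Lemma mixing_displaced (s t : 'S_N) b u v (e : R) : s != t -> 0 < e ->
  displacement [set h : Gam | normc (ip (rho (fmul (fmul (finv (fperm h s)) b) (fperm h t)) u) v) < e].
Proof.
move=> st e0.
have := displacement_avoid b (mixing u v e0) st.
have PF := displacement_proper N G_infinite.
by apply: filterS => h /= H; rewrite ltNge; apply/negP.
Qed.

(* Apply [rho (finv (fperm k t))]: as [k] goes to infinity only the term
   [s = t] keeps a nonzero weak limit. *)
Lemma perm_independent (z : 'S_N -> V -> V) u :
  (forall k, \sum_s rho (fperm k s) (z s u) = 0) -> forall s, z s u = 0.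
Proof.
move=> zE t; apply: (ip_inj (ip := ip)) => v; rewrite ip0l.
apply: normc_small => e e0.
have PF := displacement_proper N G_infinite.
have n0 : (0 : R) < #|{perm 'I_N}|.+1%:R by rewrite ltr0n.
pose A (s : 'S_N) : set Gam := [set h | s != t ->
   normc (ip (rho (fmul (finv (fperm h t)) (fperm h s)) (z s u)) v) <= e / #|{perm 'I_N}|.+1%:R].
have AP s : displacement (A s).
  have [->|st] := eqVneq s t; first by apply: filterS filterT => h _; rewrite /A /= eqxx.
  rewrite eq_sym in st.
  have := mixing_displaced (@fone G N) (z s u) v st (divr_gt0 e0 n0).
  by apply: filterS => h /=; rewrite fmul1r /A /= => /ltW.
have [h hP] := @filter_ex _ _ PF _ (@filter_forall _ _ A _ _ AP).
rewrite {}/A /= in AP hP.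
have := congr1 (fun x => ip (rho (finv (fperm h t)) x) v) (zE h).
rewrite /= (linear_fun0 (rho_lin _)) ip0l (linear_fun_sum _ _ _ (rho_lin _)) ip_suml.
rewrite (bigD1 t) //= -rhoM fmulVr rho1 => /eqP; rewrite addr_eq0 => /eqP->.
rewrite normcN'; apply: (@le_trans _ _ (\sum_(s : 'S_N | s != t) e / #|{perm 'I_N}|.+1%:R)).
  apply: (big_rec2 (fun x (y : R) => normc x <= y)) => [|s x y st xy]; first by rewrite normc_real.
  apply: le_trans (normc_triangle _ _) _; by rewrite lerD // -rhoM hP.
apply: (@le_trans _ _ (\sum_(s : 'S_N) e / #|{perm 'I_N}|.+1%:R)).
  rewrite [leRHS](bigD1 t) //= lerDr divr_ge0 // ltW //.
rewrite sumr_const -[_ *+ #|_|]mulr_natr -mulrA ger_pMr // mulrC ler_pdivrMr // mul1r.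
by rewrite ler_nat.
Qed.

Definition perm_sum (g : Gam) (u : V) : V := \sum_s rho (fperm g s) u.

Lemma sum_permV (F : 'S_N -> V) : \sum_s F s^-1%g = \sum_s F s.
Proof.
by rewrite (reindex_inj (@invg_inj _)); apply: eq_bigr => s _; rewrite invgK.
Qed.

Lemma fpermK (g : Gam) s : fperm (fperm g s) s^-1%g = g.
Proof. by apply/funext => i; rewrite /fperm permKV. Qed.

Lemma fpermVK (g : Gam) s : fperm (fperm g s^-1%g) s = g.
Proof. by apply/funext => i; rewrite /fperm permK. Qed.

Lemma fperm1 (g : Gam) : fperm g 1%g = g.
Proof. by apply/funext => i; rewrite /fperm perm1. Qed.

Lemma S_rhoV s g u : S s^-1%g (rho g u) = rho (fperm g s) (S s^-1%g u).
Proof. by rewrite S_rho invgK. Qed.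

Lemma crossed_independent (x : 'S_N -> V -> V) : (forall s, rhoC (x s)) ->
  (forall u, \sum_s x s (S s u) = 0) -> forall s u, x s u = 0.
Proof.
move=> Cx xE s u.
suff H t v : x t^-1%g (S t^-1%g v) = 0 by have := H s^-1%g (S s^-1%g u); rewrite invgK SVK.
apply: (@perm_independent (fun t v => x t^-1%g (S t^-1%g v)) v) => k.
rewrite -[RHS](xE (rho k v)) -(sum_permV (fun s => x s (S s (rho k v)))).
apply: eq_bigr => r _; rewrite S_rhoV.
by have [_ ->] := (rhoCP _).1 (Cx r^-1%g).
Qed.

Theorem perm_sum_commutant y : bounded_op ip y ->
  (forall g u, y (perm_sum g u) = perm_sum g (y u)) ->
  exists2 x : 'S_N -> V -> V, forall s, rhoC (x s) & forall u, y u = \sum_s x s (S s u).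
Proof.
move=> by_ yw; have [ya bya yya] := bounded_adjoint Vcomplete by_.
have PF := displacement_proper N G_infinite.
have [U [UU DU]] := ultraFilterLemma PF.
have [M M0 yM] := bopP by_.
(* The coefficient at [s] is the weak limit of [rho(h o s)^-1 y rho(h)]. *)
pose b s u v (h : Gam) := ip (rho (finv (fperm h s)) (y (rho h u))) v.
have bM s u v h : normc (b s u v h) <= M * hnorm ip u * hnorm ip v.
  apply: le_trans (cauchy_schwarz _ _ _) _; rewrite ler_wpM2r ?hnorm_ge0 //.
  by rewrite hnormE rho_iso -hnormE (le_trans (yM _)) // (hnormE _ (rho _ _)) rho_iso.
have bB s u v : cbounded (b s u v) by eexists; exact: bM.
have bl s c u v w h : b s (c *: u + v) w h = c * b s u w h + b s v w h.
  by rewrite /b rho_lin by_.1 rho_lin ipDl ipZl.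
have br s c u v w h : b s w (c *: u + v) h = (c^*)%C * b s w u h + b s w v h.
  by rewrite /b ipDr ipZr.
have /choice[ys ysP] s : exists ys, bounded_op ip ys /\
    forall u v, ip (ys u) v = ulim U (b s u v).
  have [| | |a ba aP] := @sesqui_op _ _ _ Vcomplete (fun u v => ulim U (b s u v)) M.
  - by move=> c u v w; rewrite -ulim_lin //; congr ulim; apply/funext => h; rewrite bl.
  - by move=> c u v w; rewrite -ulim_lin //; congr ulim; apply/funext => h; rewrite br.
  - by move=> u v; apply: ulim_le => h; exact: bM.
  - by exists a.
have ysE k u : y (rho k u) = \sum_s rho (fperm k s) (ys s u).
  apply: (ip_inj (ip := ip)) => v; rewrite ip_suml.
  under eq_bigr do rewrite rho_ipl (ysP _).2.
  rewrite -ulim_sum //.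
  pose t s (h : Gam) := ip (rho (fmul (fmul (finv (fperm h s)) (@fone G N)) (fperm h 1%g)) u)
    (rho (finv (fperm k s)) (ya v)).
  have tB s : cbounded (t s).
    exists (hnorm ip u * hnorm ip (ya v)) => h; apply: le_trans (cauchy_schwarz _ _ _) _.
    by rewrite !(hnormE _ (rho _ _)) !rho_iso.
  have -> : (fun h => \sum_s b s u (rho (finv (fperm k s)) v) h) = (fun h => \sum_s t s h).
    apply/funext => h; rewrite /b /t.
    have := congr1 (fun z => ip z v) (yw (fmul k (finv h)) (rho h u)).
    rewrite /= /perm_sum ip_suml (linear_fun_sum _ _ _ by_.1) ip_suml => E.
    transitivity (\sum_s ip (rho (fperm (fmul k (finv h)) s) (y (rho h u))) v).
      by apply: eq_bigr => s _; rewrite -rho_ipl -rhoM fpermM fpermV.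
    rewrite -E; apply: eq_bigr => s _; rewrite fmul1r fperm1 -rho_ipl -rhoM yya.
    by rewrite -rhoM fmulA fpermM fpermV.
  rewrite ulim_sum // (bigD1 1%g) //= big1 => [|s s1].
    rewrite addr0 /t (_ : (fun h => _) = (fun=> ip (y (rho k u)) v)) ?ulim_cst //.
    by apply/funext => h; rewrite fmul1r !fperm1 fmulVr rho1 -rho_ipl yya.
  apply: ulim_unique => e e0; apply/DU.
  have := mixing_displaced (@fone G N) u (rho (finv (fperm k s)) (ya v)) s1 e0.
  by apply: filterS => h /=; rewrite subr0.
have ysC s l u : ys s (rho l u) = rho (fperm l s) (ys s u).
  apply/esym/eqP; rewrite -subr_eq0; apply/eqP.
  apply: (@perm_independent (fun s u => rho (fperm l s) (ys s u) - ys s (rho l u)) u) => k.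
  under eq_bigr do rewrite linear_funB // -rhoM -fpermM.
  by rewrite sumrB -!ysE rhoM subrr.
exists (fun s u => ys s^-1%g (S s^-1%g u)) => [s|u].
  apply/rhoCP; split; first exact: bop_comp (ysP _).1 (S_bop _).
  by move=> g u; rewrite S_rhoV ysC fpermK.
rewrite -{1}[u]rho1 ysE -sum_permV; apply: eq_bigr => s _.
by rewrite SK -[RHS]rho1; congr (rho _ _).
Qed.

(* [x] is the off-diagonal block of the projection of [V + V] onto the closed
   invariant subspace spanned by the pairs [(rho g v0, rho g v)]. *)
Lemma rank_one_type v0 v : v != 0 -> wandering v0 -> wandering v ->
  let c := (sqn ip v0 / (sqn ip v0 + sqn ip v))%:C%C in
  exists x, [/\ rhoC x, forall z, hnorm ip (x z) <= hnorm ip z,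
    forall g, x (rho g v0) = c *: rho g v &
    forall z, (forall g, ip z (rho g v0) = 0) -> x z = 0].
Proof.
move=> vn w0 wv c.
pose fd : {dot {ffun bool -> V} for Num.conj} := @ffun_dot R bool V ip.
have cF : hcomplete fd := ffun_complete Vcomplete.
pose pr2 (a b : V) : {ffun bool -> V} := [ffun i => if i then a else b].
have fdE a b f : fd (pr2 a b) f = ip a (f true) + ip b (f false).
  by rewrite /fd fdotE big_bool !ffunE.
pose span := [set f : {ffun bool -> V} | forall q, (forall g, fd q (pr2 (rho g v0) (rho g v)) = 0) -> fd q f = 0].
have sspan : subspace span.
  split=> [q _|k f f' Hf Hf' q Hq]; first exact: ip0r.
  by rewrite ipDr ipZr Hf // Hf' // mulr0 addr0.
have cspan : hclosed fd span.
  move=> f Hf q Hq; apply: (@ip_closed _ _ fd) => e /Hf[f' Hf' ff'].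
  by exists f' => //=; exact: Hf'.
have gspan g : span (pr2 (rho g v0) (rho g v)) by move=> q; apply.
have /choice[P PP] f : exists p, span p /\ forall w, span w -> fd (f - p) w = 0.
  by have [p sp pP] := projection cF f sspan cspan; exists p.
have Puniq f p : span p -> (forall g, fd (f - p) (pr2 (rho g v0) (rho g v)) = 0) -> P f = p.
  move=> sp H; apply/eqP; rewrite -subr_eq0 -(dnorm_eq0 fd); apply/eqP.
  have sd : span (P f - p) by apply: subspaceB sspan (PP f).1 sp.
  have {1}-> : P f - p = (f - p) - (f - P f) by rewrite opprB [RHS]addrC -addrA addKr.
  by rewrite ipBl (sd _ H) (PP f).2 // subrr.
have PE f g : fd (f - P f) (pr2 (rho g v0) (rho g v)) = 0 by exact: (PP f).2.
have Plin k f f' : P (k *: f + f') = k *: P f + P f'.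
  apply: Puniq => [|g]; first exact: sspan.2 (PP f).1 (PP f').1.
  have -> : k *: f + f' - (k *: P f + P f') = k *: (f - P f) + (f' - P f').
    by rewrite scalerBr opprD addrACA.
  by rewrite ipDl ipZl !PE mulr0 addr0.
have Ple f : hnorm fd (P f) <= hnorm fd f.
  rewrite !hnormE ler_sqrt ?sqn_ge0 // -[in leRHS](subrK (P f) f) sqnD.
  by rewrite (PP f).2 ?mulr0 ?addr0 ?lerDr ?sqn_ge0 //; exact: (PP f).1.
pose rr h (f : {ffun bool -> V}) := pr2 (rho h (f true)) (rho h (f false)).
have rrE h f f' : fd (rr h f) f' = fd f (rr (finv h) f').
  by rewrite fdE /fd fdotE big_bool /rr !ffunE !rho_ipl.
have rrgen h g : rr h (pr2 (rho g v0) (rho g v)) = pr2 (rho (fmul h g) v0) (rho (fmul h g) v).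
  by rewrite /rr /pr2 !ffunE !rhoM.
have Prr h f : P (rr h f) = rr h (P f).
  apply: Puniq => [q Hq|g].
    rewrite -[h]finvK -rrE; apply: (PP f).1 => g.
    by rewrite rrE finvK rrgen Hq.
  have -> : rr h f - rr h (P f) = rr h (f - P f).
    by apply/ffunP => -[]; rewrite !ffunE linear_funB.
  by rewrite rrE rrgen PE.
exists (fun z => P (pr2 z 0) false); split.
- apply/rhoCP; split.
    split=> [k z z'|].
      have -> : pr2 (k *: z + z') 0 = k *: pr2 z 0 + pr2 z' 0.
        by apply/ffunP => -[]; rewrite !ffunE // scaler0 addr0.
      by rewrite Plin !ffunE.
    exists 1 => z; rewrite mul1r; apply: le_trans (hnorm_ffun_ge _ _ _) _.
    apply: le_trans (Ple _) _; rewrite !hnormE sqn_ffun big_bool !ffunE.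
    by rewrite /= sqn0 addr0.
  move=> g z; have -> : pr2 (rho g z) 0 = rr g (pr2 z 0).
    by apply/ffunP => -[]; rewrite !ffunE // linear_fun0.
  by rewrite Prr /rr ffunE.
- move=> z; apply: le_trans (hnorm_ffun_ge _ _ _) _.
  apply: le_trans (Ple _) _; rewrite !hnormE sqn_ffun big_bool !ffunE.
  by rewrite /= sqn0 addr0.
- move=> g; rewrite (@Puniq _ (c *: pr2 (rho g v0) (rho g v))) ?ffunE //.
    exact: (subspaceZ c sspan (gspan g)).
  move=> k; rewrite ipBl ipZl !fdE !ffunE ip0l addr0.
  have [<-|gk] := pselect (g = k); last by rewrite !wandering_orth // addr0 mulr0 subr0.
  rewrite !ip_sqn !rho_iso /c -rmorphD -rmorphM divfK ?subrr //.
  by rewrite gt_eqF // ltr_wpDl ?sqn_ge0 // lt_neqAle eq_sym sqn_eq0 vn sqn_ge0.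
move=> z zo; rewrite (@Puniq _ 0) ?ffunE //; first by case: sspan.
by move=> g; rewrite subr0 fdE !ffunE zo ip0l addr0.
Qed.

(* Test the hypothesis on the element of [rhoC] taking [rho g v'] to a multiple of
   [rho (fmul g h) v], pair with [rho h v], and let [h] go to infinity. *)
Theorem commutant_separating (z : 'S_N -> V) :
  (forall x, rhoC x -> \sum_s S s (x (z s)) = 0) -> z 1%g = 0.
Proof.
move=> zE.
have [[v [wv v0]]|nw] := pselect (exists v, wandering v /\ v != 0); last first.
  apply: wandering_total => w ww; suff -> : w = 0 by rewrite ip0r.
  by apply/eqP; apply: contra_notT nw => w0; exists w.
apply: wandering_total => v' w'.
have [->|v'0] := eqVneq v' 0; first by rewrite ip0r.
have rv h : rho h v != 0.
  by rewrite -(sqn_eq0 ip) rho_iso sqn_eq0.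
have /choice[x xP] h := rank_one_type (rv h) w' (wandering_rho h wv).
pose c := (sqn ip v' / (sqn ip v' + sqn ip v))%:C%C.
have xg h g : x h (rho g v') = c *: rho (fmul g h) v.
  by have [_ _ -> _] := xP h; rewrite rho_iso rhoM.
have sp y : y != 0 -> 0 < sqn ip y by move=> y0; rewrite lt_neqAle eq_sym sqn_eq0 y0 sqn_ge0.
have c0 : c != 0.
  rewrite /c -(rmorph0 (real_complex R)) (inj_eq (@complexI R)).
  by rewrite mulf_neq0 ?invr_eq0 ?gt_eqF // ?addr_gt0 // sp.
have xlin h : linear (x h) by have [/rhoCP[[]]] := xP h.
have PF := displacement_proper N G_infinite.
have DZ (Z : set V) : subspace Z -> hclosed ip Z -> (forall g, Z (rho g v')) ->
    (forall y, (forall g, ip y (rho g v') = 0) -> Z y) -> forall y, Z y.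
  move=> sZ cZ DZ oZ; apply: (closed_orth_full Vcomplete (D := range (fun g => rho g v')) sZ cZ).
    by move=> _ [g _ <-].
  by move=> y oy; apply: oZ => g; apply: oy; exists g.
have small s w y (e : R) : s != 1%g -> 0 < e ->
    displacement [set h | normc (ip (x h y) (rho (fperm h s) w)) < e].
  move=> s1; move: e; pattern y.
  apply: DZ.
  - split=> [e e0|k y1 y2 H1 H2 e e0].
      by apply: filterS filterT => h _ /=; rewrite linear_fun0 // ip0l normc_real.
    have k0 : 0 < normc k + 1 by rewrite ltr_wpDl ?normc_ge0.
    have D1 := H1 (e / 2 / (normc k + 1)) ltac:(by rewrite !divr_gt0).
    have D2 := H2 (e / 2) ltac:(by rewrite divr_gt0).
    apply: filterS (filterI D1 D2) => h [/= h1 h2].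
    rewrite xlin ipDl ipZl; apply: le_lt_trans (normc_triangle _ _) _.
    rewrite (splitr e) ler_ltD // ComplexField.Normc.normcM.
    rewrite ltr_pdivlMr // in h1; apply: le_trans (ltW h1).
    by rewrite mulrC ler_wpM2l ?normc_ge0 // lerDl.
  - move=> y0 Hy e e0; have k0 : 0 < hnorm ip w + 1 by rewrite ltr_wpDl ?hnorm_ge0.
    have [y1 Hy1 yy] := Hy (e / 2 / (hnorm ip w + 1)) ltac:(by rewrite !divr_gt0).
    have D1 := Hy1 (e / 2) ltac:(by rewrite divr_gt0).
    apply: filterS D1 => h /= h1.
    rewrite -[y0](subrK y1) linear_funD // ipDl.
    apply: le_lt_trans (normc_triangle _ _) _; rewrite (splitr e) ler_ltD //.
    apply: le_trans (cauchy_schwarz _ _ _) _; rewrite (hnormE _ (rho _ _)) rho_iso -hnormE.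
    rewrite ltr_pdivlMr // in yy; apply: le_trans (ltW yy).
    apply: ler_pM; rewrite ?hnorm_ge0 // ?lerDl //.
    by have [_ /(_ (y0 - y1))] := xP h.
  - move=> g e e0; have n0 : 0 < normc c + 1 by rewrite ltr_wpDl ?normc_ge0.
    have := mixing_displaced g v w s1 (divr_gt0 e0 n0); apply: filterS => h /=.
    rewrite fperm1 xg ipZl ComplexField.Normc.normcM rho_ipr -rhoM fmulA => lt.
    rewrite ltr_pdivlMr // in lt; apply: le_lt_trans lt.
    by rewrite mulrC ler_wpM2l ?normc_ge0 // lerDl.
  move=> y0 yo e e0; apply: filterS filterT => h _ /=.
  by have [_ _ _ ->] := xP h; rewrite // ip0l normc_real.
pose c' := c * (sqn ip v)%:C%C / (sqn ip v')%:C%C.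
have main h y : ip (x h y) (rho h v) = c' * ip y v'.
  have bx : bounded_op ip (x h) by have [/rhoCP[]] := xP h.
  have [xa _ xaE] := bounded_adjoint Vcomplete bx.
  pose k := xa (rho h v) - (c'^*)%C *: v'.
  have kE y0 : ip y0 k = ip (x h y0) (rho h v) - c' * ip y0 v'.
    by rewrite ipBr -xaE ipZr conjcK.
  apply/eqP; rewrite -subr_eq0 -kE ipC; apply/eqP.
  suff -> : ip k y = 0 by rewrite conjc0.
  move: y; apply: DZ.
  - by split=> [|d y1 y2 H1 H2] /=; rewrite ?ip0r // ipDr ipZr H1 H2 mulr0 addr0.
  - exact: ip_closed.
  - move=> g; rewrite ipC kE; apply/eqP; rewrite conjc_eq0; apply/eqP.
    rewrite xg ipZl; have [->|g1] := pselect (g = @fone G N).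
      rewrite fmul1l rho1 !ip_sqn rho_iso /c' divfK ?subrr //.
      by rewrite -(rmorph0 (real_complex R)) (inj_eq (@complexI R)) gt_eqF ?sp.
    rewrite wandering_orth // ?(w' _ g1) ?mulr0 ?subrr // => E; apply: g1.
    have := congr1 (fun y => fmul y (finv h)) E.
    by rewrite -fmulA fmulV fmul1r.
  move=> y0 yo; rewrite ipC kE; have [_ _ _ ->] := xP h; rewrite // ip0l.
  by have := yo (@fone G N); rewrite rho1 => ->; rewrite mulr0 subrr conjc0.
have c'0 : c' != 0.
  rewrite /c' !mulf_neq0 ?invr_eq0 // -(rmorph0 (real_complex R)) (inj_eq (@complexI R)) gt_eqF ?sp //.
suff : c' * ip (z 1%g) v' = 0 by move/eqP; rewrite mulf_eq0 (negbTE c'0) => /eqP.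
apply: normc_small => e e0.
have n0 : (0 : R) < #|{perm 'I_N}|.+1%:R by rewrite ltr0n.
pose A (s : 'S_N) : set Gam := [set h | s != 1%g ->
   normc (ip (x h (z s)) (rho (fperm h s) (S s^-1%g v))) <= e / #|{perm 'I_N}|.+1%:R].
have AP s : displacement (A s).
  have [->|st] := eqVneq s 1%g; first by apply: filterS filterT => h _; rewrite /A /= eqxx.
  have := small s (S s^-1%g v) (z s) _ st (divr_gt0 e0 n0).
  by apply: filterS => h /= lt _; exact: ltW.
have [h hP] := @filter_ex _ _ PF _ (@filter_forall _ _ A _ _ AP).
rewrite -(main h).
have Cx : rhoC (x h) by have [] := xP h.
have := congr1 (fun y => ip y (rho h v)) (zE _ Cx); rewrite /= ip0l ip_suml.
rewrite (bigD1 1%g) //= S1 => /eqP; rewrite addr_eq0 => /eqP->.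
rewrite normcN'; apply: (@le_trans _ _ (\sum_(s : 'S_N | s != 1%g) e / #|{perm 'I_N}|.+1%:R)).
  apply: (big_rec2 (fun x (y : R) => normc x <= y)) => [|s y1 y2 st xy]; first by rewrite normc_real.
  apply: le_trans (normc_triangle _ _) _; rewrite lerD //.
  by rewrite S_adj S_rhoV; exact: hP.
apply: (@le_trans _ _ (\sum_(s : 'S_N) e / #|{perm 'I_N}|.+1%:R)).
  by rewrite [leRHS](bigD1 1%g) //= lerDr divr_ge0 // ltW.
rewrite sumr_const -[_ *+ #|_|]mulr_natr -mulrA ger_pMr // mulrC ler_pdivrMr // mul1r.
by rewrite ler_nat.
Qed.

End Wandering.

(** * Matrix amplifications *)

Section Amplification.
Variables (R : realType) (V W : lmodType R[i]).
Variables (ip : {dot V for Num.conj}) (ipW : {dot W for Num.conj}) (I : finType).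
Variables (inj : I -> V -> W) (prj : I -> W -> V).
Implicit Types (a b d : V -> V) (z : W -> W).

(* [W] is the Hilbert sum of copies of [V] indexed by [I], so that operators on
   [W] are matrices of operators on [V]. *)
Record amplification : Prop := Amplify {
  amp_inj_lin : forall i c u v, inj i (c *: u + v) = c *: inj i u + inj i v;
  amp_prj_lin : forall i c u v, prj i (c *: u + v) = c *: prj i u + prj i v;
  amp_prj_inj : forall i j v, prj i (inj j v) = if i == j then v else 0;
  amp_sum : forall t, t = \sum_i inj i (prj i t);
  amp_adj : forall i v t, ipW (inj i v) t = ip v (prj i t) }.

Hypothesis amp : amplification.
Let inj_lin := amp_inj_lin amp.
Let prj_lin := amp_prj_lin amp.
Let prj_inj := amp_prj_inj amp.
Let amp_sum' := amp_sum amp.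
Let adj := amp_adj amp.

Definition elem i j a : W -> W := fun t => inj i (a (prj j t)).
Definition diag a : W -> W := fun t => \sum_i inj i (a (prj i t)).
Definition entry z i j : V -> V := fun v => prj i (z (inj j v)).
Definition ampl (C : set (V -> V)) : set (W -> W) :=
  [set z | bounded_op ipW z /\ forall i j, C (entry z i j)].

Lemma inj0 i : inj i 0 = 0.
Proof. by have := inj_lin i (-1) 0 0; rewrite scaler0 addr0 scaleN1r addNr. Qed.
Lemma injD i u v : inj i (u + v) = inj i u + inj i v.
Proof. by have := inj_lin i 1 u v; rewrite !scale1r. Qed.

Lemma prj0 i : prj i 0 = 0.
Proof. by have := prj_lin i (-1) 0 0; rewrite scaler0 addr0 scaleN1r addNr. Qed.
Lemma prjD i u v : prj i (u + v) = prj i u + prj i v.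
Proof. by have := prj_lin i 1 u v; rewrite !scale1r. Qed.
Lemma prjZ i c u : prj i (c *: u) = c *: prj i u.
Proof. by have := prj_lin i c u 0; rewrite !addr0 prj0 addr0. Qed.
Lemma inj_sum i J (r : seq J) P F :
  inj i (\sum_(j <- r | P j) F j) = \sum_(j <- r | P j) inj i (F j).
Proof. exact: (big_morph _ (injD i) (inj0 i)). Qed.
Lemma prj_sum i J (r : seq J) P F :
  prj i (\sum_(j <- r | P j) F j) = \sum_(j <- r | P j) prj i (F j).
Proof. exact: (big_morph _ (prjD i) (prj0 i)). Qed.

Lemma prj_sum_inj i (F : I -> V) : prj i (\sum_j inj j (F j)) = F i.
Proof.
rewrite prj_sum (bigD1 i) //= prj_inj eqxx big1 ?addr0 // => j ji.
by rewrite prj_inj eq_sym (negbTE ji).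
Qed.

Lemma prj_ext t t' : (forall i, prj i t = prj i t') -> t = t'.
Proof. by move=> E; rewrite [t]amp_sum' [t']amp_sum'; apply: eq_bigr => i _; rewrite E. Qed.

Lemma sqn_inj i v : sqn ipW (inj i v) = sqn ip v.
Proof. by rewrite /sqn adj prj_inj eqxx. Qed.

Lemma sqn_prj t : sqn ipW t = \sum_i sqn ip (prj i t).
Proof.
rewrite {1}/sqn {1}[t]amp_sum' ip_suml raddf_sum; apply: eq_bigr => i _.
by rewrite adj.
Qed.

Lemma hnorm_prj i t : hnorm ip (prj i t) <= hnorm ipW t.
Proof.
rewrite !hnormE ler_sqrt ?sqn_ge0 // sqn_prj (bigD1 i) //= lerDl sumr_ge0 // => j _.
exact: sqn_ge0.
Qed.

Lemma bop_elem i j a : bounded_op ip a -> bounded_op ipW (elem i j a).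
Proof.
move=> ba; split.
  by move=> c u v; rewrite /elem prj_lin ba.1 inj_lin.
have [M M0 aM] := bopP ba; exists M => t.
rewrite /elem hnormE sqn_inj -hnormE (le_trans (aM _)) //.
by rewrite ler_wpM2l ?hnorm_prj // ltW.
Qed.

Lemma bop_entry z i j : bounded_op ipW z -> bounded_op ip (entry z i j).
Proof.
move=> bz; split.
  by move=> c u v; rewrite /entry inj_lin bz.1 prj_lin.
have [M M0 zM] := bopP bz; exists M => t.
rewrite /entry (le_trans (hnorm_prj _ _)) // (le_trans (zM _)) //.
by rewrite hnormE sqn_inj.
Qed.

Lemma bop_diag a : bounded_op ip a -> bounded_op ipW (diag a).
Proof. by move=> ba; apply: bop_sum => i _; exact: bop_elem. Qed.

Lemma prj_op z t i : linear z -> prj i (z t) = \sum_j entry z i j (prj j t).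
Proof. by move=> lz; rewrite {1}[t]amp_sum' linear_fun_sum // prj_sum. Qed.

Lemma op_sum_elem z t : linear z -> z t = \sum_i \sum_j elem i j (entry z i j) t.
Proof.
move=> lz; rewrite [LHS]amp_sum'; apply: eq_bigr => i _.
by rewrite prj_op // inj_sum.
Qed.

Lemma entry_ext z z' : linear z -> linear z' ->
  (forall i j v, entry z i j v = entry z' i j v) -> z = z'.
Proof.
move=> lz lz' E; apply/funext => t; rewrite !op_sum_elem //.
by apply: eq_bigr => i _; apply: eq_bigr => j _; rewrite /elem E.
Qed.

Lemma prj_diag a i t : prj i (diag a t) = a (prj i t).
Proof. exact: prj_sum_inj. Qed.

Lemma diag_inj a j v : linear a -> diag a (inj j v) = inj j (a v).
Proof.
move=> la; apply: prj_ext => i; rewrite prj_diag !prj_inj.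
by case: eqP => // _; rewrite linear_fun0.
Qed.

Lemma diag_adj a b : is_adjoint ip a b -> is_adjoint ipW (diag a) (diag b).
Proof.
move=> ab u v; rewrite /diag ip_suml {2}[u]amp_sum' ip_suml.
by apply: eq_bigr => i _; rewrite !adj prj_diag ab.
Qed.

Lemma entry_diagl a z i j v : entry (diag a \o z) i j v = a (entry z i j v).
Proof. by rewrite /entry /= prj_diag. Qed.

Lemma entry_diagr a z i j v : linear a -> entry (z \o diag a) i j v = entry z i j (a v).
Proof. by move=> la; rewrite /entry /= diag_inj. Qed.

Lemma entry_comp z z' i j v : linear z -> entry (z \o z') i j v =
  \sum_k entry z i k (entry z' k j v).
Proof. by move=> lz; rewrite {1}/entry /= prj_op. Qed.

Lemma entry_adj z z' i j : is_adjoint ipW z z' -> is_adjoint ip (entry z i j) (entry z' j i).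
Proof. by move=> zz u v; rewrite /entry ipC -adj -ipC zz adj. Qed.

Lemma ampl_commutant D : D `<=` bounded_op ip ->
  ampl (commutant ip D) = commutant ipW [set diag d | d in D].
Proof.
move=> bD; apply/seteqP; split => z.
  move=> [bz Cz]; apply/commutantP; split => // _ [d Dd <-] t.
  have lz := bop_linear bz; apply: prj_ext => i; rewrite prj_diag !prj_op //.
  rewrite linear_fun_sum; last by case: (bD _ Dd).
  apply: eq_bigr => j _; rewrite prj_diag.
  by have /commutantP[_ ->] := Cz i j; last exact: Dd.
move=> /commutantP[bz Cz]; split => // i j; apply/commutantP; split; first exact: bop_entry.
move=> d Dd v; rewrite -entry_diagl -entry_diagr; last by case: (bD _ Dd).
by rewrite /entry /= Cz //; exists d.
Qed.

Lemma sum_elem_ampl C (F : I -> I -> V -> V) :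
  (forall i j, bounded_op ip (F i j)) -> (forall i j, C (F i j)) ->
  let z := fun t => \sum_i \sum_j elem i j (F i j) t in
  ampl C z /\ forall i j, entry z i j = F i j.
Proof.
move=> bF CF z.
have eF i j : entry z i j = F i j.
  apply/funext => v; rewrite /entry /z prj_sum (bigD1 i) //= prj_sum (bigD1 j) //=.
  rewrite /elem !prj_inj !eqxx big1 ?addr0 => [|k kj]; last first.
    by rewrite prj_inj eqxx prj_inj (negbTE kj) (linear_fun0 (bF _ _).1).
  rewrite big1 ?addr0 // => k ki; rewrite prj_sum big1 // => l _.
  by rewrite prj_inj eq_sym (negbTE ki).
split; last exact: eF.
split; last by move=> i j; rewrite eF.
by apply: bop_sum => i _; apply: bop_sum => j _; exact: bop_elem.
Qed.

End Amplification.

Section IsoAmplification.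
Variables (R : realType) (V1 V2 W1 W2 : lmodType R[i]).
Variables (ip1 : {dot V1 for Num.conj}) (ip2 : {dot V2 for Num.conj}).
Variables (jp1 : {dot W1 for Num.conj}) (jp2 : {dot W2 for Num.conj}).
Variable (I : finType).
Variables (inj1 : I -> V1 -> W1) (prj1 : I -> W1 -> V1).
Variables (inj2 : I -> V2 -> W2) (prj2 : I -> W2 -> V2).
Hypothesis amp1 : amplification ip1 jp1 inj1 prj1.
Hypothesis amp2 : amplification ip2 jp2 inj2 prj2.
Variables (C1 : set (V1 -> V1)) (C2 : set (V2 -> V2)) (f : (V1 -> V1) -> (V2 -> V2)).

Definition lin_closed (V : lmodType R[i]) (C : set (V -> V)) :=
  C (fun=> 0) /\ forall (c : R[i]) a b, C a -> C b -> C (fun v => c *: a v + b v).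
Definition comp_closed (V : lmodType R[i]) (C : set (V -> V)) :=
  forall a b, C a -> C b -> C (a \o b).

Record star_iso : Prop := StarIso {
  si_bop1 : C1 `<=` bounded_op ip1;
  si_bop2 : C2 `<=` bounded_op ip2;
  si_lin1 : lin_closed C1;
  si_comp1 : comp_closed C1;
  si_star1 : star_closed ip1 C1;
  si_bij : set_bij C1 C2 f;
  si_linear : forall (c : R[i]) a b, C1 a -> C1 b ->
    f (fun v => c *: a v + b v) = (fun v => c *: f a v + f b v);
  si_mul : forall a b, C1 a -> C1 b -> f (a \o b) = f a \o f b;
  si_adj : forall a b, C1 a -> C1 b -> is_adjoint ip1 a b -> is_adjoint ip2 (f a) (f b) }.

Hypothesis iso : star_iso.

Lemma si_fun a : C1 a -> C2 (f a).
Proof. by move=> Ca; have [H _ _] := si_bij iso; exact: H. Qed.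

Lemma si_zero : f (fun=> 0) = fun=> 0.
Proof.
have := si_linear iso 0 (si_lin1 iso).1 (si_lin1 iso).1.
rewrite (_ : (fun v => _) = fun=> 0); last by apply/funext => v; rewrite scale0r addr0.
by move=> E; apply/funext => v; have := congr1 (fun h => h v) E; rewrite scale0r add0r;
  move: (si_linear iso (-1) (si_lin1 iso).1 (si_lin1 iso).1);
  rewrite (_ : (fun v => _) = fun=> 0); [move=> -> ; rewrite scaleN1r addNr
   | apply/funext => w; rewrite scaler0 addr0].
Qed.

Lemma sum_closed J (r : seq J) (F : J -> V1 -> V1) : (forall j, C1 (F j)) ->
  C1 (fun v => \sum_(j <- r) F j v) /\
  f (fun v => \sum_(j <- r) F j v) = fun v => \sum_(j <- r) f (F j) v.
Proof.
move=> CF; elim: r => [|j r [Cr IHr]].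
  rewrite (_ : (fun v => _) = fun=> 0); last by apply/funext => v; rewrite big_nil.
  split; first exact: (si_lin1 iso).1.
  by rewrite si_zero; apply/funext => v; rewrite big_nil.
rewrite (_ : (fun v => _) = fun v => 1 *: F j v + \sum_(j <- r) F j v); last first.
  by apply/funext => v; rewrite big_cons scale1r.
split; first exact: (si_lin1 iso).2.
rewrite (si_linear iso) //; apply/funext => v; rewrite IHr big_cons scale1r.
by [].
Qed.

Theorem vn_isomorphic_ampl : hcomplete jp1 -> hcomplete jp2 ->
  vn_isomorphic jp1 (ampl jp1 inj1 prj1 C1) jp2 (ampl jp2 inj2 prj2 C2).
Proof.
move=> cW1 cW2.
pose F (z : W1 -> W1) : W2 -> W2 := fun t => \sum_i \sum_j elem inj2 prj2 i j (f (entry inj1 prj1 z i j)) t.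
have FP z : ampl jp1 inj1 prj1 C1 z -> ampl jp2 inj2 prj2 C2 (F z) /\
    forall i j, entry inj2 prj2 (F z) i j = f (entry inj1 prj1 z i j).
  move=> [bz Cz]; apply: (sum_elem_ampl amp2) => i j.
    by apply: (si_bop2 iso); apply: si_fun.
  exact: si_fun.
have linz z : ampl jp1 inj1 prj1 C1 z -> linear z by move=> [[]].
have linF z : ampl jp1 inj1 prj1 C1 z -> linear (F z) by move=> /FP[[[]]].
exists F; split.
- split.
  + by move=> z Az; have [] := FP z Az.
  + move=> z z'; rewrite !inE => Az Az' E.
    apply: (entry_ext amp1) => [||i j v]; [exact: linz|exact: linz|].
    have [_ injf _] := si_bij iso.
    rewrite (injf (entry inj1 prj1 z i j) (entry inj1 prj1 z' i j)) ?inE //.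
    * exact: Az.2.
    * exact: Az'.2.
    * by rewrite -(FP z Az).2 -(FP z' Az').2 E.
  + move=> z [bz Cz]; have [_ _ surf] := si_bij iso.
    have /choice[g gP] (k : I * I) : exists a, C1 a /\ f a = entry inj2 prj2 z k.1 k.2.
      by have [a Ca fa] := surf _ (Cz k.1 k.2); exists a.
    have [Ag eg] := @sum_elem_ampl _ _ _ _ _ _ _ _ amp1 C1 (fun i j => g (i, j))
       (fun i j => si_bop1 iso (gP (i, j)).1) (fun i j => (gP (i, j)).1).
    eexists; first exact: Ag.
    apply: (entry_ext amp2); [exact: linF|by case: bz|].
    by move=> i j v; rewrite (FP _ Ag).2 eg (gP (i, j)).2.
- move=> c a b Aa Ab.
  have Aab : ampl jp1 inj1 prj1 C1 (fun v => c *: a v + b v).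
    split; first by apply: bop_lin; [exact: Aa.1|exact: Ab.1].
    move=> i j; rewrite (_ : entry _ _ _ _ _ = fun v => c *: entry inj1 prj1 a i j v + entry inj1 prj1 b i j v).
      by apply: (si_lin1 iso).2; [exact: Aa.2|exact: Ab.2].
    by apply/funext => v; rewrite /entry (prjD amp1) (prjZ amp1).
  apply: (entry_ext amp2); [exact: linF| |].
    by apply: (bop_linear (ip := jp2)); apply: bop_lin; [exact: (FP _ Aa).1.1|exact: (FP _ Ab).1.1].
  move=> i j v; rewrite (FP _ Aab).2.
  rewrite (_ : entry _ _ _ _ _ = fun v => c *: entry inj1 prj1 a i j v + entry inj1 prj1 b i j v).
    rewrite (si_linear iso) //; [|exact: Aa.2|exact: Ab.2].
    by rewrite -(FP _ Aa).2 -(FP _ Ab).2 /entry (prjD amp2) (prjZ amp2).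
  by apply/funext => w; rewrite /entry (prjD amp1) (prjZ amp1).
- move=> a b Aa Ab.
  have e : forall i j, entry inj1 prj1 (a \o b) i j = fun v => \sum_k (entry inj1 prj1 a i k \o entry inj1 prj1 b k j) v.
    by move=> i j; apply/funext => v; rewrite (entry_comp amp1) //; exact: linz.
  have Ce i j k : C1 (entry inj1 prj1 a i k \o entry inj1 prj1 b k j).
    by apply: (si_comp1 iso); [exact: Aa.2|exact: Ab.2].
  have Aab : ampl jp1 inj1 prj1 C1 (a \o b).
    split; first by apply: bop_comp; [exact: Aa.1|exact: Ab.1].
    by move=> i j; rewrite e; have [] := sum_closed (index_enum I) (fun k => Ce i j k).
  apply: (entry_ext amp2); [exact: linF| |].
    by apply: (bop_linear (ip := jp2)); apply: bop_comp; [exact: (FP _ Aa).1.1|exact: (FP _ Ab).1.1].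
  move=> i j v; rewrite (FP _ Aab).2 e.
  have [_ ->] := sum_closed (index_enum I) (fun k => Ce i j k).
  rewrite (entry_comp amp2); last exact: linF.
  apply: eq_bigr => k _; rewrite (FP _ Aa).2 (FP _ Ab).2 (si_mul iso) //; [exact: Aa.2|exact: Ab.2].
move=> a Aa.
have ab := adjointP cW1 Aa.1; set b := adjoint jp1 a in ab *.
have Ab : ampl jp1 inj1 prj1 C1 b.
  split; first exact/bop_adjoint/Aa.1.
  move=> i j; have [d Cd dP] := si_star1 iso (Aa.2 j i).
  rewrite (_ : entry _ _ _ _ _ = d) //.
  by rewrite -(adjointE dP) (adjointE (entry_adj amp1 j i ab)).
apply/esym/adjointE => u v.
rewrite [F a u](op_sum_elem amp2 _ (linF _ Aa)) [F b v](op_sum_elem amp2 _ (linF _ Ab)).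
rewrite ip_suml ip_sumr.
rewrite (eq_bigr (fun i => \sum_j jp2 (elem inj2 prj2 i j (f (entry inj1 prj1 a i j)) u) v)); last first.
  by move=> i _; rewrite ip_suml; apply: eq_bigr => j _; rewrite (FP _ Aa).2.
rewrite exchange_big /=; apply: eq_bigr => j _; rewrite ip_sumr; apply: eq_bigr => i _.
rewrite /elem (amp_adj amp2) (FP _ Ab).2 [RHS]ipC (amp_adj amp2) -ipC.
by apply: (si_adj iso); [exact: Aa.2|exact: Ab.2|exact: (entry_adj amp1)].
Qed.

End IsoAmplification.

Lemma vn_isomorphic_sym (R : realType) (V1 V2 : lmodType R[i]) (ip1 : {dot V1 for Num.conj})
    (ip2 : {dot V2 for Num.conj}) S1 S2 :
  lin_closed S1 -> comp_closed S1 -> (forall a, S1 a -> S1 (adjoint ip1 a)) ->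
  vn_isomorphic ip1 S1 ip2 S2 -> vn_isomorphic ip2 S2 ip1 S1.
Proof.
move=> lS cS aS [f [[fS finj fsur] flin fmu fadj]].
have /choice[g gP] (b : V2 -> V2) : exists a, S2 b -> S1 a /\ f a = b.
  have [Sb|nb] := pselect (S2 b); last by exists (fun=> 0).
  by have [a Sa fa] := fsur b Sb; exists a.
have gS b : S2 b -> S1 (g b) by move=> /gP[].
have fg b : S2 b -> f (g b) = b by move=> /gP[].
have fI a a' : S1 a -> S1 a' -> f a = f a' -> a = a' by move=> Sa Sa'; apply: finj; rewrite inE.
have gf a : S1 a -> g (f a) = a.
  move=> Sa; have Sf : S2 (f a) by exact: fS.
  by apply: fI => //; [exact: gS|exact: fg].
have fS' a : S1 a -> S2 (f a) by move=> Sa; exact: fS.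
exists g; split.
- split.
  + exact: gS.
  + by move=> b b'; rewrite !inE => Sb Sb' E; rewrite -(fg b Sb) E fg.
  + by move=> a Sa; exists (f a); [exact: fS'|exact: gf].
- move=> c a b Sa Sb; rewrite -{1}(fg a Sa) -{1}(fg b Sb) -flin; [|exact: gS|exact: gS].
  by apply: gf; apply: lS.2; exact: gS.
- move=> a b Sa Sb; rewrite -{1}(fg a Sa) -{1}(fg b Sb) -fmu; [|exact: gS|exact: gS].
  by apply: gf; apply: cS; exact: gS.
move=> a Sa; rewrite -{1}(fg a Sa) -fadj; last exact: gS.
by apply: gf; apply: aS; exact: gS.
Qed.

(** * Crossed products by the symmetric group *)

Section CrossedProduct.
Variables (R : realType) (V : lmodType R[i]) (ip : {dot V for Num.conj}).
Variables (G : groupType) (N : nat).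
Local Notation Gam := ('I_N -> G).
Variables (rho : Gam -> V -> V) (S : 'S_N -> V -> V).
Hypothesis ws : wandering_system ip rho S.
Implicit Types (x y : 'S_N -> V -> V).

Let Vc := ws_complete ws.
Local Notation M := (rhoC ip rho).
Local Notation fd := (@ffun_dot R 'S_N V ip : {dot {ffun 'S_N -> V} for Num.conj}).
Let cF : hcomplete fd := ffun_complete Vc.

Definition Sconj (s : 'S_N) (a : V -> V) : V -> V := S s \o a \o adjoint ip (S s).

Lemma adjS s : adjoint ip (S s) = S s^-1%g.
Proof. exact/adjointE/(S_adj ws). Qed.

Lemma SconjE s a v : Sconj s a v = S s (a (S s^-1%g v)).
Proof. by rewrite /Sconj adjS. Qed.

Lemma Sconj_M s a : M a -> M (Sconj s a).
Proof.
move=> /(rhoCP ip rho)[ba Ca]; apply/(rhoCP ip rho); split.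
  rewrite /Sconj adjS; apply: bop_comp (S_bop ws _).
  exact: bop_comp (S_bop ws _) ba.
by move=> g v; rewrite !SconjE (S_rhoV ws) Ca (ws_S_rho ws) fpermK.
Qed.

Lemma M_bop a : M a -> bounded_op ip a.
Proof. by move=> /commutant_bop. Qed.

Lemma M_lin : lin_closed M.
Proof.
split=> [|c a b Ma Mb]; first exact: commutant0 (range_rho_bop ws).
exact: commutant_lin (range_rho_bop ws) Ma Mb.
Qed.

Lemma M_sum J (r : seq J) (P : pred J) (F : J -> V -> V) : (forall j, P j -> M (F j)) ->
  M (fun v => \sum_(j <- r | P j) F j v).
Proof. exact: commutant_sum (range_rho_bop ws). Qed.

Lemma M_comp : comp_closed M.
Proof. by move=> a b; exact: commutant_comp. Qed.

Lemma M_adj a : M a -> M (adjoint ip a).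
Proof.
move=> Ma; apply: (commutant_adj (rho_star ws) (range_rho_bop ws) _ _ Ma).
  exact/(bop_adjoint Vc)/M_bop.
exact/(adjointP Vc)/M_bop.
Qed.

Definition coefs x := forall s, M (x s).

Definition cmul x y : 'S_N -> V -> V :=
  fun r v => \sum_s x s (Sconj s (y (r * s^-1)%g) v).
Definition cadj x : 'S_N -> V -> V := fun s => Sconj s (adjoint ip (x s^-1%g)).
Definition clin (c : R[i]) x y : 'S_N -> V -> V := fun s v => c *: x s v + y s v.

Lemma coefs_mul x y : coefs x -> coefs y -> coefs (cmul x y).
Proof.
move=> Cx Cy r; apply: M_sum => s _; apply: (M_comp (Cx s)).
exact/Sconj_M/Cy.
Qed.

Lemma coefs_adj x : coefs x -> coefs (cadj x).
Proof. by move=> Cx s; apply/Sconj_M/M_adj/Cx. Qed.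

Lemma coefs_lin c x y : coefs x -> coefs y -> coefs (clin c x y).
Proof. by move=> Cx Cy s; exact: M_lin.2. Qed.

Section Covariant.
Variables (W : lmodType R[i]) (ipW : {dot W for Num.conj}).
Variables (th : (V -> V) -> W -> W) (u : 'S_N -> W -> W).

Record covariant : Prop := Covariant {
  co_bop : forall a, M a -> bounded_op ipW (th a);
  co_ubop : forall s, bounded_op ipW (u s);
  co_lin : forall c a b w, M a -> M b -> th (fun v => c *: a v + b v) w = c *: th a w + th b w;
  co_mul : forall a b w, M a -> M b -> th (a \o b) w = th a (th b w);
  co_adj : forall a b, M a -> M b -> is_adjoint ip a b -> is_adjoint ipW (th a) (th b);
  co_uM : forall s t w, u (s * t)%g w = u t (u s w);
  co_uadj : forall s, is_adjoint ipW (u s) (u s^-1%g);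
  co_cov : forall s a w, M a -> u s (th a w) = th (Sconj s a) (u s w);
  co_indep : forall x, coefs x -> (forall w, \sum_s th (x s) (u s w) = 0) -> forall s v, x s v = 0 }.

Hypothesis co : covariant.

Definition csum x : W -> W := fun w => \sum_s th (x s) (u s w).

Lemma th0 w : th (fun=> 0) w = 0.
Proof.
have := co_lin co (-1) w M_lin.1 M_lin.1.
by rewrite scaler0 addr0 scaleN1r addNr.
Qed.

Lemma th_sum J (r : seq J) (F : J -> V -> V) w : (forall j, M (F j)) ->
  th (fun v => \sum_(j <- r) F j v) w = \sum_(j <- r) th (F j) w.
Proof.
move=> MF; elim: r => [|j r IHr].
  by rewrite big_nil (_ : (fun v => _) = fun=> 0) ?th0 //; apply/funext => v; rewrite big_nil.
rewrite big_cons (_ : (fun v => _) = fun v => 1 *: F j v + \sum_(j <- r) F j v).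
  by rewrite (co_lin co) ?scale1r ?IHr //; apply: M_sum.
by apply/funext => v; rewrite big_cons scale1r.
Qed.

Lemma csum_bop x : coefs x -> bounded_op ipW (csum x).
Proof.
move=> Cx; apply: bop_sum => s _.
exact: (bop_comp (co_bop co (Cx s)) (co_ubop co s)).
Qed.

Lemma csum_lin c x y : coefs x -> coefs y ->
  csum (clin c x y) = fun w => c *: csum x w + csum y w.
Proof.
move=> Cx Cy; apply/funext => w; rewrite /csum scaler_sumr -big_split.
by apply: eq_bigr => s _; rewrite (co_lin co).
Qed.

Lemma csum_inj x y : coefs x -> coefs y -> csum x = csum y -> x = y.
Proof.
move=> Cx Cy E; apply/funext => s; apply/funext => v.
have Cz := coefs_lin (-1) Cy Cx.
have := @co_indep co _ Cz _ s v => H; apply/eqP; rewrite -subr_eq0 -scaleN1r addrC; apply/eqP.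
apply: H => w.
by have := congr1 (fun z => z w) (csum_lin (-1) Cy Cx); rewrite /csum => ->;
  have := congr1 (fun z => z w) E; rewrite /csum => ->; rewrite scaleN1r addNr.
Qed.

Lemma csum_mul x y : coefs x -> coefs y -> csum (cmul x y) = csum x \o csum y.
Proof.
move=> Cx Cy; apply/funext => w; rewrite /csum /=.
transitivity (\sum_r \sum_s th (x s) (th (Sconj s (y (r * s^-1)%g)) (u r w))).
  apply: eq_bigr => r _; rewrite /cmul th_sum => [|s].
    by apply: eq_bigr => s _; rewrite -(co_mul co) //; apply/Sconj_M/Cy.
  by apply: (M_comp (Cx s)); apply/Sconj_M/Cy.
rewrite exchange_big; apply: eq_bigr => s _ /=.
have lu := bop_linear (co_ubop co s); have lx := bop_linear (co_bop co (Cx s)).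
rewrite (linear_fun_sum _ _ _ lu) (linear_fun_sum _ _ _ lx).
rewrite (reindex_inj (mulIg s)); apply: eq_bigr => t _ /=.
by rewrite mulgK (co_cov co) // (co_uM co).
Qed.

Lemma csum_adj x : coefs x -> is_adjoint ipW (csum x) (csum (cadj x)).
Proof.
move=> Cx; rewrite (_ : csum (cadj x) = fun w => \sum_s u s^-1%g (th (adjoint ip (x s)) w)).
  apply: is_adjoint_sum => s _.
  apply: (is_adjoint_comp (b := u s) _ (co_uadj co s)).
  by apply: (co_adj co) => //; [exact: M_adj|exact/(adjointP Vc)/M_bop].
apply/funext => w; rewrite /csum (reindex_inj (@invg_inj _)); apply: eq_bigr => s _ /=.
by rewrite /cadj invgK (co_cov co) //; exact: M_adj.
Qed.

Definition csums : set (W -> W) := [set csum x | x in coefs].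

End Covariant.

Lemma covariant_iso W1 (ip1 : {dot W1 for Num.conj}) th1 u1 W2 (ip2 : {dot W2 for Num.conj}) th2 u2 :
  @covariant W1 ip1 th1 u1 -> @covariant W2 ip2 th2 u2 ->
  exists f, star_iso ip1 ip2 (csums th1 u1) (csums th2 u2) f.
Proof.
move=> c1 c2.
pose f (z : W1 -> W1) := csum th2 u2 (xget (fun _ _ => 0) [set x | coefs x /\ csum th1 u1 x = z]).
have fE x : coefs x -> f (csum th1 u1 x) = csum th2 u2 x.
  move=> Cx; rewrite /f; case: xgetP => [x' _ [Cx' E]|/(_ x)/not_andP[]//].
  by rewrite (csum_inj c1 Cx' Cx E).
exists f; split.
- by move=> _ [x Cx <-]; exact: csum_bop c1 _ Cx.
- by move=> _ [x Cx <-]; exact: csum_bop c2 _ Cx.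
- split.
    exists (fun _ _ => 0); first by move=> s; exact: M_lin.1.
    by apply/funext => w; rewrite /csum big1 // => s _; rewrite (th0 c1).
  move=> c _ _ [x Cx <-] [y Cy <-]; exists (clin c x y); first exact: coefs_lin.
  exact: (csum_lin c1).
- move=> _ _ [x Cx <-] [y Cy <-]; exists (cmul x y); first exact: coefs_mul.
  exact: (csum_mul c1).
- move=> _ [x Cx <-]; exists (csum th1 u1 (cadj x)); last exact: (csum_adj c1).
  by exists (cadj x) => //; exact: coefs_adj.
- split.
  + by move=> _ [x Cx <-]; rewrite fE //; exists x.
  + move=> a b; rewrite !inE => -[x Cx <-] [y Cy <-]; rewrite !fE // => E.
    by rewrite (csum_inj c2 Cx Cy E).
  + by move=> _ [x Cx <-]; exists (csum th1 u1 x); [exists x|exact: fE].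
- move=> c _ _ [x Cx <-] [y Cy <-]; rewrite -(csum_lin c1) // !fE //; last exact: coefs_lin.
  exact: (csum_lin c2).
- move=> _ _ [x Cx <-] [y Cy <-]; rewrite -(csum_mul c1) // !fE //; last exact: coefs_mul.
  exact: (csum_mul c2).
move=> _ _ [x Cx <-] [y Cy <-] ad.
have -> : csum th1 u1 y = csum th1 u1 (cadj x) by rewrite -(adjointE ad) (adjointE (csum_adj c1 Cx)).
rewrite !fE //; last exact: coefs_adj.
exact: (csum_adj c2).
Qed.

Lemma covariant_id : covariant ip id S.
Proof.
split=> //.
- exact: M_bop.
- exact: (S_bop ws).
- exact: (ws_SM ws).
- exact: (S_adj ws).
- by move=> s a w _; rewrite SconjE (SK ws).
- exact: (crossed_independent ws).
Qed.

Definition D1 : set (V -> V) := range (perm_sum rho).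

Lemma perm_sum_bop g : bounded_op ip (perm_sum rho g).
Proof. by apply: bop_sum => s _; exact: (rho_bop ws). Qed.

Lemma D1_bop : D1 `<=` bounded_op ip.
Proof. by move=> _ [g _ <-]; exact: perm_sum_bop. Qed.

Lemma D1_star : star_closed ip D1.
Proof.
move=> _ [g _ <-]; exists (perm_sum rho (finv g)); first by exists (finv g).
by apply: is_adjoint_sum => s _; rewrite fpermV; exact: (rho_adj ws).
Qed.

Lemma S_perm_sum s g v : S s (perm_sum rho g v) = perm_sum rho g (S s v).
Proof.
rewrite /perm_sum (linear_fun_sum _ _ _ (ws_S_lin ws s)).
rewrite [RHS](reindex_inj (mulgI s^-1%g)); apply: eq_bigr => t _.
by rewrite (ws_S_rho ws); congr (rho _ _); apply/funext => i; rewrite /fperm permM.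
Qed.

Lemma M_perm_sum a g v : M a -> a (perm_sum rho g v) = perm_sum rho g (a v).
Proof.
move=> Ma; have [ba Ca] := (rhoCP ip rho a).1 Ma.
by rewrite /perm_sum (linear_fun_sum _ _ _ ba.1); apply: eq_bigr => s _; rewrite Ca.
Qed.

Lemma csums_D1 : csums id S = commutant ip D1.
Proof.
apply/seteqP; split.
  move=> _ [x Cx <-]; apply/commutantP; split; first exact: csum_bop covariant_id _ Cx.
  move=> _ [g _ <-] v; rewrite /csum (linear_fun_sum _ _ _ (perm_sum_bop g).1).
  by apply: eq_bigr => s _; rewrite S_perm_sum M_perm_sum.
move=> y /commutantP[bY Cy].
have [|x Cx E] := perm_sum_commutant ws bY.
  by move=> g u; rewrite Cy //; exists g.
by exists x => //; apply/funext => u; rewrite E.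
Qed.

Local Notation emb := (crossed_emb Sconj).
Local Notation lam := (@crossed_transl R N V).

Definition dgl (g : Gam) (xi : {ffun 'S_N -> V}) : {ffun 'S_N -> V} :=
  [ffun t => rho g (xi t)].
Definition rtl (r : 'S_N) (xi : {ffun 'S_N -> V}) : {ffun 'S_N -> V} :=
  [ffun t => S r (xi (r * t)%g)].
Definition D2 := range dgl `|` range rtl.

Lemma embE a xi t : emb a xi t = S t^-1%g (a (S t (xi t))).
Proof. by rewrite ffunE SconjE invgK. Qed.

Lemma ffun_isometry_bop (f : {ffun 'S_N -> V} -> {ffun 'S_N -> V}) :
  linear f -> (forall xi, sqn fd (f xi) = sqn fd xi) -> bounded_op fd f.
Proof. exact: isometry_bop. Qed.

Lemma dgl_lin g : linear (dgl g).
Proof. by move=> c xi eta; apply/ffunP => t; rewrite !ffunE (ws_rho_lin ws). Qed.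
Lemma dgl_iso g xi : sqn fd (dgl g xi) = sqn fd xi.
Proof. by rewrite !sqn_ffun; apply: eq_bigr => t _; rewrite ffunE (ws_rho_iso ws). Qed.
Lemma rtl_lin r : linear (rtl r).
Proof. by move=> c xi eta; apply/ffunP => t; rewrite !ffunE (ws_S_lin ws). Qed.
Lemma rtl_iso r xi : sqn fd (rtl r xi) = sqn fd xi.
Proof.
rewrite !sqn_ffun [RHS](reindex_inj (mulgI r)); apply: eq_bigr => t _.
by rewrite ffunE (ws_S_iso ws).
Qed.
Lemma lam_lin s : linear (lam s).
Proof. by move=> c xi eta; apply/ffunP => t; rewrite !ffunE. Qed.
Lemma lam_iso s xi : sqn fd (lam s xi) = sqn fd xi.
Proof.
rewrite !sqn_ffun [RHS](reindex_inj (mulIg s^-1%g)); apply: eq_bigr => t _.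
by rewrite ffunE.
Qed.

Lemma D2_bop : D2 `<=` bounded_op fd.
Proof.
move=> _ [[g _ <-]|[r _ <-]]; apply: ffun_isometry_bop.
- exact: dgl_lin.
- exact: dgl_iso.
- exact: rtl_lin.
- exact: rtl_iso.
Qed.

Lemma D2_star : star_closed fd D2.
Proof.
move=> _ [[g _ <-]|[r _ <-]].
  exists (dgl (finv g)); first by left; exists (finv g).
  apply: unitary_adjoint; [exact: dgl_lin|exact: dgl_iso|].
  by move=> xi; apply/ffunP => t; rewrite !ffunE (rhoVK ws).
exists (rtl r^-1%g); first by right; exists r^-1%g.
apply: unitary_adjoint; [exact: rtl_lin|exact: rtl_iso|].
by move=> xi; apply/ffunP => t; rewrite !ffunE (SVK ws) mulKg.
Qed.

Lemma emb_bop a : M a -> bounded_op fd (emb a).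
Proof.
move=> Ma; have ba := M_bop Ma; split.
  move=> c xi eta; apply/ffunP => t; rewrite [RHS]ffunE [in RHS]ffunE !embE !ffunE.
  by rewrite (ws_S_lin ws) ba.1 (ws_S_lin ws).
have [K K0 aK] := bopP ba; exists K => xi.
rewrite -(@ler_pXn2r _ 2) ?nnegrE ?mulr_ge0 ?hnorm_ge0 ?(ltW K0) //.
rewrite exprMn !sqr_hnorm !sqn_ffun mulr_sumr; apply: ler_sum => t _.
rewrite embE (ws_S_iso ws) -(ws_S_iso ws t (xi t)) -!sqr_hnorm -exprMn.
by rewrite ler_pXn2r ?nnegrE ?mulr_ge0 ?hnorm_ge0 ?(ltW K0).
Qed.

Definition sdelta (t : 'S_N) (v : V) : {ffun 'S_N -> V} := [ffun r => if r == t then v else 0].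

Lemma covariant_crossed : covariant fd emb lam.
Proof.
split.
- exact: emb_bop.
- by move=> s; apply: ffun_isometry_bop; [exact: lam_lin|exact: lam_iso].
- move=> c a b w Ma Mb; apply/ffunP => t; rewrite [RHS]ffunE [in RHS]ffunE !embE.
  by rewrite (ws_S_lin ws).
- by move=> a b w _ _; apply/ffunP => t; rewrite !embE /= (SVK ws).
- move=> a b Ma Mb ab xi eta; rewrite !fdotE; apply: eq_bigr => t _.
  by rewrite !embE (is_adjointC (S_adj ws t)) ab (S_adj ws).
- by move=> s t w; apply/ffunP => r; rewrite !ffunE invMg mulgA.
- move=> s; apply: unitary_adjoint; [exact: lam_lin|exact: lam_iso|].
  by move=> xi; apply/ffunP => t; rewrite !ffunE invgK mulgKV.
- move=> s a w Ma; apply/ffunP => t; rewrite ffunE !embE SconjE ffunE.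
  by rewrite -!(ws_SM ws) invMg invgK.
move=> x Cx E s v.
have := congr1 (fun xi : {ffun 'S_N -> V} => xi 1%g) (E (sdelta s^-1%g v)).
rewrite sum_ffunE [RHS]ffunE (bigD1 s) //= embE invg1 !(ws_S1 ws) !ffunE mul1g eqxx.
rewrite big1 ?addr0 // => t ts; rewrite embE invg1 !(ws_S1 ws) !ffunE mul1g.
rewrite (inj_eq (@invg_inj _)) (negbTE ts) (linear_fun0 (M_bop (Cx t)).1).
by rewrite ?(linear_fun0 (ws_S_lin ws _)).
Qed.

Lemma D2_csums : commutant fd D2 `<=` csums emb lam.
Proof.
move=> y /commutantP[bY Cy].
pose x (s : 'S_N) v := y (sdelta s^-1%g v) 1%g.
have sdl t : linear (sdelta t).
  by move=> c u v; apply/ffunP => r; rewrite !ffunE; case: eqP => // _; rewrite scaler0 addr0.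
have bx s : bounded_op ip (x s).
  split; first by move=> c u v; rewrite /x sdl bY.1 !ffunE.
  have [K K0 yK] := bopP bY; exists K => v.
  apply: le_trans (hnorm_ffun_ge _ _ _) _; apply: le_trans (yK _) _.
  rewrite ler_wpM2l ?(ltW K0) // !hnormE sqn_ffun (bigD1 s^-1%g) //= ffunE eqxx.
  by rewrite big1 ?addr0 // => t ts; rewrite ffunE (negbTE ts) sqn0.
exists x.
  move=> s; apply/(rhoCP ip rho); split => // g v; rewrite /x.
  have -> : sdelta s^-1%g (rho g v) = dgl g (sdelta s^-1%g v).
    apply/ffunP => r; rewrite !ffunE; case: eqP => // _.
    by rewrite (linear_fun0 (ws_rho_lin ws g)).
  by rewrite Cy ?ffunE //; left; exists g.
apply/funext => xi; apply/ffunP => t.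
have := congr1 (fun f : {ffun 'S_N -> V} => f 1%g) (Cy (rtl t) ltac:(by right; exists t) xi).
rewrite /= [in RHS]ffunE mulg1 => E.
rewrite -[RHS](SK ws t) -E /csum sum_ffunE.
have -> : rtl t xi = \sum_s sdelta s^-1%g (S t (xi (t * s^-1)%g)).
  apply/ffunP => r; rewrite ffunE sum_ffunE (bigD1 r^-1%g) //= ffunE invgK eqxx.
  rewrite big1 ?addr0 // => s sr; rewrite ffunE; case: eqP => // rs.
  by rewrite rs invgK eqxx in sr.
rewrite (linear_fun_sum _ _ _ bY.1) sum_ffunE (linear_fun_sum _ _ _ (ws_S_lin ws _)).
by apply: eq_bigr => s _; rewrite embE ffunE.
Qed.

Lemma crossed_productE :
  crossed_product ip M Sconj = commutant fd D2 /\ crossed_product ip M Sconj = csums emb lam.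
Proof.
pose gens := [set emb a | a in M] `|` range lam.
have gb : gens `<=` bounded_op fd.
  move=> _ [[a Ma <-]|[s _ <-]]; first exact: emb_bop.
  by apply: ffun_isometry_bop; [exact: lam_lin|exact: lam_iso].
have i1 : crossed_product ip M Sconj `<=` commutant fd D2.
  apply: (vn_gen_min cF D2_star D2_bop) => z [[a Ma <-]|[s _ <-]].
  - have Ca := ((rhoCP ip rho a).1 Ma).2; apply/commutantP; split; first exact: emb_bop.
    move=> _ [[g _ <-]|[r _ <-]] xi; apply/ffunP => t.
      by rewrite embE [RHS]ffunE embE ffunE (ws_S_rho ws) Ca (S_rhoV ws) fpermVK.
    rewrite embE [RHS]ffunE embE ffunE -!(ws_SM ws) (_ : (r * t)^-1 * r = t^-1)%g //.
    by rewrite invMg mulgKV.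
  - apply/commutantP; split.
      by apply: ffun_isometry_bop; [exact: lam_lin|exact: lam_iso].
    by move=> _ [[g _ <-]|[r _ <-]] xi; apply/ffunP => t; rewrite !ffunE // mulgA.
have i3 : csums emb lam `<=` crossed_product ip M Sconj.
  move=> _ [x Cx <-]; apply: vn_gen_sum => s _.
  apply: (@vn_gen_comp _ _ _ _ (emb (x s)) (lam s)); apply: (sub_vn_gen cF gb).
    by left; exists (x s).
  by right; exists s.
have i2 := D2_csums.
split; apply/seteqP; split => //.
- exact: subset_trans i2 i3.
- exact: subset_trans i1 i2.
Qed.

End CrossedProduct.

(** * Tensor products with a finite-dimensional algebra *)

Section OrthonormalBasis.
Variables (R : realType) (A : vectType R[i]) (ipA : {dot A for Num.conj}).

Lemma orthonormal_span : exists2 X : seq A, orthonormal ipA X & <<X>>%VS = fullv.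
Proof.
suff H k : exists2 X : seq A, orthonormal ipA X & <<X>>%VS = fullv \/ (k <= size X)%N.
  have [X oX [E|le]] := H (\dim {:A}).+1; first by exists X.
  have := dimvS (subvf <<X>>%VS); have /eqP -> : \dim <<X>>%VS == size X by exact: (orthonormal_free oX).
  by rewrite leqNgt le.
elim: k => [|k [X oX [fX|le]]]; first by exists [::] => //; right.
  by exists X => //; left.
have [fX|nfX] := eqVneq <<X>>%VS fullv; first by exists X => //; left.
have [v vX] : exists v, v \notin <<X>>%VS.
  apply/not_existsP => H; move/eqP: nfX; apply; apply/vspaceP => v.
  by rewrite memvf; have /negP := H v; rewrite negbK.
have [Y YX [Z [vE _ oZ]]] := orthogonal_split ipA X v.
have Z0 : Z != 0 by apply: contra vX => /eqP Z0; rewrite vE Z0 addr0.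
pose c := ((Num.sqrt (sqn ipA Z))^-1)%:C%C.
have sZ : 0 < sqn ipA Z by rewrite lt_neqAle eq_sym sqn_eq0 Z0 sqn_ge0.
exists (c *: Z :: X); last by right.
rewrite -cat1s orthonormal_cat oX /= andbT; apply/andP; split.
  rewrite /orthonormal /= !andbT ip_sqn sqnZ normc_real ?invr_ge0 ?sqrtr_ge0 //.
  have -> : (Num.sqrt (sqn ipA Z))^-1 ^+ 2 * sqn ipA Z = 1.
    by rewrite exprVn sqr_sqrtr ?sqn_ge0 // mulVf ?gt_eqF.
  by [].
by apply/allP => w wX /=; rewrite ipZl (orthoPl oZ) // mulr0.
Qed.

Lemma orthonormal_basis : exists (d : nat) (e : 'I_d -> A),
  (forall i j, ipA (e i) (e j) = (i == j)%:R) /\ forall a, a = \sum_i ipA a (e i) *: e i.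
Proof.
have [X oX fX] := orthonormal_span.
have [uX oXX] := orthonormalP oX.
exists (size X), (fun i => X`_i).
have eE (i j : 'I_(size X)) : ipA X`_i X`_j = (i == j)%:R.
  by rewrite oXX ?mem_nth // nth_uniq.
split => // a.
have aX : a \in <<in_tuple X>>%VS by rewrite /= fX memvf.
rewrite {1}(coord_span aX); apply: eq_bigr => i _; congr (_ *: _).
rewrite {2}(coord_span aX) ip_suml (bigD1 i) //= ipZl eE eqxx mulr1.
by rewrite big1 ?addr0 // => j ji; rewrite ipZl eE (negbTE ji) mulr0.
Qed.

End OrthonormalBasis.

Section HilbertTensor.
Variables (R : realType) (V : lmodType R[i]) (A : vectType R[i]).
Variables (ip : {dot V for Num.conj}) (ipA : {dot A for Num.conj}).
Variable T : htensor ip ipA.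
Hypothesis Vc : hcomplete ip.
Local Notation ipT := (ht_dot T).
Local Notation "x '*o' y" := (ht_pure T x y) (at level 40).
Let cT : hcomplete ipT := ht_complete (h := T).
Local Notation normc := ComplexField.Normc.normc.

Lemma pureDl x x' y : (x + x') *o y = x *o y + x' *o y. Proof. exact: linearDl. Qed.
Lemma pureZl c x y : (c *: x) *o y = c *: (x *o y). Proof. exact: linearZl_LR. Qed.

Lemma pureZr c x y : x *o (c *: y) = c *: (x *o y). Proof. exact: linearZr_LR. Qed.
Lemma pure_sumr x (J : Type) (r : seq J) P F :
  x *o (\sum_(j <- r | P j) F j) = \sum_(j <- r | P j) x *o F j.
Proof. exact: linear_sumr. Qed.
Lemma pure_suml y (J : Type) (r : seq J) P F :
  (\sum_(j <- r | P j) F j) *o y = \sum_(j <- r | P j) F j *o y.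
Proof. exact: linear_sumlz. Qed.

Lemma pure_ext z z' : bounded_op ipT z -> bounded_op ipT z' ->
  (forall x y, z (x *o y) = z' (x *o y)) -> z = z'.
Proof.
move=> bz bz' E; apply/funext => t; apply: (hclosed_eq bz bz') => e /(ht_dense t)[k [x [y lt]]].
exists (\sum_(i < k) x i *o y i) => //=.
by rewrite (linear_fun_sum _ _ _ bz.1) (linear_fun_sum _ _ _ bz'.1); apply: eq_bigr => i _.
Qed.

Lemma pure_adj z z' : bounded_op ipT z -> bounded_op ipT z' ->
  (forall x y x' y', ipT (z (x *o y)) (x' *o y') = ipT (x *o y) (z' (x' *o y'))) ->
  is_adjoint ipT z z'.
Proof.
move=> bz bz' E; suff <- : adjoint ipT z = z' by exact: adjointP.
apply: pure_ext => // [|x' y']; first exact: bop_adjoint.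
apply: (ip_eq_dense (ip := ipT)
  (D := [set t | exists (k : nat) (x : 'I_k -> V) (y : 'I_k -> A), t = \sum_(i < k) x i *o y i])).
  move=> t e /(ht_dense t)[k [x [y lt]]]; exists (\sum_(i < k) x i *o y i) => //.
  by exists k, x, y.
move=> _ [k [x [y ->]]]; rewrite !ip_sumr; apply: eq_bigr => i _.
by rewrite ipC -(adjointP cT bz) E -ipC.
Qed.

Variables (d : nat) (e : 'I_d -> A).
Hypothesis e_on : forall i j, ipA (e i) (e j) = (i == j)%:R.
Hypothesis e_basis : forall a, a = \sum_i ipA a (e i) *: e i.

Definition tinj (i : 'I_d) (v : V) : T := v *o e i.
Definition tprj (i : 'I_d) (t : T) : V := xget 0 [set p | forall v, ipT (tinj i v) t = ip v p].

Lemma sqn_tinj i v : sqn ipT (tinj i v) = sqn ip v.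
Proof. by rewrite /sqn ht_pureE e_on eqxx mulr1. Qed.

Lemma tprjP i v t : ipT (tinj i v) t = ip v (tprj i t).
Proof.
rewrite /tprj; case: xgetP => [p _ //|H].
have [] := @riesz _ _ _ Vc (fun v => ipT (tinj i v) t) (hnorm ipT t).
- by move=> c u w; rewrite /tinj pureDl pureZl ipDl ipZl.
- move=> u; rewrite mulrC; apply: le_trans (cauchy_schwarz _ _ _) _.
  by rewrite hnormE sqn_tinj.
by move=> p pP; case: (H p).
Qed.

Lemma tprj_pure i x y : tprj i (x *o y) = ipA y (e i) *: x.
Proof.
by apply: (ip_injr (ip := ip)) => u; rewrite -tprjP ht_pureE ipZr -ipC mulrC.
Qed.

Lemma tensor_amplification : amplification ip ipT tinj tprj.
Proof.
have lp i c u v : tprj i (c *: u + v) = c *: tprj i u + tprj i v.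
  by apply: (ip_injr (ip := ip)) => w; rewrite -tprjP !ipDr !ipZr -!tprjP.
have li i c u v : tinj i (c *: u + v) = c *: tinj i u + tinj i v.
  by rewrite /tinj pureDl pureZl.
split => //.
- by move=> i j v; rewrite tprj_pure e_on eq_sym; case: eqP; rewrite ?scale1r ?scale0r.
- move=> t.
  have bz : bounded_op ipT (fun t => \sum_i tinj i (tprj i t)).
    apply: bop_sum => i _; split; first by move=> c u v; rewrite lp li.
    exists 1 => u; rewrite mul1r hnormE sqn_tinj -hnormE.
    have [->|p0] := eqVneq (hnorm ip (tprj i u)) 0; first exact: hnorm_ge0.
    have pp : 0 < hnorm ip (tprj i u) by rewrite lt_neqAle eq_sym p0 hnorm_ge0.
    rewrite -(ler_pM2l pp) -expr2 sqr_hnorm.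
    rewrite -[leLHS]normc_real ?sqn_ge0 // -ip_sqn -tprjP.
    apply: le_trans (cauchy_schwarz _ _ _) _; by rewrite hnormE sqn_tinj.
  have := pure_ext (bop_id ipT) bz _ => /(_ _)/(congr1 (fun f => f t)); apply.
  move=> x y /=; rewrite {1}(e_basis y) pure_sumr; apply: eq_bigr => i _.
  by rewrite tprj_pure /tinj pureZl pureZr.
- by move=> i v t; exact: tprjP.
Qed.
Local Notation amp := tensor_amplification.

Definition tensor_exp (a : V -> V) (b : A -> A) : T -> T := fun t =>
  \sum_i \sum_j elem tinj tprj i j (fun v => ipA (b (e j)) (e i) *: a v) t.

Lemma bop_scale (c : R[i]) a : bounded_op ip a -> bounded_op ip (fun v => c *: a v).
Proof.
move=> ba; have := bop_lin c ba (bop0 ip).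
by congr (bounded_op _ _); apply/funext => v; rewrite addr0.
Qed.

Lemma tensor_exp_bop a b : bounded_op ip a -> bounded_op ipT (tensor_exp a b).
Proof.
move=> ba; apply: bop_sum => i _; apply: bop_sum => j _; apply: (bop_elem amp).
exact: bop_scale.
Qed.

Lemma tensor_exp_pure a b x y : linear a -> linear b ->
  tensor_exp a b (x *o y) = a x *o b y.
Proof.
move=> la lb; rewrite /tensor_exp [b y]e_basis pure_sumr; apply: eq_bigr => i _.
rewrite pureZr -pureZl {2}[y]e_basis.
have lbA : forall F : 'I_d -> A, b (\sum_j F j) = \sum_j b (F j).
  have b0 : b 0 = 0 by have := lb (-1) 0 0; rewrite scaler0 addr0 scaleN1r addNr.
  move=> F; apply: (big_morph b _ b0) => u v.
  by have := lb 1 u v; rewrite !scale1r.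
rewrite lbA ip_suml scaler_suml pure_suml; apply: eq_bigr => j _.
have bZ c u : b (c *: u) = c *: b u.
  by have := lb c u 0; rewrite !addr0 => ->; have := lb (-1) 0 0; rewrite scaler0 addr0 scaleN1r addNr => ->; rewrite addr0.
rewrite bZ ipZl /elem tprj_pure /tinj (linear_funZ _ _ la) scalerA.
by rewrite mulrC.
Qed.

Lemma tensor_opP a b : bounded_op ip a -> linear b ->
  tensor_op (T := T) a b = tensor_exp a b.
Proof.
move=> ba lb; rewrite /tensor_op; case: xgetP => [z _ [bz zP]|/(_ (tensor_exp a b))[]].
  apply: pure_ext => //; first exact: tensor_exp_bop.
  by move=> x y; rewrite zP tensor_exp_pure //; exact: ba.1.
by split; [exact: tensor_exp_bop|move=> x y; apply: tensor_exp_pure => //; exact: ba.1].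
Qed.

Lemma tensor_op_bop a b : bounded_op ip a -> linear b -> bounded_op ipT (tensor_op (T := T) a b).
Proof. by move=> ba lb; rewrite tensor_opP //; exact: tensor_exp_bop. Qed.

Lemma tensor_op_pure a b x y : bounded_op ip a -> linear b ->
  tensor_op (T := T) a b (x *o y) = a x *o b y.
Proof. by move=> ba lb; rewrite tensor_opP // tensor_exp_pure //; exact: ba.1. Qed.

Lemma diag_pure a x y : bounded_op ip a -> diag tinj tprj a (x *o y) = a x *o y.
Proof.
move=> ba; rewrite /diag [in RHS](e_basis y) pure_sumr; apply: eq_bigr => i _.
by rewrite tprj_pure (linear_funZ _ _ ba.1) /tinj pureZl pureZr.
Qed.

Definition mxunit (i j : 'I_d) (y : A) : A := ipA y (e j) *: e i.

Lemma mxunit_lin i j : linear (mxunit i j).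
Proof. by move=> c u v; rewrite /mxunit ipDl ipZl scalerDl scalerA. Qed.

Lemma elem_tensor a i j : bounded_op ip a ->
  elem tinj tprj i j a = tensor_op (T := T) a (mxunit i j).
Proof.
move=> ba; apply: pure_ext; [exact: (bop_elem amp)|exact: (tensor_op_bop ba (mxunit_lin i j))|].
move=> x y; rewrite tensor_op_pure //; last exact: mxunit_lin.
by rewrite /elem tprj_pure (linear_funZ _ _ ba.1) /tinj /mxunit pureZl pureZr.
Qed.

Lemma vn_tensorE (D : set (V -> V)) : D `<=` bounded_op ip -> star_closed ip D ->
  vn_tensor (T := T) (commutant ip D) (@End_alg R A) = ampl ipT tinj tprj (commutant ip D).
Proof.
move=> bD sD.
set gens := [set z | exists2 a, commutant ip D a & exists2 b, End_alg b & z = tensor_op (T := T) a b].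
have gb : gens `<=` bounded_op ipT.
  by move=> _ [a Ca [b lb ->]]; apply: tensor_op_bop => //; exact: commutant_bop Ca.
apply/seteqP; split.
  rewrite (ampl_commutant amp bD); apply: (vn_gen_min cT).
  - move=> _ [a Da <-]; have [a' Da' aa] := sD _ Da.
    by exists (diag tinj tprj a'); [exists a'|exact: (diag_adj amp)].
  - by move=> _ [a /bD ba <-]; exact: (bop_diag amp).
  move=> _ [a Ca [b lb ->]]; have ba := commutant_bop Ca.
  rewrite -(ampl_commutant amp bD) tensor_opP //.
  have [] := sum_elem_ampl amp (C := commutant ip D)
    (F := fun i j v => ipA (b (e j)) (e i) *: a v).
  - by move=> i j; exact: bop_scale.
  - move=> i j; rewrite (_ : (fun v => _) = fun v => ipA (b (e j)) (e i) *: a v + 0).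
      exact: commutant_lin bD Ca (commutant0 bD).
    by apply/funext => v; rewrite addr0.
  by [].
move=> z [bz Cz].
rewrite (_ : z = fun t => \sum_i \sum_j elem tinj tprj i j (entry tinj tprj z i j) t).
  apply: vn_gen_sum => i _; apply: vn_gen_sum => j _; apply: (sub_vn_gen cT gb).
  exists (entry tinj tprj z i j) => //; exists (mxunit i j); first exact: mxunit_lin.
  exact/elem_tensor/(bop_entry amp).
by apply/funext => t; exact: (op_sum_elem amp _ bz.1).
Qed.

End HilbertTensor.

Lemma phi1 N : @phi N 1%g = 1%g.
Proof. by rewrite /phi (word_perm_eq (repr_braid [::])). Qed.

Lemma phi_surjective N (s : 'S_N) : exists b : braid N, phi b = s.
Proof.
pose P (s : 'S_N) := exists b : braid N, phi b = s.
have P1 : P 1%g by exists 1%g; exact: phi1.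
have PM s1 s2 : P s1 -> P s2 -> P (s1 * s2)%g.
  by move=> [b1 <-] [b2 <-]; exists (b2 * b1)%g; exact: phiM.
have Padj (i j : 'I_N) : j = i.+1 :> nat -> P (tperm i j).
  move=> ij; have lt : (i < N.-1)%N by rewrite ltn_predRL -ij.
  exists (braid_of_word [:: (Ordinal lt, true)]); rewrite phi_gen; congr tperm; exact: val_inj.
have Pt k (i j : 'I_N) : j = (i + k.+1)%N :> nat -> P (tperm i j).
  elim: k j => [|k IHk] j; first by rewrite addn1; exact: Padj.
  move=> ij; have lt : (i + k.+1 < N)%N by rewrite (leq_trans _ (ltnW (ltn_ord j))) // ij !addnS.
  pose l := Ordinal lt.
  have il : i != l by rewrite -val_eqE /= neq_ltn addnS ltnS leq_addr.
  have lj : l != j by rewrite -val_eqE /= neq_ltn ij ltn_add2l ltnSn.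
  have ji : j != i by rewrite -val_eqE /= ij -{2}(addn0 i) eqn_add2l.
  have -> : tperm i j = (tperm l j * tperm i l * tperm l j)%g.
    have -> : (tperm l j * tperm i l * tperm l j)%g = (tperm i l ^ tperm l j)%g by rewrite conjgE tpermV mulgA.
    by rewrite tpermJ tpermL tpermD // eq_sym.
  have Plj : P (tperm l j) by apply: Padj; rewrite ij addnS.
  by apply: (PM _ _ (PM _ _ Plj _) Plj); exact: IHk.
have Ptp (i j : 'I_N) : P (tperm i j).
  have [lt|lt|/val_inj->] := ltngtP i j; last by rewrite tperm1.
    by apply: (Pt (j - i).-1); rewrite prednK ?subn_gt0 // subnKC // ltnW.
  by rewrite tpermC; apply: (Pt (i - j).-1); rewrite prednK ?subn_gt0 // subnKC // ltnW.
have [ts -> _] := prod_tpermP s.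
by apply: (big_ind P P1 PM) => t _; exact: Ptp.
Qed.

Section AbstractTheorem.
Variables (R : realType) (V : lmodType R[i]) (ip : {dot V for Num.conj}).
Variables (G : groupType) (N : nat).
Variables (rho : ('I_N -> G) -> V -> V) (S : 'S_N -> V -> V).
Hypothesis ws : wandering_system ip rho S.
Variables (A : falgType R[i]) (ipA : {dot A for Num.conj}) (pi : braid N -> A -> A).
Hypothesis pi_unitary : unitary_rep ipA pi.
Hypothesis pi_one : forall b, phi b = 1%g -> pi b 1 = 1.
Variables (T : htensor ip ipA) (T' : htensor (@ffun_dot R 'S_N V ip) ipA).

Local Notation ipT := (ht_dot T).
Local Notation "x '*o' y" := (ht_pure T x y) (at level 40).
Let Vc := ws_complete ws.
Let cT : hcomplete ipT := ht_complete (h := T).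
Local Notation M := (rhoC ip rho).
Local Notation fd := (@ffun_dot R 'S_N V ip : {dot {ffun 'S_N -> V} for Num.conj}).

Definition Uop (b : braid N) : T -> T := tensor_op (T := T) (S (phi b)) (pi b).
Definition Uinv : set T := [set v | forall b, Uop b v = v].

Let pil b : linear (pi b). Proof. by have [H _ _ _] := pi_unitary. Qed.
Let piu b u v : ipA (pi b u) (pi b v) = ipA u v. Proof. by have [_ H _ _] := pi_unitary. Qed.
Let pi1 u : pi 1%g u = u. Proof. by have [_ _ H _] := pi_unitary. Qed.
Let piM b c u : pi (b * c)%g u = pi b (pi c u). Proof. by have [_ _ _ H] := pi_unitary. Qed.

Variables (d : nat) (e : 'I_d -> A).
Hypothesis e_on : forall i j, ipA (e i) (e j) = (i == j)%:R.
Hypothesis e_basis : forall a, a = \sum_i ipA a (e i) *: e i.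
Local Notation inj := (tinj T e).
Local Notation prj := (tprj e).
Let amp : amplification ip ipT inj prj := tensor_amplification T Vc e_on e_basis.
Local Notation dg := (diag inj prj).

Lemma Uop_bop b : bounded_op ipT (Uop b).
Proof. exact: (tensor_op_bop T Vc e_on e_basis (S_bop ws _) (pil _)). Qed.

Lemma Uop_pure b x y : Uop b (x *o y) = S (phi b) x *o pi b y.
Proof. exact: (tensor_op_pure T Vc e_on e_basis _ _ (S_bop ws _) (pil _)). Qed.

Lemma Uop_adj b : is_adjoint ipT (Uop b) (Uop b^-1%g).
Proof.
apply: (pure_adj (T := T)); [exact: Uop_bop|exact: Uop_bop|].
move=> x y x' y'; rewrite !Uop_pure !ht_pureE; congr (_ * _).
  rewrite (S_adj ws); congr (ip _ (S _ _)); apply: (mulgI (phi b)).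
  by rewrite mulgV -phiM mulVg phi1.
by rewrite -(piu b y) -piM mulgV pi1.
Qed.

Lemma Uinv_subspace : subspace Uinv.
Proof.
split=> [b|c u v Hu Hv b]; first exact: linear_fun0 (Uop_bop b).1.
by rewrite (Uop_bop b).1 Hu Hv.
Qed.

Lemma Uinv_closed : hclosed ipT Uinv.
Proof.
move=> v Hv b; apply: (hclosed_eq (Uop_bop b) (bop_id ipT)) => r /Hv[w Hw lt].
by exists w => //=; exact: Hw.
Qed.

Lemma PU_spec v : Uinv (orth_proj ipT Uinv v) /\
  forall w, Uinv w -> ipT (v - orth_proj ipT Uinv v) w = 0.
Proof.
have [u Wu o] := projection cT v Uinv_subspace Uinv_closed.
by rewrite /orth_proj; case: xgetP => [u' _ //|/(_ u)/not_andP[]].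
Qed.

Lemma PU_unique v u : Uinv u -> (forall w, Uinv w -> ipT (v - u) w = 0) ->
  orth_proj ipT Uinv v = u.
Proof.
have [Wp po] := PU_spec v; move=> Wu uo; apply/eqP; rewrite -subr_eq0.
set p := orth_proj _ _ _ in Wp po *.
have Wd : Uinv (p - u) by exact: subspaceB Uinv_subspace Wp Wu.
rewrite -(dnorm_eq0 ipT); apply/eqP.
have {1}-> : p - u = (v - u) - (v - p) by rewrite opprB [RHS]addrC -addrA addKr.
by rewrite ipBl uo // po // subrr.
Qed.

Local Notation PU := (orth_proj ipT Uinv).

Lemma PU_bop : bounded_op ipT PU.
Proof.
split.
  move=> c u v; have [Wu uo] := PU_spec u; have [Wv vo] := PU_spec v.
  apply: PU_unique; first exact: Uinv_subspace.2.
  move=> w Ww; have -> : c *: u + v - (c *: PU u + PU v) = c *: (u - PU u) + (v - PU v).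
    by rewrite scalerBr opprD addrACA.
  by rewrite ipDl ipZl uo // vo // mulr0 addr0.
exists 1 => v; rewrite mul1r !hnormE ler_sqrt ?sqn_ge0 //.
have [Wv vo] := PU_spec v.
by rewrite -[in leRHS](subrK (PU v) v) sqnD vo // mulr0 addr0 lerDr sqn_ge0.
Qed.

Lemma PU_commute z z' : bounded_op ipT z -> is_adjoint ipT z z' ->
  (forall b t, Uop b (z t) = z (Uop b t)) -> (forall b t, Uop b (z' t) = z' (Uop b t)) ->
  forall t, PU (z t) = z (PU t).
Proof.
move=> bz zz Uz Uz' t; have [Wt to] := PU_spec t.
apply: PU_unique; first by move=> b; rewrite Uz Wt.
move=> w Ww; rewrite -(linear_funB bz.1) zz to // => b.
by rewrite Uz' Ww.
Qed.

Lemma diag_Uop a b t : bounded_op ip a -> (forall v, S (phi b) (a v) = a (S (phi b) v)) ->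
  Uop b (dg a t) = dg a (Uop b t).
Proof.
move=> ba Sa; suff E : Uop b \o dg a = dg a \o Uop b by exact: (congr1 (fun f => f t) E).
have bd : bounded_op ipT (dg a) by exact: (bop_diag amp).
apply: pure_ext; [exact: bop_comp (Uop_bop _) bd|exact: bop_comp bd (Uop_bop _)|].
move=> x y /=; rewrite (diag_pure T Vc e_on e_basis _ _ ba) !Uop_pure.
by rewrite (diag_pure T Vc e_on e_basis _ _ ba) Sa.
Qed.

Let c1 : covariant ip rho S ip id S := covariant_id ws.
Local Notation C1 := (csums ip rho id S).

Lemma QE : vn_tensor (T := T) M (@End_alg R A) = ampl ipT inj prj M.
Proof. exact: (vn_tensorE T Vc e_on e_basis (range_rho_bop ws) (rho_star ws)). Qed.

Local Notation Q := (vn_tensor (T := T) M (@End_alg R A)).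
Local Notation dgD1 := [set dg a | a in D1 rho].

Lemma dgD1_bop : dgD1 `<=` bounded_op ipT.
Proof. by move=> _ [a /(D1_bop ws) ba <-]; exact: (bop_diag amp). Qed.

Lemma dgD1_star : star_closed ipT dgD1.
Proof.
move=> _ [a Da <-]; have [a' Da' aa] := D1_star ws Da.
by exists (dg a'); [exists a'|exact: (diag_adj amp)].
Qed.

Lemma Q_bop : Q `<=` bounded_op ipT. Proof. by rewrite QE => z []. Qed.

Lemma Q_D1 : Q `<=` commutant ipT dgD1.
Proof.
rewrite QE -(ampl_commutant amp (D1_bop ws)) => z [bz Cz]; split => // i j.
have Mz := Cz i j; apply/commutantP; split; first exact: M_bop Mz.
by move=> _ [g _ <-] v; exact: M_perm_sum.
Qed.

Lemma D1_Uop w b t : dgD1 w -> Uop b (w t) = w (Uop b t).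
Proof.
move=> [_ [g _ <-] <-]; apply: diag_Uop; first exact: (perm_sum_bop ws).
exact: (S_perm_sum ws).
Qed.

Lemma ampl_C1E : ampl ipT inj prj C1 = commutant ipT dgD1.
Proof. by rewrite (csums_D1 ws) (ampl_commutant amp (D1_bop ws)). Qed.

Local Notation QU := (Q `|` range Uop).
Local Notation QP := (Q `|` [set PU]).

Lemma QU_bop : QU `<=` bounded_op ipT.
Proof. by move=> z [/Q_bop//|[b _ <-]]; exact: Uop_bop. Qed.

Lemma QU_sub : vn_gen ipT QU `<=` ampl ipT inj prj C1.
Proof.
rewrite ampl_C1E; apply: (vn_gen_min cT dgD1_star dgD1_bop) => z [/Q_D1//|[b _ <-]].
apply/commutantP; split; first exact: Uop_bop.
by move=> w Dw t; exact: D1_Uop.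
Qed.

Lemma QP_sub : vn_gen ipT QP `<=` ampl ipT inj prj C1.
Proof.
rewrite ampl_C1E; apply: (vn_gen_min cT dgD1_star dgD1_bop) => z [/Q_D1//|->].
apply/commutantP; split; first exact: PU_bop.
move=> w Dw t; have [w' Dw' ww] := dgD1_star Dw.
apply: (PU_commute (dgD1_bop Dw) ww).
  by move=> b s; exact: D1_Uop.
by move=> b s; exact: D1_Uop.
Qed.

Lemma Q_tensor a f : M a -> linear f -> Q (tensor_op (T := T) a f).
Proof.
move=> Ma lf; apply: (sub_vn_gen cT) => [_ [a' Ma' [b lb ->]]|].
  exact: (tensor_op_bop T Vc e_on e_basis (commutant_bop Ma') lb).
by exists a => //; exists f.
Qed.

Lemma sup_QU : ampl ipT inj prj C1 `<=` vn_gen ipT QU.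
Proof.
move=> z [bz Cz].
rewrite (_ : z = fun t => \sum_i \sum_j elem inj prj i j (entry inj prj z i j) t); last first.
  by apply/funext => t; exact: (op_sum_elem amp _ bz.1).
apply: vn_gen_sum => i _; apply: vn_gen_sum => j _.
have [x Cx <-] := Cz i j.
rewrite (_ : elem _ _ _ _ _ = fun t => \sum_s elem inj prj i j (fun v => x s (S s v)) t); last first.
  by apply/funext => t; rewrite /elem /csum (inj_sum amp).
apply: vn_gen_sum => s _; have [b bs] := phi_surjective s.
have lf : linear (fun y => mxunit ipA e i j (pi b^-1%g y)).
  by move=> c u v; rewrite pil mxunit_lin.
have bx := M_bop (Cx s).
rewrite (_ : elem _ _ _ _ _ = tensor_op (T := T) (x s) (fun y => mxunit ipA e i j (pi b^-1%g y)) \o Uop b).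
  have G1 : vn_gen ipT QU (tensor_op (T := T) (x s) (fun y => mxunit ipA e i j (pi b^-1%g y))).
    by apply: (sub_vn_gen cT QU_bop); left; exact: Q_tensor.
  have G2 : vn_gen ipT QU (Uop b) by apply: (sub_vn_gen cT QU_bop); right; exists b.
  exact: (vn_gen_comp G1 G2).
have bxs : bounded_op ip (fun v => x s (S s v)) by exact: bop_comp bx (S_bop ws s).
have bt := tensor_op_bop T Vc e_on e_basis bx lf.
rewrite (elem_tensor T Vc e_on e_basis i j bxs).
apply: pure_ext; [|exact: bop_comp bt (Uop_bop b)|].
  exact: (tensor_op_bop T Vc e_on e_basis bxs (mxunit_lin _ _ _ _)).
move=> v y /=; rewrite Uop_pure !(tensor_op_pure T Vc e_on e_basis) //; last exact: mxunit_lin.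
by rewrite bs -piM mulVg pi1.
Qed.

Definition lift (s : 'S_N) : braid N := xget 1%g [set b | phi b = s].

Lemma phi_lift s : phi (lift s) = s.
Proof.
by rewrite /lift; case: xgetP => [b _ //|H]; have [b bs] := phi_surjective s; case: (H b).
Qed.

Lemma pi_phi b c : phi b = phi c -> pi b 1 = pi c 1.
Proof.
move=> bc; have : pi (c^-1 * b)%g 1 = 1.
  by apply: pi_one; rewrite phiM bc -phiM mulVg phi1.
by rewrite piM => /(congr1 (pi c)); rewrite -piM mulgV pi1.
Qed.

Lemma PU_one v : PU (v *o 1) =
  (#|{perm 'I_N}|%:R^-1 : R[i]) *: \sum_s (S s v *o pi (lift s) 1).
Proof.
apply: PU_unique => [b|w Ww].
  rewrite (linear_funZ _ _ (Uop_bop b).1) (linear_fun_sum _ _ _ (Uop_bop b).1).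
  congr (_ *: _); rewrite [RHS](reindex_inj (mulIg (phi b))); apply: eq_bigr => s _.
  rewrite Uop_pure -(ws_SM ws) -piM; congr (_ *o _); apply: pi_phi.
  by rewrite phiM !phi_lift.
have E s : ipT (S s v *o pi (lift s) 1) w = ipT (v *o 1) w.
  rewrite -{1}(phi_lift s) -Uop_pure Uop_adj.
  by rewrite Ww.
have n0 : #|{perm 'I_N}|%:R != 0 :> R[i].
  by rewrite pnatr_eq0 -lt0n; apply/card_gt0P; exists 1%g.
have ES : \sum_s ipT (S s v *o pi (lift s) 1) w = #|{perm 'I_N}|%:R * ipT (v *o 1) w.
  by rewrite (eq_bigr _ (fun s _ => E s)) sumr_const mulr_natl.
by rewrite ipBl ipZl ip_suml ES mulKf // subrr.
Qed.

Lemma pi_lift_neq0 s : pi (lift s) 1 != 0.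
Proof. by rewrite -(dnorm_eq0 ipA) piu dnorm_eq0 oner_neq0. Qed.

(* The hypothesis on [PU] gives [\sum_s (w0 S_s - S_s w0) u (x) pi_s 1 = 0];
   replacing [u] by [a v] with [a] in [M] brings it into the scope of
   [commutant_separating], which isolates each term. *)
Lemma commute_S w0 : bounded_op ip w0 -> (forall a, M a -> forall v, w0 (a v) = a (w0 v)) ->
  (forall v, PU (dg w0 (v *o 1)) = dg w0 (PU (v *o 1))) ->
  forall s v, S s (w0 v) = w0 (S s v).
Proof.
move=> bw Mw E r v.
have lw := bw.1.
have E1 u : \sum_s ((w0 (S s u) - S s (w0 u)) *o pi (lift s) 1) = 0.
  have := E u; rewrite (diag_pure T Vc e_on e_basis _ _ bw) !PU_one.
  have ld : linear (dg w0) by have [] := bop_diag amp bw.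
  rewrite (linear_funZ _ _ ld) (linear_fun_sum _ _ _ ld) => /esym.
  move/scalerI => /(_ _) H.
  rewrite (eq_bigr (fun s => dg w0 (S s u *o pi (lift s) 1) - S s (w0 u) *o pi (lift s) 1)); last first.
    by move=> s _; rewrite (diag_pure T Vc e_on e_basis _ _ bw) -scaleN1r pureDl pureZl scaleN1r.
  rewrite sumrB H ?subrr // invr_neq0 // pnatr_eq0 -lt0n; apply/card_gt0P; by exists 1%g.
pose c a s := ipA (pi (lift s) 1) a.
have E2 a u : \sum_s c a s *: (w0 (S s u) - S s (w0 u)) = 0.
  apply: (ip_inj (ip := ip)) => z; rewrite ip0l ip_suml.
  have := congr1 (fun t => ipT t (z *o a)) (E1 u); rewrite /= ip0l ip_suml => E1u.
  rewrite -[RHS]E1u; apply: eq_bigr => s _.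
  by rewrite ht_pureE ipZl mulrC.
pose z a s := c a s *: (S s^-1%g (w0 (S s v)) - w0 v).
have E3 a x : M x -> \sum_s S s (x (z a s)) = 0.
  move=> Mx; have bx := M_bop Mx; rewrite -[RHS](E2 a (x v)); apply: eq_bigr => s _.
  rewrite /z (linear_funZ _ _ bx.1) (linear_funZ _ _ (ws_S_lin ws s)); congr (_ *: _).
  rewrite (linear_funB bx.1) (linear_funB (ws_S_lin ws s)); congr (_ - _); last by rewrite Mw.
  have := Mw _ (Sconj_M ws s Mx) (S s v).
  by rewrite !(SconjE ws) (SK ws) => ->.
have z0 a : z a r = 0.
  have := @commutant_separating _ _ _ _ _ _ _ ws (fun t => z a (t * r)%g).
  rewrite mul1g; apply => x Mx.
  have := congr1 (S r^-1%g) (E3 a x Mx).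
  rewrite (linear_fun0 (ws_S_lin ws _)) (linear_fun_sum _ _ _ (ws_S_lin ws _)) => E4.
  rewrite -[RHS]E4 [RHS](reindex_inj (mulIg r)); apply: eq_bigr => t _.
  by rewrite -(ws_SM ws) mulgK.
have /eqP := z0 (pi (lift r) 1); rewrite scaler_eq0 (dnorm_eq0 ipA) (negbTE (pi_lift_neq0 r)) /=.
by rewrite subr_eq0 => /eqP <-; rewrite (SVK ws).
Qed.

Lemma sup_QP : ampl ipT inj prj C1 `<=` vn_gen ipT QP.
Proof.
apply: (subset_trans sup_QU); rewrite /vn_gen; apply: commutantS => w Cw.
have lw : linear w by have [[]] := Cw.
have wQ q : Q q -> forall t, w (q t) = q (w t).
  by move=> Qq t; have [_ H] := (commutantP _ _ _).1 Cw; rewrite H //; left; left.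
have wP t : w (PU t) = PU (w t).
  by have [_ H] := (commutantP _ _ _).1 Cw; rewrite H //; left; right.
have M1 : M id.
  by apply/(rhoCP ip rho); split; [exact: bop_id|].
have i0 : 'I_d.
  case: (d) e e_basis => [|d'] e' eb; last exact: ord0.
  by have /eqP := eb 1; rewrite big_ord0 oner_eq0.
have wel i j t : w (elem inj prj i j id t) = elem inj prj i j id (w t).
  apply: wQ; rewrite (elem_tensor T Vc e_on e_basis i j (bop_id ip)).
  exact: Q_tensor M1 (mxunit_lin _ _ _ _).
pose w0 := entry inj prj w i0 i0.
have wE : w = dg w0.
  apply: (entry_ext amp) => // [|i j v].
    apply: (bop_linear (ip := ipT)); apply: (bop_diag amp).
    exact: (bop_entry amp _ _ (commutant_bop Cw)).
  have w0l : linear w0 by have [] := bop_entry amp i0 i0 (commutant_bop Cw).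
  rewrite {2}/entry (diag_inj amp _ _ w0l) (amp_prj_inj amp) /w0 /entry.
  have -> : inj j v = elem inj prj j i0 id (inj i0 v).
    by rewrite /elem (amp_prj_inj amp) eqxx.
  rewrite wel /elem (amp_prj_inj amp); case: eqP => //.
have bw : bounded_op ip w0 by exact: (bop_entry amp i0 i0 (commutant_bop Cw)).
have Mw a : M a -> forall v, w0 (a v) = a (w0 v).
  move=> Ma v; have ba := M_bop Ma.
  have lid : linear (id : A -> A) by [].
  have := wQ _ (Q_tensor Ma lid) (inj i0 v); rewrite /tinj.
  rewrite !(tensor_op_pure T Vc e_on e_basis _ _ ba lid).
  move/(congr1 (prj i0)) => E; rewrite {1}/w0 {1}/entry /tinj E.
  rewrite wE (diag_pure T Vc e_on e_basis _ _ bw) (tensor_op_pure T Vc e_on e_basis _ _ ba lid).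
  by have := amp_prj_inj amp i0 i0 (a (w0 v)); rewrite eqxx.
have Sw := commute_S bw Mw.
have {}Sw s v : S s (w0 v) = w0 (S s v) by apply: Sw => u; rewrite -wE wP.
have wU b t : w (Uop b t) = Uop b (w t) by rewrite wE diag_Uop.
apply/commutantP; split; first exact: commutant_bop Cw.
move=> z [[Qz|[b _ <-]]|[z' [Qz|[b _ <-]] <-]] t.
- exact: wQ.
- exact: wU.
- have [_ H] := (commutantP _ _ _).1 Cw; rewrite H //; right; exists z' => //; by left.
- by rewrite (adjointE (Uop_adj b)) wU.
Qed.

Lemma QP_E : vn_gen ipT QP = ampl ipT inj prj C1.
Proof. by apply/seteqP; split; [exact: QP_sub|exact: sup_QP]. Qed.

Lemma QU_E : vn_gen ipT QU = ampl ipT inj prj C1.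
Proof. by apply/seteqP; split; [exact: QU_sub|exact: sup_QU]. Qed.

Local Notation crossed := (crossed_product ip M (Sconj ip S)).
Local Notation crossed_End := (vn_tensor (T := T') crossed (@End_alg R A)).

Lemma crossed_iso : vn_isomorphic ipT (ampl ipT inj prj C1) (ht_dot T') crossed_End.
Proof.
have cF : hcomplete fd := ffun_complete Vc.
have [cE cE2] := crossed_productE ws.
have -> : crossed_End = ampl (ht_dot T') (tinj T' e) (tprj (T := T') e) (csums ip rho (crossed_emb (Sconj ip S)) (@crossed_transl R N V)).
  by rewrite {1}cE (vn_tensorE T' cF e_on e_basis (D2_bop ws) (D2_star ws)) -cE cE2.
have [f fiso] := covariant_iso ws (covariant_id ws) (covariant_crossed ws).
apply: (vn_isomorphic_ampl amp _ fiso cT (ht_complete (h := T'))).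
exact: (tensor_amplification T' cF e_on e_basis).
Qed.

Lemma abstract_isomorphisms :
  [/\ vn_isomorphic ipT (vn_gen ipT QP) (ht_dot T') crossed_End,
      vn_isomorphic (ht_dot T') crossed_End ipT (vn_gen ipT QU) &
      vn_isomorphic ipT (vn_gen ipT QP) ipT (vn_gen ipT QU)].
Proof.
have iso := crossed_iso.
split; first by rewrite QP_E.
  rewrite QU_E; apply: vn_isomorphic_sym iso; rewrite -QU_E.
  - split; first by apply: commutant0; exact: commutant_bops.
    by move=> c a b; exact: vn_gen_lin.
  - by move=> a b; exact: vn_gen_comp.
  - move=> a Ga; have [b Gb ab] := vn_gen_star cT QU_bop Ga.
    by rewrite (adjointE ab).
rewrite QP_E QU_E; exists id; split => //.
split => [a //|a b _ _ //|a Ga]; by exists a.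
Qed.

End AbstractTheorem.

(** * Calculus in coordinates *)

Section SmoothCalculus.
Variable R : realType.

Lemma near_eq_diff (V W : normedModType R) (f g : V -> W) x :
  (\forall y \near x, f y = g y) -> differentiable f x ->
  differentiable g x /\ 'd g x = 'd f x :> (V -> W).
Proof.
move=> fg /diff_locallyP[cf Ef].
have E : g \o shift x = cst (g x) + 'd f x +o_ 0 id.
  move/eqaddoP: Ef => Ef; apply/eqaddoP => eps eps0.
  have n0 : \forall h \near (0 : V), f (h + x) = g (h + x).
    by move: fg; rewrite (near_shift 0) subr0.
  have fgx : f x = g x by exact: nbhs_singleton fg.
  apply: filterS2 n0 (Ef _ eps0) => h E; apply: le_trans.
  rewrite -fgx le_eqVlt; apply/orP; left; apply/eqP; congr (`|_|).
  exact: (congr1 (fun t => t - (f x + 'd f x h)) (esym E)).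
have dE : 'd g x = 'd f x :> (V -> W) by exact: diff_unique.
split; last exact: dE.
apply/diff_locallyP; rewrite dE; split; [exact: cf|exact: E].
Qed.

Lemma near_eq_jacobian n p (f g : 'rV[R]_n -> 'rV[R]_p) x :
  (\forall y \near x, f y = g y) -> differentiable f x -> jacobian g x = jacobian f x.
Proof.
move=> fg df; have [_ E] := @near_eq_diff 'rV[R]_n 'rV[R]_p f g x fg df.
by rewrite /jacobian; apply: (congr1 (fun t => lin1_mx t)); exact: E.
Qed.

Lemma mul_jacobian n p (f : 'rV[R]_n -> 'rV[R]_p) x (v : 'rV[R]_n) :
  v *m jacobian f x = 'd f x v.
Proof. by rewrite /jacobian mul_rV_lin1. Qed.

Lemma jacobian_comp n p q (f : 'rV[R]_n -> 'rV[R]_p) (g : 'rV[R]_p -> 'rV[R]_q) h x :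
  differentiable f x -> differentiable g (f x) -> (\forall y \near x, g (f y) = h y) ->
  jacobian h x = jacobian f x *m jacobian g (f x).
Proof.
move=> df dg gfh; have dgf : differentiable (g \o f) x by exact: differentiable_comp.
rewrite (near_eq_jacobian gfh dgf); apply/row_matrixP => i.
rewrite !rowE mulmxA !mul_jacobian.
exact: (congr1 (fun t => t (delta_mx 0 i)) (diff_comp df dg)).
Qed.

Lemma jacobian_id n (x : 'rV[R]_n) : jacobian id x = 1%:M.
Proof.
apply/row_matrixP => i; rewrite !rowE mulmx1 mul_jacobian.
have c : continuous (idfun : {linear 'rV[R]_n -> 'rV[R]_n}) by move=> y; exact: cvg_id.
exact: (congr1 (fun t => t (delta_mx 0 i)) (diff_lin x c)).
Qed.

Lemma rV_sum_delta n p (f : 'rV[R]_n -> 'rV[R]_p) :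
  f = \sum_(j < p) (fun u => f u 0 j *: delta_mx 0 j).
Proof.
by apply/funext => u; rewrite {1}[f u]row_sum_delta fct_sumE.
Qed.

Lemma differentiable_rV n p (f : 'rV[R]_n -> 'rV[R]_p) x :
  (forall j, differentiable (fun u => f u 0 j : R^o) x) -> differentiable f x.
Proof.
move=> H; rewrite (rV_sum_delta f); apply: differentiable_sum => j.
exact: differentiableZl.
Qed.

Lemma continuous_rV (T : topologicalType) p (f : T -> 'rV[R]_p) x :
  (forall j, {for x, continuous (fun u => f u 0 j : R^o)}) -> {for x, continuous f}.
Proof.
move=> H; rewrite (_ : f = fun u => \sum_(j < p) f u 0 j *: delta_mx 0 j); last first.
  by apply/funext => u; rewrite -row_sum_delta.
elim: (index_enum _) => [|j r IHr].
  rewrite (_ : (fun u => _) = fun=> 0); first exact: cst_continuous.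
  by apply/funext => u; rewrite big_nil.
rewrite (_ : (fun u => _) = fun u => f u 0 j *: delta_mx 0 j + \sum_(i <- r) f u 0 i *: delta_mx 0 i).
  by apply: cvgD; [apply: cvgZr_tmp; exact: H|exact: IHr].
by apply/funext => u; rewrite big_cons.
Qed.

Section Ck.
Variable n : nat.
Implicit Types (O : set 'rV[R]_n) (f g : 'rV[R]_n -> R^o).

Lemma Ck_sub k O O' f : O' `<=` O -> Ck k O f -> Ck k O' f.
Proof.
elim: k f => [|k IHk] f OO /=; first by move=> H x /OO/H.
by move=> [df Df]; split=> [x /OO/df//|i]; exact: IHk.
Qed.

Lemma Ck_local k O f : (forall x, O x -> exists2 O', O' x & Ck k O' f) -> Ck k O f.
Proof.
elim: k f => [|k IHk] f H /=; first by move=> x /H[Q Qx]; apply.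
split; first by move=> x /H[Q Qx [df _]]; exact: df.
by move=> i; apply: IHk => x /H[Q Qx [_ Df]]; exists Q => //; exact: Df.
Qed.

Lemma Ck_weak k O f : Ck k.+1 O f -> Ck k O f.
Proof.
elim: k f => [|k IHk] f; first by move=> [df _] x /df; exact: differentiable_continuous.
by move=> [df Df]; split => // i; apply: IHk; exact: Df.
Qed.

Lemma near_open O (P : 'rV[R]_n -> Prop) x : open O -> O x -> (forall u, O u -> P u) ->
  \forall u \near x, P u.
Proof.
by move=> oO Ox H; have : nbhs x O by [exact: open_nbhs_nbhs]; apply: filterS.
Qed.

Lemma Ck_eq k O f g : open O -> (forall u, O u -> f u = g u) -> Ck k O f -> Ck k O g.
Proof.
move=> oO; elim: k f g => [|k IHk] f g fg /=.
  move=> cf x Ox; have n1 : \forall u \near x, f u = g u by exact: near_open oO Ox fg.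
  have cfx : f @ x --> g x by rewrite -(fg _ Ox); exact: cf.
  by apply: cvg_trans cfx; exact: near_eq_cvg n1.
move=> [df Df]; split=> [x Ox|i].
  have n1 : \forall u \near x, f u = g u by exact: near_open oO Ox fg.
  by have [] := @near_eq_diff 'rV[R]_n R^o f g x n1 (df _ Ox).
apply: IHk (Df i) => x Ox; apply: near_eq_derive; exact: near_open oO Ox fg.
Qed.

Lemma Ck_cst k O (c : R) : Ck k O (fun=> c).
Proof.
elim: k c => [|k IHk] c /=; first by move=> x _; exact: cst_continuous.
split=> [x _|i]; first exact: differentiable_cst.
have -> : 'D_(delta_mx 0 i) (fun=> c : R^o) = (fun=> 0) :> ('rV[R]_n -> R^o).
  by apply/funext => x; exact: derive_cst.
exact: IHk.
Qed.

Lemma Ck_add k O f g : open O -> Ck k O f -> Ck k O g -> Ck k O (fun u => f u + g u).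
Proof.
move=> oO; elim: k f g => [|k IHk] f g /=.
  by move=> cf cg x Ox; exact: (@continuousD _ R^o _ f g x (cf x Ox) (cg x Ox)).
move=> [df Df] [dg Dg]; split=> [x Ox|i].
  exact: (@differentiableD _ 'rV[R]_n R^o f g x (df _ Ox) (dg _ Ox)).
apply: Ck_eq oO _ (IHk _ _ (Df i) (Dg i)) => x Ox.
have := @deriveD _ 'rV[R]_n R^o f g x (delta_mx 0 i).
by move=> -> //; apply: diff_derivable; [exact: df|exact: dg].
Qed.

Lemma Ck_mul k O f g : open O -> Ck k O f -> Ck k O g -> Ck k O (fun u => f u * g u).
Proof.
move=> oO; elim: k f g => [|k IHk] f g.
  by move=> cf cg x Ox; exact: (@continuousM _ _ f g x (cf x Ox) (cg x Ox)).
move=> Cf Cg; have [df Df] := Cf; have [dg Dg] := Cg; split=> [x Ox|i].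
  exact: (@differentiableM _ 'rV[R]_n f g x (df _ Ox) (dg _ Ox)).
have H1 := IHk _ _ (Ck_weak Cf) (Dg i); have H2 := IHk _ _ (Ck_weak Cg) (Df i).
apply: Ck_eq oO _ (Ck_add oO H1 H2) => x Ox.
have := @deriveM _ 'rV[R]_n f g x (delta_mx 0 i).
by move=> -> //; apply: diff_derivable; [exact: df|exact: dg].
Qed.

Lemma Ck_sum k O I (r : seq I) (F : I -> 'rV[R]_n -> R^o) : open O ->
  (forall i, Ck k O (F i)) -> Ck k O (fun u => \sum_(i <- r) F i u).
Proof.
move=> oO CF; elim: r => [|i r IHr].
  rewrite (_ : (fun u => _) = fun=> 0); first exact: Ck_cst.
  by apply/funext => u; rewrite big_nil.
rewrite (_ : (fun u => _) = fun u => F i u + \sum_(j <- r) F j u); first exact: Ck_add.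
by apply/funext => u; rewrite big_cons.
Qed.

Lemma Ck_coord k O j : Ck k O (fun u : 'rV[R]_n => u 0 j).
Proof.
case: k => [|k]; first by move=> x _; exact: coord_continuous.
split=> [x _|i]; first exact: differentiable_coord.
pose f : 'rV[R]_n -> R^o := fun u => u 0 j.
have lf : linear f by move=> c u v; rewrite /f !mxE.
pose fl : {linear 'rV[R]_n -> R^o} := HB.pack f (GRing.isLinear.Build _ _ _ _ f lf).
have cf : continuous fl by move=> x; exact: coord_continuous.
have -> : 'D_(delta_mx 0 i) (fun u : 'rV[R]_n => u 0 j : R^o) = fun=> f (delta_mx 0 i).
  apply/funext => x; rewrite deriveE; last exact: differentiable_coord.
  exact: (congr1 (fun t => t (delta_mx 0 i)) (diff_lin x cf)).
exact: Ck_cst.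
Qed.

End Ck.

Lemma Ck_differentiable n k O (f : 'rV[R]_n -> R^o) x : Ck k.+1 O f -> O x -> differentiable f x.
Proof. by move=> [df _]; exact: df. Qed.

Lemma derive_comp n p (f : 'rV[R]_p -> R^o) (g : 'rV[R]_n -> 'rV[R]_p) x v :
  differentiable g x -> differentiable f (g x) ->
  'D_v (f \o g) x = \sum_j 'D_(delta_mx 0 j) f (g x) * 'D_v (fun u => g u 0 j) x.
Proof.
move=> dg df.
have dgj j : differentiable (fun u => g u 0 j : R^o) x.
  apply: (@differentiable_comp _ _ _ _ g (fun u : 'rV[R]_p => u 0 j : R^o)) => //.
  exact: differentiable_coord.
rewrite deriveE; last exact: differentiable_comp.
rewrite (congr1 (fun t => t v) (diff_comp dg df)) /= [in LHS](row_sum_delta ('d g x v)).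
rewrite linear_sum; apply: eq_bigr => j _.
rewrite linearZ /= (deriveE _ df) (deriveE _ (dgj j)) mulrC; congr (_ * _).
have cj : differentiable (fun u : 'rV[R]_p => u 0 j : R^o) (g x) by exact: differentiable_coord.
rewrite (congr1 (fun t => t v) (diff_comp dg cj)) /=.
pose h : 'rV[R]_p -> R^o := fun u => u 0 j.
have lh : linear h by move=> c u w; rewrite /h !mxE.
pose hl : {linear 'rV[R]_p -> R^o} := HB.pack h (GRing.isLinear.Build _ _ _ _ h lh).
have ch : continuous hl by move=> y; exact: coord_continuous.
by have := congr1 (fun t => t ('d g x v)) (diff_lin (g x) ch) => /= ->.
Qed.

Lemma smooth_differentiable n p O (f : 'rV[R]_n -> 'rV[R]_p) x :
  smooth_on O f -> O x -> differentiable f x.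
Proof.
by move=> sf Ox; apply: differentiable_rV => j; apply: Ck_differentiable (sf 1%N j) Ox.
Qed.

Lemma Ck_comp n p k O O' (g : 'rV[R]_n -> 'rV[R]_p) (f : 'rV[R]_p -> R^o) : open O ->
  (forall j, Ck k O (fun u => g u 0 j)) -> (forall u, O u -> O' (g u)) -> Ck k O' f ->
  Ck k O (fun u => f (g u)).
Proof.
move=> oO; elim: k f => [|k IHk] f Cg gO.
  move=> cf x Ox; apply: continuous_comp; last exact/cf/gO.
  by apply: continuous_rV => j; exact: Cg.
move=> Cf; have [df Df] := Cf.
have dg x : O x -> differentiable g x.
  by move=> Ox; apply: differentiable_rV => j; exact: Ck_differentiable (Cg j) Ox.
split=> [x Ox|i].
  by apply: (@differentiable_comp _ _ _ _ g f); [exact: dg|exact/df/gO].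
apply: (@Ck_eq _ _ _ (fun u => \sum_j 'D_(delta_mx 0 j) f (g u) * 'D_(delta_mx 0 i) (fun u => g u 0 j) u)) => //.
  by move=> x Ox; rewrite -derive_comp //; [exact: dg|exact/df/gO].
apply: Ck_sum => // j; apply: Ck_mul => //; last by have [_] := Cg j; exact.
exact: (IHk ('D_(delta_mx 0 j) f) (fun l => Ck_weak (Cg l)) gO (Df j)).
Qed.

Lemma smooth_on_comp n p q O O' (g : 'rV[R]_n -> 'rV[R]_p) (f : 'rV[R]_p -> 'rV[R]_q) :
  open O -> smooth_on O g -> (forall u, O u -> O' (g u)) -> smooth_on O' f ->
  smooth_on O (f \o g).
Proof.
move=> oO sg gO sf k j.
exact: (@Ck_comp _ _ k O O' g (fun u => f u 0 j) oO (sg k) gO (sf k j)).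
Qed.

Lemma smooth_on_eq n p O (f g : 'rV[R]_n -> 'rV[R]_p) : open O ->
  (forall u, O u -> f u = g u) -> smooth_on O f -> smooth_on O g.
Proof. by move=> oO fg sf k j; apply: Ck_eq (sf k j) => // u /fg->. Qed.

Lemma smooth_on_sub n p O O' (f : 'rV[R]_n -> 'rV[R]_p) : O' `<=` O ->
  smooth_on O f -> smooth_on O' f.
Proof. by move=> OO sf k j; exact: Ck_sub (sf k j). Qed.

Lemma smooth_on_local n p O (f : 'rV[R]_n -> 'rV[R]_p) :
  (forall x, O x -> exists2 O', O' x & smooth_on O' f) -> smooth_on O f.
Proof. by move=> H k j; apply: Ck_local => x /H[Q Qx sf]; exists Q. Qed.

End SmoothCalculus.

(** * Smooth maps and their differentials *)

Arguments atlas {R n} _ _.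

Section Manifolds.
Variable R : realType.

Section Charts.
Variables (n : nat) (X : manifold R n).
Implicit Types (c : chart R X n) (x : X).

Lemma chart_open c (W : set X) : is_chart c -> open W -> open (cmap c @` (cdom c `&` W)).
Proof.
move=> [od or cK cc ci] oW; rewrite openE => u [x [dx Wx] <-]; rewrite /interior.
have rx : cran c (cmap c x) by exists x.
have nW : nbhs (cinv c (cmap c x)) (W `&` cdom c).
  by rewrite cK //; apply: open_nbhs_nbhs; split; [exact: openI|].
have n1 : nbhs (cmap c x) (cinv c @^-1` (W `&` cdom c)) := ci _ rx _ nW.
have n2 : nbhs (cmap c x) (cran c) by exact: open_nbhs_nbhs.
apply: filterS (filterI n1 n2) => v [[/= Wv dv] [y dy yv]].
by exists y => //; split => //; rewrite -yv cK // in Wv.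
Qed.

Lemma chart_preimage c (O : set 'rV[R]_n) : is_chart c -> open O -> open (cdom c `&` cmap c @^-1` O).
Proof.
move=> [od or cK cc ci] oO; rewrite openE => x [dx Ox]; rewrite /interior.
have n1 : nbhs x (cmap c @^-1` O) := cc _ dx _ (open_nbhs_nbhs (conj oO Ox)).
have n2 : nbhs x (cdom c) by exact: open_nbhs_nbhs.
by apply: filterS (filterI n1 n2) => y [].
Qed.

Lemma chart_at_chart x : is_chart (chart_at x).
Proof. exact/atlas_chart/chart_at_atlas. Qed.

Lemma chart_cmapK c x : is_chart c -> cdom c x -> cinv c (cmap c x) = x.
Proof. by move=> [_ _ cK _ _]; exact: cK. Qed.

End Charts.

Lemma smooth_mapP n p (X : manifold R n) (Y : manifold R p) (f : X -> Y) : continuous f ->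
  (forall x, exists c c' O, [/\ atlas X c, atlas Y c', cdom c x & cdom c' (f x)] /\
     [/\ open O, O (cmap c x) & smooth_on O (cmap c' \o f \o cinv c)]) -> smooth_map f.
Proof.
move=> cf H; split => // a a' Aa Aa'.
have Ca := atlas_chart Aa; have Ca' := atlas_chart Aa'.
apply: smooth_on_local => _ [x [ax a'fx] <-].
have [c [c' [ O [[Ac Ac' cx c'fx] [oO Ox sO]]]]] := H x.
have Cc := atlas_chart Ac; have Cc' := atlas_chart Ac'.
pose W := (cdom c `&` cmap c @^-1` O) `&` f @^-1` (cdom c' `&` cdom a').
have oW : open W.
  apply: openI; first exact: chart_preimage.
  by apply: open_comp => [y _|]; [exact: cf|apply: openI; [case: Cc'|case: Ca']].
exists (cmap a @` (cdom a `&` W)); first by exists x.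
have oW' := chart_open Ca oW.
have s1 : smooth_on (cmap a @` (cdom a `&` W)) (cmap c \o cinv a).
  apply: smooth_on_sub (atlas_smooth Aa Ac) => _ [y [ay [[cy _] _]] <-].
  by exists y.
have s2 : smooth_on (cmap a @` (cdom a `&` W)) (cmap c' \o f \o cinv c \o (cmap c \o cinv a)).
  apply: (@smooth_on_comp _ _ _ _ _ O _ _ oW' s1) sO => _ [y [ay [[cy Oy] _]] <-] /=.
  by rewrite (chart_cmapK Ca).
have s3 := @smooth_on_comp _ _ _ _ _ (cmap c' @` (cdom c' `&` cdom a')) _ _ oW' s2 _ (atlas_smooth Ac' Aa').
apply: smooth_on_eq (s3 _) => //.
  move=> _ [y [ay [[cy Oy] [c'y a'y]]] <-] /=.
  by rewrite (chart_cmapK Ca) // (chart_cmapK Cc) // (chart_cmapK Cc').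
move=> _ [y [ay [[cy Oy] [c'y a'y]]] <-] /=.
by rewrite (chart_cmapK Ca) // (chart_cmapK Cc) //; exists (f y).
Qed.

Lemma smooth_map_differentiable n p (X : manifold R n) (Y : manifold R p) (f : X -> Y) c c' x :
  smooth_map f -> atlas X c -> atlas Y c' -> cdom c x -> cdom c' (f x) ->
  differentiable (cmap c' \o f \o cinv c) (cmap c x).
Proof.
move=> [_ sf] Ac Ac' cx c'x; apply: (smooth_differentiable (sf _ _ Ac Ac')).
by exists x.
Qed.

Lemma smooth_map_id n (X : manifold R n) : smooth_map (@id X).
Proof.
split; first by move=> x; exact: cvg_id.
by move=> c c' Ac Ac'; exact: (atlas_smooth Ac Ac').
Qed.

Definition chart_jacobian n p (X : manifold R n) (Y : manifold R p) (f : X -> Y)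
    (c : chart R X n) (c' : chart R Y p) (x : X) : 'M[R]_(n, p) :=
  jacobian (cmap c' \o f \o cinv c) (cmap c x).

Lemma chart_jacobian_comp n p q (X : manifold R n) (Y : manifold R p) (Z : manifold R q)
    (f : X -> Y) (g : Y -> Z) a b c x :
  smooth_map f -> smooth_map g -> atlas X a -> atlas Y b -> atlas Z c ->
  cdom a x -> cdom b (f x) -> cdom c (g (f x)) ->
  chart_jacobian (g \o f) a c x = chart_jacobian f a b x *m chart_jacobian g b c (f x).
Proof.
move=> sf sg Aa Ab Ac ax bx cx.
have Ca := atlas_chart Aa; have Cb := atlas_chart Ab.
have df := smooth_map_differentiable sf Aa Ab ax bx.
have dg := smooth_map_differentiable sg Ab Ac bx cx.
have E : (cmap b \o f \o cinv a) (cmap a x) = cmap b (f x) by rewrite /= (chart_cmapK Ca).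
rewrite /chart_jacobian -E; apply: jacobian_comp => //; first by rewrite E.
have oW : open (f @^-1` cdom b).
  by apply: open_comp => [y _|]; [exact: sf.1|case: Cb].
have := chart_open Ca oW => oO.
apply: (near_open oO); first by exists x.
by move=> _ [y [ay by_] <-] /=; rewrite (chart_cmapK Ca) // (chart_cmapK Cb).
Qed.

Lemma chart_jacobian_id n (X : manifold R n) (c : chart R X n) x :
  atlas X c -> cdom c x -> chart_jacobian id c c x = 1%:M.
Proof.
move=> Ac cx; have Cc := atlas_chart Ac; rewrite /chart_jacobian -[RHS](jacobian_id (cmap c x)).
have oO : open (cran c) by case: Cc.
apply/esym/near_eq_jacobian.
  apply: (near_open oO); first by exists x.
  by move=> _ [y cy <-] /=; rewrite (chart_cmapK Cc).
exact: (smooth_map_differentiable (@smooth_map_id n X) Ac Ac cx cx).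
Qed.

Lemma tangent_comp n p q (X : manifold R n) (Y : manifold R p) (Z : manifold R q)
    (f : X -> Y) (g : Y -> Z) x : smooth_map f -> smooth_map g ->
  tangent (g \o f) x = tangent f x *m tangent g (f x).
Proof.
move=> sf sg; apply: (@chart_jacobian_comp _ _ _ _ _ _ f g (chart_at x) (chart_at (f x)) (chart_at (g (f x))) x) => //;
  by [exact: chart_at_atlas|exact: chart_at_dom].
Qed.

Lemma tangent_id n (X : manifold R n) (x : X) : tangent id x = 1%:M.
Proof.
exact: (@chart_jacobian_id n X (chart_at x) x (chart_at_atlas x) (chart_at_dom x)).
Qed.

Lemma tangent_chart_comp n p (X : manifold R n) (Y : manifold R p) (f : X -> Y) c c' x :
  smooth_map f -> atlas X c -> atlas Y c' -> cdom c x -> cdom c' (f x) ->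
  chart_jacobian f c c' x *m tangent_chart c' (f x) = tangent_chart c x *m tangent f x.
Proof.
move=> sf Ac Ac' cx c'x.
have H1 := @chart_jacobian_comp _ _ _ _ _ _ f id c c' (chart_at (f x)) x sf (@smooth_map_id _ Y)
  Ac Ac' (chart_at_atlas _) cx c'x (chart_at_dom _).
have H2 := @chart_jacobian_comp _ _ _ _ _ _ id f c (chart_at x) (chart_at (f x)) x (@smooth_map_id _ X) sf
  Ac (chart_at_atlas _) (chart_at_atlas _) cx (chart_at_dom _) (chart_at_dom _).
exact: etrans (esym H1) H2.
Qed.

Lemma tangent_chart_unit n (X : manifold R n) (c : chart R X n) x : atlas X c -> cdom c x ->
  tangent_chart c x \in unitmx.
Proof.
move=> Ac cx.
have H := @chart_jacobian_comp _ _ _ _ _ _ id id c (chart_at x) c x (@smooth_map_id _ X) (@smooth_map_id _ X)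
  Ac (chart_at_atlas _) Ac cx (chart_at_dom _) cx.
have H1 : tangent_chart c x *m chart_jacobian id (chart_at x) c x = 1%:M.
  exact: etrans (esym H) (chart_jacobian_id Ac cx).
have [H2 _] := mulmx1_unit H1; exact: H2.
Qed.

Section Diffeomorphism.
Variables (n : nat) (X : manifold R n) (f g : X -> X).
Hypotheses (sf : smooth_map f) (sg : smooth_map g) (fK : cancel f g) (gK : cancel g f).

Definition pull_chart (c : chart R X n) : chart R X n :=
  {| cdom := f @^-1` cdom c; cmap := cmap c \o f; cinv := g \o cinv c |}.

Lemma pull_chart_ran c : cran (pull_chart c) = cran c.
Proof.
apply/seteqP; split => [_ [x /= fx <-]|_ [x cx <-]]; first by exists (f x).
by exists (g x); rewrite /= gK.
Qed.

Lemma pull_chart_atlas c : atlas X c -> atlas X (pull_chart c).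
Proof.
move=> Ac; have Cc := atlas_chart Ac; have [od or cK cc ci] := Cc.
have tr (a b : chart R X n) : atlas X a -> atlas X b ->
    cmap (pull_chart a) @` (cdom (pull_chart a) `&` cdom b) = cmap a @` (cdom a `&` g @^-1` cdom b).
  move=> Aa Ab; apply/seteqP; split => [_ [x [/= fx bx] <-]|_ [x [ax bx] <-]].
    by exists (f x) => //; split => //=; rewrite fK.
  by exists (g x) => /=; rewrite gK.
apply: atlas_max.
  split => /=.
  - by apply: open_comp => // y _; exact: sf.1.
  - by rewrite -/(pull_chart c) pull_chart_ran.
  - by move=> x fx; rewrite cK // fK.
  - by move=> x fx; apply: continuous_comp; [exact: sf.1|exact: cc].
  - move=> u; rewrite -/(pull_chart c) pull_chart_ran => ru.
    by apply: continuous_comp; [exact: ci|exact: sg.1].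
move=> c' Ac'; split.
  rewrite /smooth_transition tr //.
  exact: sg.2 _ _ Ac Ac'.
exact: sf.2 _ _ Ac' Ac.
Qed.

Lemma tangent_pull_chart c x : atlas X c -> cdom c (f x) ->
  tangent_chart (pull_chart c) x *m tangent f x = tangent_chart c (f x).
Proof.
move=> Ac cx.
rewrite -(tangent_chart_comp (c := pull_chart c) (c' := c)) //; last exact: pull_chart_atlas.
suff -> : chart_jacobian f (pull_chart c) c x = 1%:M by rewrite mul1mx.
rewrite /chart_jacobian /= -[RHS](jacobian_id (cmap c (f x))).
have oO : open (cran c) by have [] := atlas_chart Ac.
have Ap := pull_chart_atlas Ac.
apply/esym/near_eq_jacobian.
  apply: (near_open oO); first by exists (f x).
  by move=> _ [y cy <-] /=; rewrite gK (chart_cmapK (atlas_chart Ac)).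
exact: (smooth_map_differentiable (c := pull_chart c) sf Ap Ac cx cx).
Qed.

End Diffeomorphism.

End Manifolds.

(** * Isometries of a power of a manifold *)

Section PowerMaps.
Variable R : realType.

Record isometry_pair n (Y : riemannian R n) (f g : Y -> Y) : Prop := IsometryPair {
  iso_smooth : smooth_map f;
  iso_smoothV : smooth_map g;
  iso_fK : cancel f g;
  iso_gK : cancel g f;
  iso_metric : forall y, metric y = tangent f y *m metric (f y) *m (tangent f y)^T }.

Lemma near_eq_continuous (T U : topologicalType) (f g : T -> U) x :
  (\forall y \near x, f y = g y) -> {for x, continuous f} -> {for x, continuous g}.
Proof.
move=> fg cf; have fgx : f x = g x by exact: nbhs_singleton fg.
have cfx : f @ x --> g x by rewrite -fgx; exact: cf.
by apply: cvg_trans cfx; exact: near_eq_cvg fg.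
Qed.

Variables (n : nat) (X : riemannian R n) (N : nat) (XN : riem_power X N).

Definition power_chart (c : 'I_N -> chart R X n) : chart R XN (N * n) :=
  prod_chart (@pr R n X N XN) (@tup R n X N XN) c.

Arguments power_chart : simpl never.

Lemma power_chartE c y i j : cmap (power_chart c) y 0 (mxvec_index i j) = cmap (c i) (pr i y) 0 j.
Proof. by rewrite mxvecE mxE. Qed.

Lemma power_chart_atlas c : (forall i, atlas X (c i)) -> atlas XN (power_chart c).
Proof. exact: power_atlas. Qed.

Lemma power_chart_row c i y : row i (vec_mx (cmap (power_chart c) y)) = cmap (c i) (pr i y).
Proof. by rewrite mxvecK; apply/rowP => j; rewrite !mxE. Qed.

Lemma pr_power_cinv c i u : pr i (cinv (power_chart c) u) = cinv (c i) (row i (vec_mx u)).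
Proof. exact: pr_tup. Qed.

Definition block (i : 'I_N) (u : 'rV[R]_(N * n)) : 'rV[R]_n := row i (vec_mx u).

Lemma blockE i u j : block i u 0 j = u 0 (mxvec_index i j).
Proof. by rewrite !mxE. Qed.

Lemma block_continuous i : continuous (block i).
Proof.
move=> u; apply: continuous_rV => j.
have -> : (fun u => block i u 0 j : R^o) = (fun u => u 0 (mxvec_index i j)).
  by apply/funext => v; exact: blockE.
exact: coord_continuous.
Qed.

Lemma block_smooth O i : smooth_on O (block i).
Proof.
move=> k j; have -> : (fun u => block i u 0 j) = (fun u => u 0 (mxvec_index i j)).
  by apply/funext => v; exact: blockE.
exact: Ck_coord.
Qed.

Lemma pr_continuous i : continuous (@pr R n X N XN i).
Proof.
move=> y; pose c j := chart_at (pr j y).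
have Ac j : atlas X (c j) by exact: chart_at_atlas.
have [od or cK cc ci] := atlas_chart (power_chart_atlas Ac).
have cy : cdom (power_chart c) y by move=> j; exact: chart_at_dom.
apply: (@near_eq_continuous _ _ (cinv (c i) \o block i \o cmap (power_chart c))).
  have : nbhs y (cdom (power_chart c)) by exact: open_nbhs_nbhs.
  by apply: filterS => z cz; rewrite /= -{2}(cK _ cz) pr_power_cinv.
apply: continuous_comp; first exact: cc.
apply: continuous_comp; first exact: block_continuous.
rewrite /block power_chart_row; have [_ _ _ _ cic] := atlas_chart (Ac i).
by apply: cic; exists (pr i y) => //; exact: chart_at_dom.
Qed.

Lemma pr_smooth i : smooth_map (@pr R n X N XN i).
Proof.
apply: smooth_mapP; first exact: pr_continuous.
move=> y; pose c j := chart_at (pr j y).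
have Ac j : atlas X (c j) by exact: chart_at_atlas.
have Apc := power_chart_atlas Ac.
have [od or cK cc ci] := atlas_chart Apc.
have cy : cdom (power_chart c) y by move=> j; exact: chart_at_dom.
exists (power_chart c), (c i), (cran (power_chart c)); split; first by split => //; exact: chart_at_dom.
split => //; first by exists y.
apply: smooth_on_eq (@block_smooth (cran (power_chart c)) i) => //.
move=> _ [z cz <-]; rewrite /block power_chart_row.
by rewrite -[RHS]/(cmap (c i) (pr i (cinv (power_chart c) (cmap (power_chart c) z)))) (cK z cz).
Qed.

Definition power_map (h : 'I_N -> X -> X) (s : 'S_N) (y : XN) : XN :=
  tup XN (fun i => h i (pr (s i) y)).

Lemma pr_power_map h s i y : pr i (power_map h s y) = h i (pr (s i) y).
Proof. exact: pr_tup. Qed.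

Lemma power_ext (y z : XN) : (forall i, pr i y = pr i z) -> y = z.
Proof.
move=> E; rewrite -[y]tup_pr -[z]tup_pr; congr (tup _ _).
by apply/funext => i; exact: E.
Qed.

Section Smooth.
Variables (h : 'I_N -> X -> X) (s : 'S_N).
Hypothesis sh : forall i, smooth_map (h i).

Let pr_cont i (y : XN) : {for y, continuous (fun z : XN => h i (pr (s i) z))}.
Proof. by apply: continuous_comp; [exact: pr_continuous|exact: (sh i).1]. Qed.

Lemma power_map_continuous : continuous (power_map h s).
Proof.
move=> y; pose d i := chart_at (h i (pr (s i) y)).
have Ad j : atlas X (d j) by exact: chart_at_atlas.
have [od or cK cc ci] := atlas_chart (power_chart_atlas Ad).
have dy : cdom (power_chart d) (power_map h s y).
  by move=> j; rewrite pr_power_map; exact: chart_at_dom.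
apply: (@near_eq_continuous _ _ (cinv (power_chart d) \o (cmap (power_chart d) \o power_map h s))).
  pose A (i : 'I_N) : set XN := [set z | cdom (d i) (h i (pr (s i) z))].
  have nA i : nbhs y (A i).
    apply: (pr_cont (i := i) (y := y)); apply: open_nbhs_nbhs; split; last exact: chart_at_dom.
    by have [] := atlas_chart (Ad i).
  have nA' : nbhs y [set z | forall i, A i z] := filter_forall (nbhs_filter y) nA.
  by apply: filterS nA' => z Hz; apply: (cK (power_map h s z)) => i; rewrite pr_power_map; exact: Hz.
apply: continuous_comp; last by apply: ci; exists (power_map h s y).
apply: continuous_rV => k; case/mxvec_indexP: k => i j.
have -> : (fun z => (cmap (power_chart d) \o power_map h s) z 0 (mxvec_index i j) : R^o) =
    (fun u : 'rV[R]_n => u 0 j : R^o) \o (cmap (d i) \o (fun z : XN => h i (pr (s i) z))).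
  by apply/funext => z; rewrite /= power_chartE pr_power_map.
apply: continuous_comp; last exact: coord_continuous.
apply: continuous_comp; first exact: pr_cont.
have [_ _ _ cic _] := atlas_chart (Ad i).
by apply: cic; exact: chart_at_dom.
Qed.

Lemma power_map_smooth : smooth_map (power_map h s).
Proof.
apply: smooth_mapP; first exact: power_map_continuous.
move=> y; pose c j := chart_at (pr j y); pose d i := chart_at (h i (pr (s i) y)).
have Ac j : atlas X (c j) by exact: chart_at_atlas.
have Ad j : atlas X (d j) by exact: chart_at_atlas.
have Apc := power_chart_atlas Ac; have Apd := power_chart_atlas Ad.
have Cpc := atlas_chart Apc; have Cpd := atlas_chart Apd.
have cy : cdom (power_chart c) y by move=> j; exact: chart_at_dom.
have dy : cdom (power_chart d) (power_map h s y).
  by move=> j; rewrite pr_power_map; exact: chart_at_dom.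
pose O := cmap (power_chart c) @` (cdom (power_chart c) `&` power_map h s @^-1` cdom (power_chart d)).
have oO : open O.
  apply: chart_open => //; apply: open_comp => [z _|]; first exact: power_map_continuous.
  by case: Cpd.
exists (power_chart c), (power_chart d), O; split => //; split => //; first by exists y.
move=> k l; case/mxvec_indexP: l => i j.
have -> : (fun u => (cmap (power_chart d) \o power_map h s \o cinv (power_chart c)) u 0 (mxvec_index i j)) =
    (fun u => ((cmap (d i) \o h i \o cinv (c (s i))) \o block (s i)) u 0 j).
  by apply/funext => u; rewrite /= power_chartE pr_power_map pr_power_cinv.
apply: (@smooth_on_comp _ _ _ _ _ _ _ _ oO (@block_smooth _ _) _ ((sh i).2 _ _ (Ac (s i)) (Ad i))).
move=> _ [z [cz dz] <-]; rewrite /block power_chart_row.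
exists (pr (s i) z) => //; split; first exact: cz.
by have := dz i; rewrite pr_power_map.
Qed.

End Smooth.

Lemma tangent_power_map h s y i : (forall i, smooth_map (h i)) ->
  tangent (power_map h s) y *m tangent (@pr R n X N XN i) (power_map h s y) =
  tangent (@pr R n X N XN (s i)) y *m tangent (h i) (pr (s i) y).
Proof.
move=> sh; rewrite -tangent_comp; [|exact: power_map_smooth|exact: pr_smooth].
rewrite -(tangent_comp _ (pr_smooth (s i)) (sh i)); congr (tangent _ _).
by apply/funext => z; rewrite /= pr_power_map.
Qed.

Lemma congruence_transfer (F : comPzRingType) p q r (T : 'M[F]_(p, q)) (P' : 'M[F]_(q, r)) (P : 'M[F]_(p, r)) (H M : 'M[F]_r) :
  T *m P' = P *m H ->
  P *m (H *m M *m H^T) *m P^T = T *m (P' *m M *m P'^T) *m T^T.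
Proof.
move=> E; have -> : T *m (P' *m M *m P'^T) *m T^T = (T *m P') *m M *m (T *m P')^T.
  by rewrite trmx_mul !mulmxA.
by rewrite E trmx_mul !mulmxA.
Qed.

Lemma power_map_isometry (h k : 'I_N -> X -> X) s : (forall i, isometry_pair (h i) (k i)) ->
  isometry_pair (power_map h s) (power_map (fun i => k (s^-1%g i)) s^-1%g).
Proof.
move=> hk; split.
- by apply: power_map_smooth => i; exact: (iso_smooth (hk i)).
- by apply: power_map_smooth => i; exact: (iso_smoothV (hk _)).
- by move=> y; apply: power_ext => i; rewrite !pr_power_map permKV (iso_fK (hk _)).
- by move=> y; apply: power_ext => i; rewrite !pr_power_map permK (iso_gK (hk _)).
move=> y; rewrite !power_metric mulmx_sumr mulmx_suml.
rewrite (reindex_inj (@perm_inj _ s)); apply: eq_bigr => i _.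
have sh j : smooth_map (h j) by exact: (iso_smooth (hk j)).
rewrite (iso_metric (hk i)) pr_power_map.
exact: congruence_transfer (tangent_power_map _ _ _ sh).
Qed.

End PowerMaps.

(** * The pointwise norm of a form *)

Section PosDef.
Variable R : realType.

Definition posdef n (M : 'M[R]_n) : Prop :=
  M^T = M /\ forall v : 'rV[R]_n, v != 0 -> 0 < (v *m M *m v^T) 0 0.

Lemma posdef_congr p n (B : 'M[R]_(p, n)) (M : 'M[R]_n) : row_free B -> posdef M ->
  posdef (B *m M *m B^T).
Proof.
move=> Bf [Ms Mp]; split; first by rewrite !trmx_mul trmxK Ms mulmxA.
move=> v v0; have vB : v *m B != 0.
  apply: contra v0 => /eqP vB; apply/eqP; apply: (row_free_inj Bf); by rewrite vB mul0mx.
have -> : v *m (B *m M *m B^T) *m v^T = (v *m B) *m M *m (v *m B)^T by rewrite trmx_mul !mulmxA.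
exact: Mp.
Qed.

(* Cholesky factorization, by Schur complements. *)
Lemma posdef_factor n (M : 'M[R]_n) : posdef M -> exists2 B, B \in unitmx & M = B *m B^T.
Proof.
elim: n M => [|n IHn] M Mpd.
  by exists 1%:M; [exact: unitmx1|apply/matrixP => -[]].
suff step (M' : 'M[R]_(1 + n)) : posdef M' -> exists2 B, B \in unitmx & M' = B *m B^T.
  exact: step Mpd.
move=> {M Mpd} Mpd.
pose a := ulsubmx M' 0 0; pose b := ursubmx M'; pose D := drsubmx M'.
have [Ms Mp] := Mpd.
have dl : dlsubmx M' = b^T by rewrite /b -{1}[M']Ms -trmx_ursub.
have ME : M' = block_mx a%:M b b^T D by rewrite -dl -[LHS]submxK [ulsubmx M']mx11_scalar.
have a0 : 0 < a.
  have := Mp (row_mx 1%:M 0 : 'rV[R]_(1 + n)).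
  rewrite ME mul_row_block !mul1mx !mul0mx !addr0 tr_row_mx mul_row_col.
  rewrite trmx1 mulmx1 trmx0 mulmx0 addr0 mxE eqxx => -> //.
  apply/eqP => /matrixP/(_ 0 (lshift n 0)); rewrite row_mxEl !mxE eqxx => /eqP.
  by rewrite oner_eq0.
pose B0 : 'M[R]_(n, 1 + n) := row_mx (- (a^-1 *: b^T)) 1%:M.
have B0f : row_free B0.
  apply/row_freeP; exists (col_mx 0 1%:M).
  by rewrite mul_row_col mulmx0 add0r mulmx1.
have := posdef_congr B0f Mpd; rewrite ME mul_row_block !mul1mx mul_mx_scalar scalerN scalerA.
rewrite divff ?gt_eqF // scale1r addNr tr_row_mx mul_row_col mul0mx add0r trmx1 mulmx1.
move=> /IHn [C Cu CE].
exists (block_mx (Num.sqrt a)%:M 0 ((Num.sqrt a)^-1 *: b^T) C).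
  by rewrite unitmxE det_lblock det_scalar1 unitrM unitfE sqrtr_eq0 -ltNge a0 -unitmxE.
have sa : Num.sqrt a != 0 by rewrite sqrtr_eq0 -ltNge.
rewrite tr_block_mx mulmx_block !trmx0 !mulmx0 !mul0mx !addr0 tr_scalar_mx -CE.
rewrite mul_scalar_mx mul_mx_scalar scale_scalar_mx -expr2 sqr_sqrtr ?ltW //.
rewrite mul_scalar_mx linearZ /= trmxK !scalerA divff // !scale1r.
rewrite -scalemxAl -scalemxAr scalerA -invfM -expr2 sqr_sqrtr ?ltW //.
by rewrite mulNmx -scalemxAl addrA addrN add0r.
Qed.

Lemma invmxM n (A B : 'M[R]_n) : A \in unitmx -> B \in unitmx -> invmx (A *m B) = invmx B *m invmx A.
Proof.
move=> Au Bu; have ABu : A *m B \in unitmx by rewrite unitmx_mul Au.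
by rewrite -[RHS]mul1mx -(mulVmx ABu) -!mulmxA mulKVmx // mulmxV // mulmx1.
Qed.

Lemma invmx_congr n (T M : 'M[R]_n) : T \in unitmx -> M \in unitmx ->
  T^T *m invmx (T *m M *m T^T) *m T = invmx M.
Proof.
move=> Tu Mu; have Tt : T^T \in unitmx by rewrite unitmx_tr.
by rewrite !invmxM ?unitmx_mul ?Tu // !mulmxA mulmxV // mul1mx -!mulmxA mulVmx // mulmx1.
Qed.

Lemma posdef_unit n (M : 'M[R]_n) : posdef M -> M \in unitmx.
Proof. by move=> /posdef_factor [B Bu ->]; rewrite unitmx_mul unitmx_tr Bu. Qed.

End PosDef.

Section Forms.
Variable R : realType.
Variables (m n : nat).
Implicit Types (f : 'M[R]_(m, n) -> R[i]) (A : 'M[R]_(m, n)).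

Local Notation "x %:C" := (real_complex R x) (at level 1, format "x %:C").

Definition set_row A (j : 'I_m) (v : 'rV[R]_n) : 'M[R]_(m, n) :=
  \matrix_(i, k) if i == j then v 0 k else A i k.

Lemma set_row_id A j : set_row A j (row j A) = A.
Proof. by apply/matrixP => i k; rewrite !mxE; case: eqP => [->|]. Qed.

Lemma row_set_row A j v : row j (set_row A j v) = v.
Proof. by apply/rowP => k; rewrite !mxE eqxx. Qed.

Lemma row'_set_row A j v : row' j (set_row A j v) = row' j A.
Proof. by apply/matrixP => i k; rewrite !mxE eq_sym (negPf (neq_lift _ _)). Qed.

Lemma alternating_set_row f A j a u v : Defs.alternating f ->
  f (set_row A j (a *: u + v)) = a%:C * f (set_row A j u) + f (set_row A j v).
Proof. by case=> H _; apply: (H j); rewrite ?row_set_row ?row'_set_row. Qed.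

Lemma alternating_row_sum f A j : Defs.alternating f ->
  f A = \sum_k (A j k)%:C * f (set_row A j (delta_mx 0 k)).
Proof.
move=> af; rewrite -{1}[A](set_row_id A j) [row j A]row_sum_delta.
have f0 : f (set_row A j 0) = 0.
  have := alternating_set_row A j 1 0 0 af; rewrite scale1r addr0 mul1r => /eqP.
  by rewrite -subr_eq subrr eq_sym => /eqP.
elim: (index_enum _) => [|k r IHr]; first by rewrite !big_nil.
by rewrite !big_cons alternating_set_row // IHr mxE.
Qed.

Lemma form_expand f A : Defs.alternating f ->
  f A = \sum_(I : {ffun 'I_m -> 'I_n}) (\prod_k A k (I k))%:C * f (frame R I).
Proof.
move=> af.
(* Induction on the number [j] of rows that are not yet basis vectors. *)
suff H j : forall A (J : {ffun 'I_m -> 'I_n}), (forall k : 'I_m, (j <= k)%N -> row k A = delta_mx 0 (J k)) ->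
    f A = \sum_(I : {ffun 'I_m -> 'I_n}) (\prod_k A k (I k))%:C * f (frame R I).
  have [J _|noJ] := pickP (fun J : {ffun 'I_m -> 'I_n} => true).
    by apply: (H m A J) => k; rewrite leqNgt ltn_ord.
  have [i mi] : exists i : 'I_m, forall x : 'I_n, False.
    case: m n A noJ {f af H} => [|m'] n' A noJ.
      by have := noJ (finfun (fun i : 'I_0 => match notF (ltn_ord i) with end)).
    by exists ord0 => x; have := noJ [ffun=> x].
  by rewrite (alternating_row_sum A i af) !big1 // => x; first [case: (mi x)|case: (mi (x i))].
elim: j => [|j IHj] {}A J AJ.
  have AE k l : A k l = (l == J k)%:R.
    by have /rowP/(_ l) := AJ k isT; rewrite !mxE eqxx.
  rewrite (bigD1 J) //= big1; last by move=> k _; rewrite AE eqxx.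
  rewrite big1 ?mul1r ?addr0.
    by congr (f _); apply/matrixP => k l; rewrite AE mxE.
  move=> I IJ; have [k Ik] : exists k, I k != J k.
    by apply/existsP; apply: contraNT IJ => /existsPn IJ; apply/eqP/ffunP => k; have := IJ k; rewrite negbK => /eqP.
  by rewrite (bigD1 k) //= AE (negPf Ik) mul0r mul0r.
have [jm|mj] := ltnP j m; last by apply: (IHj A J) => k jk; have := ltn_ord k; rewrite ltnNge (leq_trans mj).
pose j' := Ordinal jm.
rewrite (alternating_row_sum A j' af).
transitivity (\sum_k \sum_(I : {ffun 'I_m -> 'I_n})
    (A j' k)%:C * ((\prod_l set_row A j' (delta_mx 0 k) l (I l))%:C * f (frame R I))).
  apply: eq_bigr => k _; rewrite -mulr_sumr; congr (_ * _).
  apply: (IHj _ [ffun l => if l == j' then k else J l]) => l jl; rewrite ffunE.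
  have [->|lj] := eqVneq l j'; first exact: row_set_row.
  rewrite -AJ; last by rewrite ltn_neqAle jl andbT eq_sym; apply: contra lj => /eqP lj; apply/eqP/val_inj.
  by apply/rowP => x; rewrite !mxE (negPf lj).
rewrite exchange_big; apply: eq_bigr => I _ /=.
transitivity (\sum_k ((A j' k * (k == I j')%:R * \prod_(l | l != j') A l (I l))%:C * f (frame R I))).
  apply: eq_bigr => k _; rewrite mulrA -rmorphM (bigD1 j') //= !mxE !eqxx mulrA eq_sym.
  congr ((_ * _)%:C * _); apply: eq_bigr => l lj; by rewrite !mxE (negPf lj).
rewrite -mulr_suml -rmorph_sum -mulr_suml (bigD1 (I j')) //= eqxx mulr1 big1 ?addr0.
  by rewrite [in RHS](bigD1 j').
by move=> k /negPf ->; rewrite mulr0.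
Qed.

Definition herm_norm (H : 'M[R]_n) f : R[i] :=
  \sum_(I : {ffun 'I_m -> 'I_n}) \sum_(J : {ffun 'I_m -> 'I_n})
    (\prod_(k < m) H (I k) (J k))%:C * (f (frame R I) * Num.conj (f (frame R J))).

Lemma frame_mul (I : {ffun 'I_m -> 'I_n}) (B : 'M[R]_n) k l : (frame R I *m B) k l = B (I k) l.
Proof.
rewrite mxE (bigD1 (I k)) //= mxE eqxx mul1r big1 ?addr0 // => j /negPf jI.
by rewrite mxE jI mul0r.
Qed.

Lemma conj_real (x : R) : Num.conj x%:C = x%:C.
Proof. by apply/eqP; rewrite eq_complex /= oppr0 !eqxx. Qed.

Lemma form_expand_frame f (B : 'M[R]_n) (I : {ffun 'I_m -> 'I_n}) : Defs.alternating f ->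
  f (frame R I *m B) = \sum_(J : {ffun 'I_m -> 'I_n}) (\prod_k B (I k) (J k))%:C * f (frame R J).
Proof.
move=> af; rewrite (form_expand _ af); apply: eq_bigr => J _; congr (_%:C * _).
by apply: eq_bigr => k _; rewrite frame_mul.
Qed.

Lemma herm_norm_congr (H B : 'M[R]_n) f : Defs.alternating f ->
  herm_norm H (fun A => f (A *m B)) = herm_norm (B^T *m H *m B) f.
Proof.
move=> af; rewrite /herm_norm.
transitivity (\sum_(I : {ffun 'I_m -> 'I_n}) \sum_(J : {ffun 'I_m -> 'I_n})
   \sum_(I' : {ffun 'I_m -> 'I_n}) \sum_(J' : {ffun 'I_m -> 'I_n})
   (\prod_k (B (I k) (I' k) * H (I k) (J k) * B (J k) (J' k)))%:C *
     (f (frame R I') * Num.conj (f (frame R J')))).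
  apply: eq_bigr => I _; apply: eq_bigr => J _; rewrite !form_expand_frame // rmorph_sum.
  rewrite mulr_suml mulr_sumr; apply: eq_bigr => I' _.
  rewrite mulr_sumr mulr_sumr; apply: eq_bigr => J' _.
  rewrite !big_split /= !rmorphM /= conj_real; ring.
transitivity (\sum_(I' : {ffun 'I_m -> 'I_n}) \sum_(J' : {ffun 'I_m -> 'I_n})
  \sum_(I : {ffun 'I_m -> 'I_n}) \sum_(J : {ffun 'I_m -> 'I_n})
   (\prod_k (B (I k) (I' k) * H (I k) (J k) * B (J k) (J' k)))%:C *
     (f (frame R I') * Num.conj (f (frame R J')))).
  under eq_bigr => I _ do rewrite exchange_big.
  rewrite exchange_big; apply: eq_bigr => I' _ /=.
  under eq_bigr => I _ do rewrite exchange_big.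
  by rewrite exchange_big.
apply: eq_bigr => I' _; apply: eq_bigr => J' _.
under eq_bigr => I _ do rewrite -mulr_suml -rmorph_sum.
rewrite -mulr_suml -rmorph_sum; congr (_%:C * _).
under eq_bigr => I _ do rewrite -(bigA_distr_bigA (fun k j => B (I k) (I' k) * H (I k) j * B j (J' k))).
rewrite -(bigA_distr_bigA (fun k i => \sum_j B i (I' k) * H i j * B j (J' k))) /=.
apply: eq_bigr => k _; rewrite mxE exchange_big; apply: eq_bigr => j _.
by rewrite mxE mulr_suml; apply: eq_bigr => i _; rewrite mxE.
Qed.

Definition csq (z : R[i]) : R := complex.Re z ^+ 2 + complex.Im z ^+ 2.

Lemma csq_ge0 z : 0 <= csq z.
Proof. by rewrite addr_ge0 // sqr_ge0. Qed.

Lemma csqM y z : csq (y * z) = csq y * csq z.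
Proof. case: y z => [a b] [c d]; rewrite /csq /=; ring. Qed.

Lemma csqD y z : csq (y + z) <= 2 * csq y + 2 * csq z.
Proof.
case: y z => [a b] [c d]; rewrite /csq /= -subr_ge0.
have -> : 2 * (a ^+ 2 + b ^+ 2) + 2 * (c ^+ 2 + d ^+ 2) - ((a + c) ^+ 2 + (b + d) ^+ 2) =
  (a - c) ^+ 2 + (b - d) ^+ 2 by ring.
by rewrite addr_ge0 // sqr_ge0.
Qed.

Lemma Re_sum (T : finType) (F : T -> R[i]) : complex.Re (\sum_i F i) = \sum_i complex.Re (F i).
Proof. by elim/big_rec2: _ => // i x y _ <-; case: (F i) y => [? ?] []. Qed.

Lemma herm_norm1 f : complex.Re (herm_norm 1%:M f) = \sum_(I : {ffun 'I_m -> 'I_n}) csq (f (frame R I)).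
Proof.
rewrite /herm_norm Re_sum; apply: eq_bigr => I _.
rewrite (bigD1 I) //= big1; last by move=> k _; rewrite mxE eqxx.
rewrite big1 => [|J JI]; last first.
  have [k kJ] : exists k, J k != I k.
    by apply/existsP; apply: contraNT JI => /existsPn IJ; apply/eqP/ffunP => k; have := IJ k; rewrite negbK => /eqP.
  by rewrite (bigD1 k) //= !mxE eq_sym (negPf kJ) mul0r mul0r.
rewrite addr0 rmorph1 mul1r /csq; case: (f _) => a b /=; ring.
Qed.

Lemma herm_norm_factor (M : 'M[R]_n) : posdef M ->
  exists B : 'M[R]_n, forall f, Defs.alternating f ->
    complex.Re (herm_norm (invmx M) f) = \sum_(I : {ffun 'I_m -> 'I_n}) csq (f (frame R I *m B)).
Proof.
move=> /posdef_factor [C Cu ->]; exists (invmx C) => f af.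
have -> : invmx (C *m C^T) = (invmx C)^T *m 1%:M *m invmx C.
  by rewrite mulmx1 invmxM ?unitmx_tr // trmx_inv.
by rewrite -herm_norm_congr // herm_norm1.
Qed.

End Forms.

Section FormNorm.
Variables (R : realType) (n : nat) (Y : riemannian R n) (m : nat).
Implicit Types (w : mform Y m) (y : Y).

Definition frame_norm2 w y (B : 'M[R]_n) : R :=
  (m`!)%:R^-1 * \sum_(I : {ffun 'I_m -> 'I_n}) csq (w y (frame R I *m B)).

Lemma metric_posdef y : posdef (metric y).
Proof. by split; [exact: Defs.metric_sym|move=> v v0; exact: Defs.metric_pos]. Qed.

Lemma form_norm2_frames y : exists B, forall w, Defs.alternating (w y) ->
  form_norm2 w y = frame_norm2 w y B.
Proof.
have [B HB] := herm_norm_factor m (metric_posdef y); exists B => w aw.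
by rewrite /form_norm2 /frame_norm2 -HB.
Qed.

Lemma fact_inv_ge0 : 0 <= (m`!)%:R^-1 :> R.
Proof. by rewrite invr_ge0 ler0n. Qed.

Lemma form_norm2_ge0 w y : Defs.alternating (w y) -> 0 <= form_norm2 w y.
Proof.
have [B HB] := form_norm2_frames y => /HB ->.
by rewrite mulr_ge0 ?fact_inv_ge0 // sumr_ge0 // => I _; exact: csq_ge0.
Qed.

Lemma alternating_lin (f g : 'M[R]_(m, n) -> R[i]) (a : R[i]) :
  Defs.alternating f -> Defs.alternating g -> Defs.alternating (fun v => a * f v + g v).
Proof.
move=> [f1 f2] [g1 g2]; split => [i c A B C rA rB rC|i j A ij rij].
  rewrite (f1 _ _ _ _ _ rA rB rC) (g1 _ _ _ _ _ rA rB rC); ring.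
by rewrite (f2 i j) // (g2 i j) // mulr0 addr0.
Qed.

Lemma alternating_mulmx p (f : 'M[R]_(m, n) -> R[i]) (T : 'M[R]_(p, n)) :
  Defs.alternating f -> Defs.alternating (fun v => f (v *m T)).
Proof.
move=> [f1 f2]; split => [i c A B C rA rB rC|i j A ij rij].
  apply: (f1 i); rewrite ?row_mul ?rA ?mulmxDl -?scalemxAl //.
    by rewrite row'Esub -!mul_rowsub_mx -!row'Esub rB.
  by rewrite row'Esub -!mul_rowsub_mx -!row'Esub rC.
by apply: (f2 i j) => //; rewrite !row_mul rij.
Qed.

Lemma form_norm2_lin (a : R[i]) w w' y : Defs.alternating (w y) -> Defs.alternating (w' y) ->
  form_norm2 (fun y v => a * w y v + w' y v) y <= 2 * csq a * form_norm2 w y + 2 * form_norm2 w' y.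
Proof.
have [B HB] := form_norm2_frames y => aw aw'; rewrite !HB //; last exact: alternating_lin.
rewrite /frame_norm2 !mulrA ![_ * _^-1]mulrC -!mulrA -mulrDr ler_wpM2l ?fact_inv_ge0 //.
rewrite !mulr_sumr -big_split; apply: ler_sum => I _ /=.
by rewrite (le_trans (csqD _ _)) // csqM mulrA.
Qed.

Lemma form_norm2_eq0 w y : w y = (fun=> 0) -> form_norm2 w y = 0.
Proof.
move=> w0; rewrite /form_norm2 big1 ?mulr0 // => I _; rewrite big1 // => J _.
by rewrite w0 mul0r mulr0.
Qed.

Lemma form_norm2_eq w w' y : w y = w' y -> form_norm2 w y = form_norm2 w' y.
Proof. by rewrite /form_norm2 => ->. Qed.

Lemma form_norm2Z (a : R[i]) w y : Defs.alternating (w y) ->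
  form_norm2 (fun y v => a * w y v) y = csq a * form_norm2 w y.
Proof.
have [B HB] := form_norm2_frames y => aw.
have aw' : Defs.alternating (fun v => a * w y v).
  have [f1 f2] := aw; split => [i c U V W rA rB rC|i j U ij rij].
    by rewrite (f1 _ _ _ _ _ rA rB rC); ring.
  by rewrite (f2 i j) // mulr0.
rewrite !HB // /frame_norm2 mulrCA; congr (_ * _); rewrite mulr_sumr.
by apply: eq_bigr => I _; rewrite csqM.
Qed.

Lemma form_norm2_tangent_chart c w y : atlas Y c -> cdom c y -> Defs.alternating (w y) ->
  form_norm2 w y = (m`!)%:R^-1 * complex.Re
    (herm_norm (invmx (gram (@metric R n Y) c y)) (fun v => w y (v *m tangent_chart c y))).
Proof.
move=> Ac cy aw; have Tu := tangent_chart_unit Ac cy.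
rewrite herm_norm_congr // /form_norm2; congr (_ * complex.Re (herm_norm _ _)).
by rewrite /gram invmx_congr // posdef_unit //; exact: metric_posdef.
Qed.

Lemma form_norm2_pullback f g w y : isometry_pair f g -> Defs.alternating (w (f y)) ->
  form_norm2 (pullback f w) y = form_norm2 w (f y).
Proof.
move=> [sf sg fK gK fm] aw; rewrite /form_norm2 /pullback; congr (_ * complex.Re _).
have Tu : tangent f y \in unitmx.
  have E : tangent f y *m tangent g (f y) = 1%:M.
    rewrite -(tangent_comp _ sf sg) -[RHS](tangent_id y); congr (tangent _ _).
    by apply/funext => z; exact: fK.
  by have [H _] := mulmx1_unit E.
have := herm_norm_congr (invmx (metric y)) (tangent f y) aw; rewrite /herm_norm => ->.
by rewrite (fm y) invmx_congr // posdef_unit //; exact: metric_posdef.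
Qed.

End FormNorm.

(** * Borel measurability *)

Section Borel.
Variable R : realType.

Lemma countable_cover (X : topologicalType) (P : set X -> Prop) : @second_countable X ->
  P set0 -> (forall U V, U `<=` V -> P V -> P U) ->
  (forall x, exists2 O, open O /\ O x & P O) ->
  exists V : nat -> set X, [/\ forall k, open (V k), forall k, P (V k) & \bigcup_k V k = setT].
Proof.
move=> [B /countable_injP [f finj] [Bo Bb]] P0 Psub Ploc.
pose C k := [set b | [/\ B b, f b = k & P b]].
exists (fun k => \bigcup_(b in C k) b); split => [k|k|].
- by apply: bigcup_open => b [Bbb _ _]; exact: Bo.
- have [[b Cb]|nC] := pselect (exists b, C k b); last first.
    by rewrite (_ : \bigcup_(b in _) _ = set0) // -subset0 => x [b Cb _]; apply: nC; exists b.
  have [Bbb fb Pb] := Cb; apply: Psub (Pb) => x [b' [Bb' fb' _] b'x].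
  by rewrite (finj b b') ?inE // fb fb'.
apply/seteqP; split => // x _.
have [ O [oO Ox] PO] := Ploc x.
have [b [Bbb bx] bO] : (filter_from [set U | B U /\ U x] id) O by apply: Bb; exact: open_nbhs_nbhs.
by exists (f b) => //; exists b => //; split => //; exact: Psub PO.
Qed.

Lemma borel_open (X : ptopologicalType) (A : set (borel X)) : open (A : set X) -> measurable A.
Proof. by move=> oA; apply: sub_sigma_algebra. Qed.

Lemma continuous_borel (X Y : ptopologicalType) (f : X -> Y) : continuous f ->
  measurable_fun [set: borel X] (f : borel X -> borel Y).
Proof.
move=> cf; apply: (@measurability _ _ (borel X) (borel Y) setT f (@open Y) erefl).
move=> _ [U oU <-]; apply: borel_open; rewrite setTI.
by apply: open_comp => // x _; exact: cf.
Qed.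

Lemma continuous_measurable_on (X : ptopologicalType) (D : set X) (f : X -> R) : open D ->
  (forall x, D x -> {for x, continuous f}) -> measurable_fun (D : set (borel X)) (f : borel X -> R).
Proof.
move=> oD cf; apply: (measurability _ (RGenOpens.measurableE R)).
move=> _ [_ [a [b ->] <-]]; apply: borel_open.
have ab : open `]a, b[%classic by exact: interval_open.
rewrite openE => x [Dx fx]; rewrite /interior.
have n1 : nbhs x (f @^-1` `]a, b[%classic) := cf _ Dx _ (open_nbhs_nbhs (conj ab fx)).
have n2 : nbhs x D by exact: open_nbhs_nbhs.
by apply: filterS (filterI n2 n1).
Qed.

End Borel.

Section MeasurableMatrices.
Context d (T : measurableType d) (R : realType).
Variable D : set T.

Lemma measurable_inv (f : T -> R) : measurable_fun D f -> measurable_fun D (fun x => (f x)^-1).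
Proof.
move=> mf; apply: (measurableT_comp (f := (@GRing.inv R))) => //.
have -> : [set: R] = [set 0] `|` [set~ 0] by rewrite setUv.
have oC : open [set~ (0 : R)] by apply: closed_openC; exact: (@closed_eq R 0).
apply/measurable_funU => //; first exact: open_measurable.
split; first exact: measurable_fun_set1.
apply: open_continuous_measurable_fun => // x; rewrite inE => /eqP x0.
exact: inv_continuous.
Qed.

Lemma measurable_bigsum (I : Type) (r : seq I) (P : pred I) (F : I -> T -> R) :
  (forall i, measurable_fun D (F i)) -> measurable_fun D (fun x => \sum_(i <- r | P i) F i x).
Proof.
move=> mF; elim: r => [|i r IHr].
  by under eq_fun do rewrite big_nil; exact: measurable_cst.
under eq_fun do rewrite big_cons; case: (P i) => //.
exact: (measurable_funD (mF i) IHr).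
Qed.

Lemma measurable_bigprod (I : Type) (r : seq I) (P : pred I) (F : I -> T -> R) :
  (forall i, measurable_fun D (F i)) -> measurable_fun D (fun x => \prod_(i <- r | P i) F i x).
Proof.
move=> mF; elim: r => [|i r IHr].
  by under eq_fun do rewrite big_nil; exact: measurable_cst.
under eq_fun do rewrite big_cons; case: (P i) => //.
exact: (measurable_funM (mF i) IHr).
Qed.

Lemma measurable_det n (A : T -> 'M[R]_n) : (forall i j, measurable_fun D (fun x => A x i j)) ->
  measurable_fun D (fun x => \det (A x)).
Proof.
move=> mA; rewrite /determinant; apply: measurable_bigsum => s.
by apply: measurable_funM; [exact: measurable_cst|exact: measurable_bigprod].
Qed.

Lemma measurable_invmx n (A : T -> 'M[R]_n) i j : (forall x, D x -> A x \in unitmx) ->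
  (forall i j, measurable_fun D (fun x => A x i j)) ->
  measurable_fun D (fun x => invmx (A x) i j).
Proof.
move=> uA mA.
apply: (@eq_measurable_fun _ _ _ _ _ (fun x => (\det (A x))^-1 * cofactor (A x) j i)).
  by move=> x; rewrite inE => /uA Au; rewrite /invmx Au !mxE.
apply: measurable_funM; first exact/measurable_inv/measurable_det.
apply: measurable_funM; first exact: measurable_cst.
case: n A uA mA i j => [|n] A uA mA i j; first by case: i.
apply: measurable_det => k l.
by under eq_fun do rewrite !mxE; exact: mA.
Qed.

End MeasurableMatrices.

(** * Invariance of the volume *)

Section RiemannianMeasure.
Variables (R : realType) (n : nat) (Y : riemannian R n).

Lemma chart_cover : exists (V : nat -> set Y) (c : nat -> chart R Y n),
  [/\ forall k, open (V k), forall k, atlas Y (c k), forall k, V k `<=` cdom (c k) & \bigcup_k V k = setT].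
Proof.
have [||x|V [oV PV UV]] := @countable_cover Y (fun U => exists2 c, atlas Y c & U `<=` cdom c)
    (@msecond_countable R n Y).
- by exists (chart_at point); [exact: chart_at_atlas|exact: sub0set].
- by move=> U V UV [c Ac Vc]; exists c => //; exact: subset_trans UV Vc.
- exists (cdom (chart_at x)); last by exists (chart_at x) => //; exact: chart_at_atlas.
  by split; [have [] := chart_at_chart x|exact: chart_at_dom].
have [c Hc] := @choice _ _ (fun k c => atlas Y c /\ V k `<=` cdom c)
  (fun k => let: ex_intro2 c a b := PV k in ex_intro _ c (conj a b)).
by exists V, c; split => // k; have [] := Hc k.
Qed.

Lemma gram_measurable c i j : atlas Y c ->
  measurable_fun (cdom c : set (borel Y)) (fun y => gram (@metric R n Y) c y i j : R).
Proof.
move=> Ac; have [od or cK cc ci] := atlas_chart Ac.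
apply: (@eq_measurable_fun _ _ (borel Y) _ _ (fun y => gram (@metric R n Y) c (cinv c (cmap c y)) i j)).
  by move=> y; rewrite inE => cy; rewrite cK.
apply: continuous_measurable_on => // y cy.
have := @metric_smooth R n Y c Ac 0 i j (cmap c y).
move=> /(_ (ex_intro2 _ _ y cy erefl)) H.
exact: (@continuous_comp _ _ _ (cmap c) (fun u => gram (@metric R n Y) c (cinv c u) i j) y (cc _ cy) H).
Qed.

Lemma gram_unit c y : atlas Y c -> cdom c y -> gram (@metric R n Y) c y \in unitmx.
Proof.
move=> Ac cy; have Tu := tangent_chart_unit Ac cy.
by rewrite !unitmx_mul unitmx_tr Tu posdef_unit //; exact: metric_posdef.
Qed.

Variable m : nat.
Implicit Types w : mform Y m.

Lemma Re_herm_norm (H : 'M[R]_n) (f : 'M[R]_(m, n) -> R[i]) :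
  complex.Re (herm_norm H f) = \sum_(I : {ffun 'I_m -> 'I_n}) \sum_(J : {ffun 'I_m -> 'I_n})
    (\prod_(k < m) H (I k) (J k)) * (complex.Re (f (frame R I)) * complex.Re (f (frame R J)) +
      complex.Im (f (frame R I)) * complex.Im (f (frame R J))).
Proof.
rewrite /herm_norm Re_sum; apply: eq_bigr => I _; rewrite Re_sum; apply: eq_bigr => J _.
by case: (f _) (f _) => a b [c d] /=; ring.
Qed.

Lemma form_norm2_measurable w : (forall y, Defs.alternating (w y)) -> measurable_form w ->
  measurable_fun [set: borel Y] (form_norm2 w).
Proof.
move=> aw mw; have [V [c [oV Ac Vc <-]]] := chart_cover.
apply/measurable_fun_bigcup => [k|k]; first exact: borel_open.
have [od _ _ _ _] := atlas_chart (Ac k).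
apply: (@measurable_funS _ _ (borel Y) _ (cdom (c k) : set (borel Y))) => //; first exact: borel_open.
apply: (@eq_measurable_fun _ _ (borel Y) _ _ (fun y => (m`!)%:R^-1 * complex.Re
    (herm_norm (invmx (gram (@metric R n Y) (c k) y)) (fun v => w y (v *m tangent_chart (c k) y))))).
  by move=> y; rewrite inE => cy; rewrite (form_norm2_tangent_chart (Ac k) cy (aw y)).
apply: measurable_funM; first exact: measurable_cst.
under eq_fun do rewrite Re_herm_norm.
apply: measurable_bigsum => I; apply: measurable_bigsum => J.
have [mRI mII] := mw _ I (Ac k); have [mRJ mIJ] := mw _ J (Ac k).
apply: measurable_funM.
  apply: measurable_bigprod => l; apply: measurable_invmx => [y cy|i j]; first exact: gram_unit.
  exact: gram_measurable.
by apply: measurable_funD; apply: measurable_funM.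
Qed.

Variable vol : {measure set (borel Y) -> \bar R}.
Hypothesis vol_Y : is_volume vol.
Variables f g : Y -> Y.
Hypothesis fg : isometry_pair f g.

Lemma isometry_preimage_measurable (A : set (borel Y)) : measurable A ->
  measurable (f @^-1` A : set (borel Y)).
Proof.
by move=> mA; have := continuous_borel (iso_smooth fg).1 measurableT mA; rewrite setTI.
Qed.

Lemma gram_pull_chart c y : atlas Y c -> cdom c (f y) ->
  gram (@metric R n Y) (pull_chart f g c) y = gram (@metric R n Y) c (f y).
Proof.
have [sf sg fK gK fm] := fg => Ac cy.
rewrite /gram (fm y) -(tangent_pull_chart sf sg fK gK Ac cy).
by rewrite trmx_mul !mulmxA.
Qed.

Lemma eq_volume_integral (S S' : set 'rV[R]_n) (M M' : 'rV[R]_n -> 'M[R]_n) : S = S' ->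
  (forall u, S' u -> M u = M' u) ->
  rV_integral (fun u => (\1_S u * Num.sqrt (\det (M u)))%:E) =
  rV_integral (fun u => (\1_S' u * Num.sqrt (\det (M' u)))%:E).
Proof.
move=> -> MM; congr rV_integral; apply/funext => u; congr (_%:E).
have [Su|nSu] := pselect (S' u); first by rewrite MM.
by rewrite !indicE memNset // !mul0r.
Qed.

Lemma volume_isometry (A : set (borel Y)) : measurable A -> vol (f @^-1` A) = vol A.
Proof.
have [sf sg fK gK fm] := fg.
suff H c B : atlas Y c -> measurable (B : set (borel Y)) -> B `<=` cdom c -> vol (f @^-1` B) = vol B.
  have [V [c [oV Ac Vc UV]]] := chart_cover => mA.
  pose W k := A `&` seqDU V k.
  have mV k : measurable (V k : set (borel Y)) by exact: borel_open.
  have mW k : measurable (W k : set (borel Y)).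
    by apply: measurableI => //; apply: measurableD => //; exact: bigsetU_measurable.
  have tW : trivIset setT W.
    exact: trivIset_setIl (@trivIset_seqDU _ V).
  have AW : A = \bigcup_k W k by rewrite -setI_bigcupr -seqDU_bigcup_eq UV setIT.
  rewrite AW preimage_bigcup !measure_semi_bigcup //.
  - apply: eq_eseriesr => k _; apply: (H (c k)) => //.
    by move=> y [_ [Vy _]]; exact: Vc.
  - by apply: bigcup_measurable.
  - by move=> k; exact: isometry_preimage_measurable.
  - move=> i j _ _ [y [Wi Wj]]; apply: tW => //; by exists (f y).
  - by apply: bigcup_measurable => k _; exact: isometry_preimage_measurable.
move=> Ac mB Bc.
have Ap := pull_chart_atlas sf sg fK gK Ac.
have fBp : f @^-1` B `<=` cdom (pull_chart f g c) by move=> y By; exact: Bc.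
apply: (etrans (vol_Y Ap (isometry_preimage_measurable mB) fBp)).
apply/esym/(etrans (vol_Y Ac mB Bc))/esym.
have imE : cmap (pull_chart f g c) @` (f @^-1` B) = cmap c @` B.
  apply/seteqP; split => [_ [y By <-]|_ [y By <-]]; first by exists (f y).
  by exists (g y) => /=; rewrite gK.
apply: (eq_volume_integral imE) => _ [y By <-].
have cy : cdom c (f (g y)) by rewrite gK; exact: Bc.
have cyK : cinv c (cmap c y) = y by apply: chart_cmapK (atlas_chart Ac) _; exact: Bc.
by rewrite -[cinv (pull_chart f g c) _]/(g (cinv c (cmap c y))) cyK (gram_pull_chart Ac cy) gK.
Qed.

Lemma L2_norm2_pullback w : (forall y, Defs.alternating (w y)) -> measurable_form w ->
  L2_norm2 vol (pullback f w) = L2_norm2 vol w.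
Proof.
move=> aw mw; rewrite /L2_norm2.
have mf := continuous_borel (iso_smooth fg).1.
have -> : (\int[vol]_(y in [set: borel Y]) (form_norm2 w y)%:E)%E =
    (\int[pushforward vol (f : borel Y -> borel Y)]_(y in [set: borel Y]) (form_norm2 w y)%:E)%E.
  by apply: eq_measure_integral => A mA _; rewrite -volume_isometry.
rewrite [RHS]ge0_integral_pushforward //.
- by apply: eq_integral => y _ /=; rewrite (form_norm2_pullback fg).
- by apply/measurable_EFinP; exact: form_norm2_measurable.
- by move=> y _; rewrite lee_fin form_norm2_ge0.
Qed.

Lemma mulmx_cancelr p q (F : 'M[R]_(p, q)) (P C S T : 'M[R]_q) :
  S *m T = 1%:M -> P *m S = C -> F *m C *m T = F *m P.
Proof. by move=> ST <-; rewrite -!mulmxA ST mulmx1. Qed.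

Lemma measurable_form_pullback w : measurable_form w -> measurable_form (pullback f w).
Proof.
have [sf sg fK gK fm] := fg => mw c I Ac.
have Apc := pull_chart_atlas sg sf gK fK Ac.
have [mR mI] := mw _ I Apc.
have [od _ _ _ _] := atlas_chart Apc.
have E y : cdom c y -> frame R I *m tangent_chart c y *m tangent f y = frame R I *m tangent_chart (pull_chart g f c) (f y).
  move=> cy; have cy' : cdom c (g (f y)) by rewrite fK.
  have TC := tangent_pull_chart sg sf gK fK Ac cy'; rewrite fK in TC.
  have gf1 : tangent g (f y) *m tangent f y = 1%:M.
    have := tangent_comp (f y) sg sf; rewrite fK => <-.
    rewrite -[RHS](tangent_id (f y)); congr (tangent _ _).
    by apply/funext => z; exact: gK.
  exact: (mulmx_cancelr _ gf1 TC).
have sub : f @` (cdom c) `<=` cdom (pull_chart g f c) by move=> _ [y cy <-] /=; rewrite fK.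
have mcf := measurable_funTS (D := cdom c : set (borel Y)) (continuous_borel sf.1).
have mdom : measurable (cdom (pull_chart g f c) : set (borel Y)) by exact: borel_open.
have EP y : cdom c y -> w (f y) (frame R I *m tangent_chart (pull_chart g f c) (f y)) =
    pullback f w y (frame R I *m tangent_chart c y).
  by move=> cy; exact: (congr1 (w (f y)) (esym (E y cy))).
have mRf := @measurable_comp _ _ _ (borel Y) (borel Y) R (cdom (pull_chart g f c)) _ (cdom c) f mdom sub mR mcf.
have mIf := @measurable_comp _ _ _ (borel Y) (borel Y) R (cdom (pull_chart g f c)) _ (cdom c) f mdom sub mI mcf.
split.
- apply: (@eq_measurable_fun _ _ (borel Y) _ _ _ _ _ mRf) => y; rewrite inE => cy.
  exact: (congr1 (@complex.Re R) (EP y cy)).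
- apply: (@eq_measurable_fun _ _ (borel Y) _ _ _ _ _ mIf) => y; rewrite inE => cy.
  exact: (congr1 (@complex.Im R) (EP y cy)).
Qed.

End RiemannianMeasure.

(** * Pullback operators on square-integrable forms *)

Lemma ge0_integral_lin d (T : measurableType d) (R : realType) (mu : {measure set T -> \bar R})
    (a b : R) (f g : T -> R) : 0 <= a -> 0 <= b ->
  measurable_fun setT f -> measurable_fun setT g -> (forall x, 0 <= f x) -> (forall x, 0 <= g x) ->
  (\int[mu]_(x in setT) (a * f x + b * g x)%:E =
   a%:E * \int[mu]_(x in setT) (f x)%:E + b%:E * \int[mu]_(x in setT) (g x)%:E)%E.
Proof.
move=> a0 b0 mf mg f0 g0.
have mf' : measurable_fun setT (fun x => (f x)%:E) by exact/measurable_EFinP.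
have mg' : measurable_fun setT (fun x => (g x)%:E) by exact/measurable_EFinP.
under eq_integral do rewrite EFinD !EFinM.
have maf : measurable_fun setT (fun x => a%:E * (f x)%:E)%E by exact: measurable_funeM.
have mbg : measurable_fun setT (fun x => b%:E * (g x)%:E)%E by exact: measurable_funeM.
rewrite ge0_integralD //; last 2 first.
- by move=> x _; rewrite -EFinM lee_fin mulr_ge0.
- by move=> x _; rewrite -EFinM lee_fin mulr_ge0.
rewrite ge0_integralZl_EFin //; last by move=> x _; rewrite lee_fin.
rewrite ge0_integralZl_EFin //; last by move=> x _; rewrite lee_fin.
Qed.

Lemma smooth_map_comp (R : realType) n p q (X : manifold R n) (Y : manifold R p) (Z : manifold R q)
    (f : X -> Y) (g : Y -> Z) : smooth_map f -> smooth_map g -> smooth_map (g \o f).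
Proof.
move=> sf sg; apply: smooth_mapP.
  by move=> x; apply: continuous_comp; [exact: sf.1|exact: sg.1].
move=> x; pose a := chart_at x; pose b := chart_at (f x); pose d := chart_at (g (f x)).
have [Aa Ab Ad] : [/\ atlas X a, atlas Y b & atlas Z d] by split; exact: chart_at_atlas.
have [Ca Cb Cd] := And3 (atlas_chart Aa) (atlas_chart Ab) (atlas_chart Ad).
pose W := f @^-1` (cdom b `&` g @^-1` cdom d).
have oW : open W.
  apply: open_comp => [y _|]; first exact: sf.1.
  apply: openI; first by case: Cb.
  by apply: open_comp => [y _|]; [exact: sg.1|case: Cd].
have oO := chart_open Ca oW.
exists a, d, (cmap a @` (cdom a `&` W)); split.
  by split => //; exact: chart_at_dom.
split => //.
  by exists x => //; split; [exact: chart_at_dom|split; exact: chart_at_dom].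
have s1 : smooth_on (cmap a @` (cdom a `&` W)) (cmap b \o f \o cinv a).
  by apply: smooth_on_sub (sf.2 _ _ Aa Ab) => _ [y [ay [by_ _]] <-]; exists y.
have s2 := @smooth_on_comp _ _ _ _ _ _ _ _ oO s1 _ (sg.2 _ _ Ab Ad).
apply: smooth_on_eq (s2 _) => //.
  by move=> _ [y [ay [by_ dy]] <-] /=; rewrite (chart_cmapK Ca) // (chart_cmapK Cb).
move=> _ [y [ay [by_ dy]] <-] /=.
by rewrite (chart_cmapK Ca) //; exists (f y).
Qed.

Lemma isometry_pair_comp (R : realType) n (Y : riemannian R n) (f f' g g' : Y -> Y) :
  isometry_pair f f' -> isometry_pair g g' -> isometry_pair (g \o f) (f' \o g').
Proof.
move=> [sf sf' fK fK' fm] [sg sg' gK gK' gm].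
split; [exact: smooth_map_comp|exact: smooth_map_comp|exact: can_comp|exact: can_comp|].
move=> y; rewrite (fm y) (gm (f y)) (tangent_comp y sf sg) trmx_mul !mulmxA //.
Qed.

Section L2Forms.
Variables (R : realType) (n : nat) (Y : riemannian R n) (m : nat).
Variables (vol : {measure set (borel Y) -> \bar R}).
Implicit Types (w : mform Y m) (B : set (borel Y)).
Local Notation sqi := (square_integrable vol).

Definition form_lin (a : R[i]) w w' : mform Y m := fun y v => a * w y v + w' y v.

Lemma measurable_form_lin a w w' : measurable_form w -> measurable_form w' ->
  measurable_form (form_lin a w w').
Proof.
case: a => a b mw mw' c I Ac; have [mR mI] := mw c I Ac; have [mR' mI'] := mw' c I Ac.
have mc (k : R) : measurable_fun (cdom c : set (borel Y)) (fun _ : borel Y => k) by exact: measurable_cst.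
split.
- apply: (@eq_measurable_fun _ _ (borel Y) _ _ _ _ _
    (measurable_funD (measurable_funB (measurable_funM (mc a) mR) (measurable_funM (mc b) mI)) mR')).
  by move=> y _; rewrite /form_lin /=; case: (w y _) (w' y _) => [x z] [x' z'].
- apply: (@eq_measurable_fun _ _ (borel Y) _ _ _ _ _
    (measurable_funD (measurable_funD (measurable_funM (mc a) mI) (measurable_funM (mc b) mR)) mI')).
  by move=> y _; rewrite /form_lin /=; case: (w y _) (w' y _) => [x z] [x' z'].
Qed.

Lemma L2_norm2_lin (a b : R) w w' : 0 <= a -> 0 <= b -> sqi w -> sqi w' ->
  (\int[vol]_(y in [set: borel Y]) (a * form_norm2 w y + b * form_norm2 w' y)%:E =
   a%:E * L2_norm2 vol w + b%:E * L2_norm2 vol w')%E.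
Proof.
move=> a0 b0 [aw mw _] [aw' mw' _].
by apply: ge0_integral_lin => //; [exact: form_norm2_measurable|exact: form_norm2_measurable|
  move=> y; exact: form_norm2_ge0|move=> y; exact: form_norm2_ge0].
Qed.

Lemma square_integrable_lin a w w' : sqi w -> sqi w' -> sqi (form_lin a w w').
Proof.
move=> sw sw'; have [aw mw fw] := sw; have [aw' mw' fw'] := sw'.
have al y : Defs.alternating (form_lin a w w' y) by exact: alternating_lin.
have ml : measurable_form (form_lin a w w') by exact: measurable_form_lin.
split => //.
have ca : 0 <= 2 * csq a by rewrite mulr_ge0 // csq_ge0.
apply: (@le_lt_trans _ _ (\int[vol]_(y in [set: borel Y])
   ((2 * csq a) * form_norm2 w y + 2 * form_norm2 w' y)%:E)%E).
  apply: ge0_le_integral => //.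
  - by move=> y _; rewrite lee_fin form_norm2_ge0.
  - by apply/measurable_EFinP; exact: form_norm2_measurable.
  - apply/measurable_EFinP; apply: measurable_funD; apply: measurable_funM;
      by [exact: measurable_cst|exact: form_norm2_measurable].
  - by move=> y _; rewrite lee_fin; exact: form_norm2_lin.
rewrite L2_norm2_lin // lte_add_pinfty // lte_mul_pinfty // ?lee_fin //.
Qed.

Definition form_restrict B w : mform Y m := fun y v => if y \in B then w y v else 0.

Lemma form_norm2_restrict B w y : form_norm2 (form_restrict B w) y = \1_B y * form_norm2 w y.
Proof.
rewrite indicE; case: (boolP (y \in B)) => yB.
  by rewrite mul1r; apply: form_norm2_eq; apply/funext => v; rewrite /form_restrict yB.
by rewrite mul0r; apply: form_norm2_eq0; apply/funext => v; rewrite /form_restrict (negPf yB).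
Qed.

Lemma alternating_restrict B w y : Defs.alternating (w y) -> Defs.alternating (form_restrict B w y).
Proof.
move=> aw; rewrite /form_restrict; case: (y \in B) => //.
by split => [*|//]; rewrite mulr0 addr0.
Qed.

Lemma square_integrable_restrict B w : measurable B -> sqi w -> sqi (form_restrict B w).
Proof.
move=> mB [aw mw fw].
have ar y : Defs.alternating (form_restrict B w y) by exact: alternating_restrict.
have mr : measurable_form (form_restrict B w).
  move=> c I Ac; have [mR mI] := mw c I Ac.
  have mi : measurable_fun (cdom c : set (borel Y)) (\1_B : borel Y -> R) by exact: measurable_indic.
  split.
  - apply: (@eq_measurable_fun _ _ (borel Y) _ _ _ _ _ (measurable_funM mi mR)) => y _.
    by rewrite /= /form_restrict indicE; case: (y \in B); rewrite ?mul1r ?mul0r.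
  - apply: (@eq_measurable_fun _ _ (borel Y) _ _ _ _ _ (measurable_funM mi mI)) => y _.
    by rewrite /= /form_restrict indicE; case: (y \in B); rewrite ?mul1r ?mul0r.
split => //; apply: le_lt_trans fw; apply: ge0_le_integral => //.
- by move=> y _; rewrite lee_fin form_norm2_ge0.
- by apply/measurable_EFinP; exact: form_norm2_measurable.
- by apply/measurable_EFinP; exact: form_norm2_measurable.
by move=> y _; rewrite lee_fin form_norm2_restrict ler_piMl ?form_norm2_ge0 // indicE; case: (y \in B).
Qed.

Lemma square_integrable_pullback f g w : is_volume vol -> isometry_pair f g -> sqi w ->
  sqi (pullback f w).
Proof.
move=> vol_Y fg [aw mw fw]; split.
- by move=> y; exact: alternating_mulmx.
- exact: (measurable_form_pullback fg mw).
- by rewrite (L2_norm2_pullback vol_Y fg).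
Qed.

Variable L : L2_forms m vol.

Lemma sqn_L2_class w : sqi w -> (sqn (L2_dot L) (L2_class L w))%:E = L2_norm2 vol w.
Proof. exact: L2_classE. Qed.

Lemma L2_class_eq0 w : sqi w -> (L2_class L w = 0) <-> (L2_norm2 vol w = 0%E).
Proof.
move=> sw; rewrite -sqn_L2_class //; split => [->|[E]]; first by rewrite sqn0.
by apply/eqP; rewrite -(sqn_eq0 (L2_dot L)) E.
Qed.

Lemma L2_repr_spec (h : L) : sqi (L2_repr h) /\ L2_class L (L2_repr h) = h.
Proof.
have [w sw wh] := L2_class_surj h.
by rewrite /L2_repr; case: xgetP => [_ _ //|/(_ w) []].
Qed.

Lemma L2_class_lin a w w' : sqi w -> sqi w' ->
  L2_class L (form_lin a w w') = a *: L2_class L w + L2_class L w'.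
Proof. exact: L2_class_linear. Qed.

Section PullbackOp.
Hypothesis vol_Y : is_volume vol.

Lemma pullback_opE f g w : isometry_pair f g -> sqi w ->
  pullback_op f (L2_class L w) = L2_class L (pullback f w).
Proof.
move=> fg sw; have [sw' ww'] := L2_repr_spec (L2_class L w).
rewrite /pullback_op; set w' := L2_repr _ in sw' ww' *.
have sp := square_integrable_pullback vol_Y fg sw.
have sp' := square_integrable_pullback vol_Y fg sw'.
have sd : sqi (form_lin (-1) w w') by exact: square_integrable_lin.
have /(L2_class_eq0 sd) d0 : L2_class L (form_lin (-1) w w') = 0.
  by rewrite L2_class_lin // ww' scaleN1r addNr.
have [ad md _] := sd.
have : L2_class L (form_lin (-1) (pullback f w) (pullback f w')) = 0.
  apply/(L2_class_eq0 (square_integrable_lin _ sp sp')).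
  by rewrite -d0 -(L2_norm2_pullback vol_Y fg ad md).
by rewrite L2_class_lin // scaleN1r addrC => /eqP; rewrite subr_eq0 => /eqP.
Qed.

Lemma pullback_op_linear f g : isometry_pair f g -> linear (pullback_op f : L -> L).
Proof.
move=> fg a h h'; have [w sw <-] := L2_class_surj h; have [w' sw' <-] := L2_class_surj h'.
rewrite -L2_class_lin // !(pullback_opE fg) //; last exact: square_integrable_lin.
by rewrite -L2_class_lin //; exact: (square_integrable_pullback vol_Y fg).
Qed.

Lemma pullback_op_sqn f g (h : L) : isometry_pair f g ->
  sqn (L2_dot L) (pullback_op f h) = sqn (L2_dot L) h.
Proof.
move=> fg; have [w sw <-] := L2_class_surj h; apply: EFin_inj.
rewrite (pullback_opE fg) // !sqn_L2_class //; last exact: (square_integrable_pullback vol_Y fg).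
by have [aw mw _] := sw; exact: (L2_norm2_pullback vol_Y fg).
Qed.

Lemma pullback_op_comp f f' g g' (h : L) : isometry_pair f f' -> isometry_pair g g' ->
  pullback_op f (pullback_op g h) = pullback_op (g \o f) h.
Proof.
move=> ff gg; have [w sw <-] := L2_class_surj h.
have fg := isometry_pair_comp ff gg.
have E1 := pullback_opE gg sw.
have E2 := pullback_opE ff (square_integrable_pullback vol_Y gg sw).
have E3 := pullback_opE fg sw.
have E : pullback f (pullback g w) = pullback (g \o f) w.
  apply/funext => y; apply/funext => v; apply: (congr1 (w (g (f y)))).
  apply: etrans (esym (mulmxA _ _ _)) _; apply: (congr1 (mulmx v)).
  exact: (esym (tangent_comp y (iso_smooth ff) (iso_smooth gg))).
exact: (etrans (congr1 _ E1) (etrans E2 (etrans (congr1 _ E) (esym E3)))).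
Qed.

Lemma pullback_op_id (h : L) : pullback_op id h = h.
Proof.
have [sw wh] := L2_repr_spec h; rewrite -[RHS]wh /pullback_op; congr (L2_class L _).
apply/funext => y; apply/funext => v; apply: (congr1 (L2_repr h y)).
by rewrite tangent_id mulmx1.
Qed.

End PullbackOp.

Lemma L2_disjoint w w' : sqi w -> sqi w' -> (forall y, w y = (fun=> 0) \/ w' y = (fun=> 0)) ->
  L2_dot L (L2_class L w) (L2_class L w') = 0.
Proof.
move=> sw sw' ww.
have E (a : R[i]) : complex.Re (a * L2_dot L (L2_class L w) (L2_class L w')) = 0.
  have [aw _ _] := sw; have [aw' _ _] := sw'.
  have : sqn (L2_dot L) (a *: L2_class L w + L2_class L w') =
      csq a * sqn (L2_dot L) (L2_class L w) + 1 * sqn (L2_dot L) (L2_class L w').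
    apply: EFin_inj; rewrite -L2_class_lin // sqn_L2_class; last exact: square_integrable_lin.
    rewrite EFinD !EFinM !sqn_L2_class // -L2_norm2_lin ?csq_ge0 //.
    apply: eq_integral => y _; congr (_%:E); rewrite mul1r.
    case: (ww y) => E.
      rewrite (form_norm2_eq0 E) mulr0 add0r; apply: form_norm2_eq.
      by apply/funext => v; rewrite /form_lin E mulr0 add0r.
    rewrite (form_norm2_eq0 E) addr0 -form_norm2Z //; apply: form_norm2_eq.
    by apply/funext => v; rewrite /form_lin E addr0.
  have -> : csq a * sqn (L2_dot L) (L2_class L w) = sqn (L2_dot L) (a *: L2_class L w).
    rewrite sqnZ; congr (_ * _); case: a => x z.
    by rewrite /csq /ComplexField.Normc.normc sqr_sqrtr // addr_ge0 // sqr_ge0.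
  rewrite sqnD mul1r ipZl => /eqP.
  by rewrite -subr_eq0 addrAC subrr add0r mulf_eq0 pnatr_eq0 => /eqP.
case: (L2_dot L _ _) E => x z E.
have := E 1; have := E (Complex 0 (-1)); rewrite /= => H1 H2.
by congr Complex; lra.
Qed.

Lemma L2_restrict w B : measurable B -> sqi w ->
  L2_dot L (L2_class L w) (L2_class L (form_restrict B w)) =
  (sqn (L2_dot L) (L2_class L (form_restrict B w)))%:C%C.
Proof.
move=> mB sw; have sB := square_integrable_restrict mB sw.
have sC := square_integrable_restrict (measurableC mB) sw.
have -> : L2_class L w = L2_class L (form_restrict (~` B) w) + L2_class L (form_restrict B w).
  rewrite -[L2_class L (form_restrict (~` B) w)]scale1r -L2_class_lin //; congr (L2_class L _).
  apply/funext => y; apply/funext => v; rewrite /form_lin /form_restrict mul1r in_setC.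
  by case: (y \in B); rewrite ?add0r ?addr0.
rewrite ipDl L2_disjoint //; first by rewrite add0r ip_sqn.
move=> y; rewrite /form_restrict in_setC; case: (y \in B); [left|right]; by apply/funext.
Qed.

Lemma L2_cover_eq0 w (B : nat -> set (borel Y)) : sqi w -> (forall k, measurable (B k)) ->
  trivIset setT B -> \bigcup_k B k = setT ->
  (forall k, L2_class L (form_restrict (B k) w) = 0) -> L2_class L w = 0.
Proof.
move=> sw mB tB UB B0; apply/L2_class_eq0 => //; have [aw mw _] := sw.
rewrite /L2_norm2 -UB ge0_integral_bigcup //; last 2 first.
- by rewrite UB; apply/measurable_EFinP; exact: form_norm2_measurable.
- by move=> y _; rewrite lee_fin form_norm2_ge0.
apply: eseries0 => k _ _.
have := B0 k; move/(L2_class_eq0 (square_integrable_restrict (mB k) sw)) => <-.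
rewrite integral_mkcond; apply: eq_integral => y _.
by rewrite form_norm2_restrict patchE indicE; case: (y \in B k); rewrite ?mul1r ?mul0r.
Qed.

End L2Forms.

(** * The wandering system of a Galois cover *)

Section Action.
Variables (R : realType) (n : nat) (X K : riemannian R n).
Variables (G : groupType) (act : G -> X -> X) (p : X -> K).
Hypotheses (act_isometric : isometric_action act) (act_free : free_action act).
Hypothesis p_cover : galois_cover act p.

Lemma act_isometry_pair g : isometry_pair (act g) (act g^-1%g).
Proof.
have [act1 actM actI] := act_isometric.
split; [exact: (actI g).1|exact: (actI g^-1%g).1| | |exact: (actI g).2].
- by move=> x; rewrite -actM mulVg act1.
- by move=> x; rewrite -actM mulgV act1.
Qed.

Lemma covering_displaced x : exists2 U : set X, open U /\ U x &
  forall g y, U y -> U (act g y) -> g = 1%g.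
Proof.
have [[_ _ ev] _ fib] := p_cover.
have [V [_ Vx [I [U [oU UV _ Ubij]]]]] := ev (p x).
have : (p @^-1` V) x by [].
rewrite UV => -[i _ Uix]; exists (U i) => // g y Uy Ugy.
apply: (act_free (x := y)); have [[_ injp _] _] := Ubij i.
by apply: injp; rewrite ?inE //; apply/esym/fib; exists g.
Qed.

Variables (N m : nat) (XN : riem_power X N).

Lemma diag_actE (g : 'I_N -> G) : diag_act (XN := XN) act g = power_map (fun i => act (g i)) 1%g.
Proof. by apply/funext => y; rewrite /power_map; congr (tup _ _); apply/funext => i; rewrite perm1. Qed.

Lemma diag_act_isometry (g : 'I_N -> G) : isometry_pair (diag_act (XN := XN) act g)
  (power_map (fun i => act (g ((1%g : 'S_N)^-1%g i))^-1%g) (1%g : 'S_N)^-1%g).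
Proof. 
rewrite diag_actE.
exact: (@power_map_isometry R n X N XN (fun i => act (g i)) (fun i => act (g i)^-1%g) 1%g
  (fun i => act_isometry_pair (g i))).
Qed.

Lemma perm_isometry (s : 'S_N) :
  isometry_pair (power_map (XN := XN) (fun=> id) s) (power_map (XN := XN) (fun=> id) s^-1%g).
Proof.
apply: (@power_map_isometry R n X N XN (fun=> id) (fun=> id) s) => i.
split => //; [exact: smooth_map_id|exact: smooth_map_id|move=> y].
by rewrite tangent_id trmx1 mulmx1 mul1mx.
Qed.

Lemma power_displaced (y : XN) : exists2 O : set XN, open O /\ O y &
  forall g : 'I_N -> G, g <> @fone G N -> forall z, O z -> ~ O (diag_act act g z).
Proof.
have [U HU] := @choice _ _ (fun i (U : set X) => (open U /\ U (pr i y)) /\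
    forall g y, U y -> U (act g y) -> g = 1%g)
  (fun i => let: ex_intro2 U a b := covering_displaced (pr i y) in ex_intro _ U (conj a b)).
exists (\bigcap_(i in [set: 'I_N]) (@pr R n X N XN i @^-1` U i)).
  split; last by move=> i _; exact: (HU i).1.2.
  rewrite openE => z Uz; rewrite /interior.
  have nU i : nbhs z (@pr R n X N XN i @^-1` U i).
    apply: open_nbhs_nbhs; split; last exact: (Uz i I).
    by apply: open_comp => [t _|]; [exact: pr_continuous|exact: (HU i).1.1].
  have nA : nbhs z [set t | forall i, U i (pr i t)] := filter_forall (nbhs_filter z) nU.
  by apply: filterS nA => t Ht i _; exact: Ht.
move=> g g1 z Oz Ogz; apply: g1; apply/funext => i.
have := Ogz i I; rewrite /= pr_tup => Ug.
by apply: ((HU i).2 _ _ (Oz i I) Ug).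
Qed.

Variable vol : {measure set (borel XN) -> \bar R}.
Hypothesis vol_XN : is_volume vol.
Variable L : L2_forms m vol.
Hypothesis G_infinite : infinite_set [set: G].

Lemma L2_wandering_system :
  wandering_system (L2_dot L) (group_op (L := L) act) (perm_op (L := L)).
Proof.
have [act1 actM actI] := act_isometric.
split.
- exact: L2_complete.
- exact: G_infinite.
- by move=> g; exact: (pullback_op_linear vol_XN (diag_act_isometry _)).
- by move=> g u; exact: (pullback_op_sqn vol_XN _ (diag_act_isometry _)).
- move=> u; rewrite -[RHS](pullback_op_id u) /group_op; congr (pullback_op _ u).
  by apply/funext => y; apply: power_ext => i; rewrite pr_tup /fone invg1 act1.
- move=> g h u; rewrite /group_op.
  apply: etrans _ (esym (pullback_op_comp vol_XN u (diag_act_isometry _) (diag_act_isometry _))).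
  congr (pullback_op _ u); apply/funext => y; apply: power_ext => i /=.
  by rewrite !pr_tup /fmul invMg actM.
- by move=> s; exact: (pullback_op_linear vol_XN (perm_isometry s)).
- by move=> s u; exact: (pullback_op_sqn vol_XN _ (perm_isometry s)).
- move=> u; rewrite -[RHS](pullback_op_id u) /perm_op; congr (pullback_op _ u).
  by apply/funext => y; apply: power_ext => i; rewrite pr_tup perm1.
- move=> s t u; rewrite /perm_op.
  apply: etrans _ (esym (pullback_op_comp vol_XN u (perm_isometry t) (perm_isometry s))).
  congr (pullback_op _ u); apply/funext => y; apply: power_ext => i /=.
  by rewrite !pr_power_map pr_tup permM.
- move=> s g u; rewrite /perm_op /group_op.
  apply: etrans (pullback_op_comp vol_XN u (perm_isometry s) (diag_act_isometry _)) _.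
  apply: etrans _ (esym (pullback_op_comp vol_XN u (diag_act_isometry _) (perm_isometry s))).
  congr (pullback_op _ u); apply/funext => y; apply: power_ext => i /=.
  by rewrite !pr_tup /fperm permK.
move=> v v0; have [w sw wv] := L2_class_surj v; rewrite -wv in v0 *.
have [||y|V [oV PV UV]] := @countable_cover XN (fun O => forall g : 'I_N -> G, g <> @fone G N ->
    forall z, O z -> ~ O (diag_act act g z)) (@msecond_countable R _ XN).
- by [].
- by move=> U V UV PV g g1 z /UV Vz /UV; exact: (PV g g1 z Vz).
- exact: power_displaced.
have mV k : measurable (V k : set (borel XN)) by exact: borel_open.
pose B k : set (borel XN) := seqDU V k.
have mB k : measurable (B k) by apply: measurableD => //; exact: bigsetU_measurable.
apply: (L2_cover_eq0 (B := B) sw mB (@trivIset_seqDU _ V)).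
  by rewrite -seqDU_bigcup_eq.
move=> k; apply/eqP; rewrite -(sqn_eq0 (L2_dot L)); apply/eqP.
have sB := square_integrable_restrict (mB k) sw.
apply: (@complexI R); rewrite -(L2_restrict L (mB k) sw); apply: v0 => g g1.
pose g' i := (g i)^-1%g.
have g'1 : g' <> @fone G N.
  by move=> E; apply: g1; apply/funext => i; have := congr1 (fun h => h i) E; rewrite /g' /fone => /(congr1 invg); rewrite invgK invg1.
rewrite /group_op (pullback_opE L vol_XN (diag_act_isometry _) sB).
apply: L2_disjoint => //; first exact: (square_integrable_pullback vol_XN (diag_act_isometry _)).
move=> y; have [yB|nyB] := pselect (B k y); last first.
  by right; apply/funext => u; rewrite /form_restrict memNset.
left; apply/funext => u; rewrite /pullback /form_restrict memNset // => -[Vy _].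
by apply: (PV k g' g'1 y) Vy; case: yB.
Qed.

End Action.

Theorem theorem4p3 (R : realType) (n : nat) (X K : riemannian R n)
    (G : groupType) (act : G -> X -> X) (p : X -> K)
    (X_connected : connected [set: X]) (K_compact : compact [set: K])
    (G_infinite : infinite_set [set: G]) (G_ICC : ICC G)
    (act_isometric : isometric_action act) (act_free : free_action act)
    (p_cover : galois_cover act p)
    (N m : nat) (N_ge2 : (2 <= N)%N) (m_le : (m <= N * n)%N)
    (XN : riem_power X N) (vol : {measure set (borel XN) -> \bar R})
    (vol_XN : is_volume vol) (L : L2_forms m vol)
    (A : falgType R[i]) (A_comm : commutative (@GRing.mul A))
    (ipA : {dot A for Num.conj})
    (pi : braid N -> A -> A) (pi_unitary : unitary_rep ipA pi)
    (A_pi : subalgebra (pure_fixed pi))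
    (T : htensor (L2_dot L) ipA)
    (T' : htensor (@ffun_dot R 'S_N L (L2_dot L)) ipA) :
  let M := M_alg (L := L) act in
  let Q := Q_alg (T := T) act in
  let Q_P := vn_gen (ht_dot T) (Q `|` [set P_U (T := T) pi]) in
  let crossed := crossed_product (L2_dot L) M (alpha_action (L := L)) in
  let crossed_End := vn_tensor (T := T') crossed (@End_alg R A) in
  let Q_U := vn_gen (ht_dot T) (Q `|` range (U_op (T := T) pi)) in
  [/\ vn_isomorphic (ht_dot T) Q_P (ht_dot T') crossed_End,
      vn_isomorphic (ht_dot T') crossed_End (ht_dot T) Q_U &
      vn_isomorphic (ht_dot T) Q_P (ht_dot T) Q_U].
Proof.
move=> M Q Q_P crossed crossed_End Q_U.
have [d [e [e_on e_basis]]] := orthonormal_basis ipA.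
have ws := L2_wandering_system act_isometric act_free p_cover vol_XN L G_infinite.
have pi_one b : phi b = 1%g -> pi b 1 = 1 by case: A_pi => H _ _; exact: H.
exact: (abstract_isomorphisms ws pi_unitary pi_one T T' e_on e_basis).
Qed.
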